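(* At least one of the following three statements is true: (1) there is no p-optimal propositional proof system; (2) $\mathsf{E}\not\subseteq \mathsf{P}/poly$; (3) there exists a function $h:\{0,1\}^*\to\{0,1\}^*$ with $|h(u)|=|u|+1$ for all $u$, computable in time $2^{O((\log n)^{\log\log n})}$ on inputs of length $n$, such that its range $Rng(h)$ intersects every infinite $\mathsf{NP}$ subset of $\{0,1\}^*$.
   Context: A propositional proof system is a polynomial-time computable function $P$ from $\{0,1\}^*$ onto the set of propositional tautologies (a string $\pi$ is a $P$-proof of $P(\pi)$). $P$ is p-optimal if for every propositional proof system $Q$ there is a polynomial-time function $f$ such that $P(f(\pi))=Q(\pi)$ for all $\pi$. $\mathsf E=\mathrm{DTIME}(2^{O(n)})$ and $\mathsf P/poly$ is the class of languages decided by polynomial-size Boolean circuit families. *)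

(* Defs.v *)
From Stdlib Require Import Reals.
From mathcomp Require Import all_boot.
From mathcomp Require Import boolp classical_sets functions cardinality.
Set Implicit Arguments.
Unset Strict Implicit.
Unset Printing Implicit Defensive.

Local Open Scope nat_scope.
Local Open Scope classical_set_scope.

Definition bitstring := seq bool.
Definition language := set bitstring.

(* The tape alphabet is {0, 1, blank}, blank being None. *)
Definition symbol := option bool.

Inductive move := MoveLeft | MoveStay | MoveRight.

(* A two-way infinite tape: the cells strictly to the left of the head, listed
   from right to left, and the cells from the head (included) rightwards.  All
   the cells that are not listed are blank. *)
Definition tape : eqType := (seq symbol * seq symbol)%type.

Definition tape_read (t : tape) : symbol := head None t.2.

Definition tape_write (a : symbol) (t : tape) : tape := (t.1, a :: behead t.2).

Definition tape_move (m : move) (t : tape) : tape :=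
  match m with
  | MoveLeft => (behead t.1, head None t.1 :: t.2)
  | MoveStay => t
  | MoveRight => (head None t.2 :: t.1, behead t.2)
  end.

Record machine := Machine {
  ntapes_pred : nat;
  state : finType;
  start : state;
  halting : pred state;
  delta : state -> {ffun 'I_ntapes_pred.+1 -> symbol} ->
          state * {ffun 'I_ntapes_pred.+1 -> symbol * move}
}.

Definition config (M : machine) : Type :=
  (state M * {ffun 'I_(ntapes_pred M).+1 -> tape})%type.

(* The input is on the first tape, with the head on its first bit. *)
Definition init_config (M : machine) (x : bitstring) : config M :=
  (start M, [ffun i => ([::], if i == ord0 then map some x else [::])]).

Definition step (M : machine) (c : config M) : config M :=
  if halting c.1 then c else
  let: (q, act) := delta c.1 [ffun i => tape_read (c.2 i)] in
  (q, [ffun i => tape_move (act i).2 (tape_write (act i).1 (c.2 i))]).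

Fixpoint bits_until_blank (s : seq symbol) : bitstring :=
  if s is Some b :: s' then b :: bits_until_blank s' else [::].

(* The output is on the last tape (which is also the input tape when there is
   only one), from the head up to the first blank. *)
Definition output (M : machine) (c : config M) : bitstring :=
  bits_until_blank (c.2 ord_max).2.

Definition computes_in_time (M : machine) (f : bitstring -> bitstring)
    (t : nat -> nat) : Prop :=
  forall x, exists s, [/\ s <= t (size x),
    halting (iter s (@step M) (init_config M x)).1 &
    output (iter s (@step M) (init_config M x)) = f x].

Definition poly_bounded (t : nat -> nat) : Prop :=
  exists c, forall n, t n <= n ^ c + c.

Definition exp_bounded (t : nat -> nat) : Prop :=
  exists c N, forall n, N <= n -> t n <= 2 ^ (c * n).

Definition log2 (x : R) : R := Rdiv (ln x) (ln (IZR 2)).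

(* t(n) = 2^{O((log n)^{log log n})}; the real-valued, base-2 logarithm is used
   because rounding it would change the class of bounds. *)
Definition subexp_bounded (t : nat -> nat) : Prop :=
  exists (c : R) (N : nat), forall n, N <= n ->
    Rle (INR (t n))
        (Rpower (IZR 2)
                (Rmult c (Rpower (log2 (INR n)) (log2 (log2 (INR n)))))).

Definition computable_in (bounded : (nat -> nat) -> Prop)
    (f : bitstring -> bitstring) : Prop :=
  exists M t, bounded t /\ computes_in_time M f t.

Definition polytime : (bitstring -> bitstring) -> Prop :=
  computable_in poly_bounded.

Definition decidable_in (bounded : (nat -> nat) -> Prop) (L : language) : Prop :=
  computable_in bounded (fun x => [:: `[< L x >]]).

Definition class_P : set language := [set L | decidable_in poly_bounded L].

Definition class_E : set language := [set L | decidable_in exp_bounded L].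

(* Self-delimiting code: every bit is preceded by 1, and a 0 marks the end. *)
Definition self_delim (x : bitstring) : bitstring :=
  flatten [seq [:: true; b] | b <- x] ++ [:: false].

Definition pair_code (x w : bitstring) : bitstring := self_delim x ++ w.

Definition class_NP : set language :=
  [set L | exists V c, class_P V /\
     forall x, L x <->
       exists w, size w <= size x ^ c + c /\ V (pair_code x w)].

(* A circuit is the list of its gates in topological order; the indices in
   GNot, GAnd, GOr are positions of earlier gates, the last gate is the output,
   and the size is the number of gates. *)
Inductive gate :=
  | GInput of nat
  | GConst of bool
  | GNot of nat
  | GAnd of nat & nat
  | GOr of nat & nat.

Definition circuit := seq gate.

(* [pos] is the position of the gate, [n] the number of inputs. *)
Definition gate_wf (n pos : nat) (g : gate) : bool :=
  match g with
  | GInput i => i < n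
  | GConst _ => true
  | GNot i => i < pos
  | GAnd i j | GOr i j => (i < pos) && (j < pos)
  end.

Definition circuit_wf (n : nat) (C : circuit) : Prop :=
  0 < size C /\
  forall pos, pos < size C -> gate_wf n pos (nth (GConst false) C pos).

Definition gate_val (x vals : seq bool) (g : gate) : bool :=
  match g with
  | GInput i => nth false x i
  | GConst b => b
  | GNot i => ~~ nth false vals i
  | GAnd i j => nth false vals i && nth false vals j
  | GOr i j => nth false vals i || nth false vals j
  end.

Definition circuit_eval (C : circuit) (x : bitstring) : bool :=
  last false (foldl (fun vals g => rcons vals (gate_val x vals g)) [::] C).

Definition class_Ppoly : set language :=
  [set L | exists C : nat -> circuit,
     [/\ forall n, circuit_wf n (C n),
         poly_bounded (fun n => size (C n)) &
         forall x, L x <-> circuit_eval (C (size x)) x]].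

(* The atoms are indexed by binary strings, so that the code below writes
   atom indices in binary. *)
Inductive formula :=
  | FAtom of bitstring
  | FConst of bool
  | FNot of formula
  | FAnd of formula & formula
  | FOr of formula & formula.

Fixpoint formula_eval (v : bitstring -> bool) (F : formula) : bool :=
  match F with
  | FAtom s => v s
  | FConst b => b
  | FNot G => ~~ formula_eval v G
  | FAnd G H => formula_eval v G && formula_eval v H
  | FOr G H => formula_eval v G || formula_eval v H
  end.

Definition tautology (F : formula) : Prop := forall v, formula_eval v F.

(* Polish notation with three-bit tags; this is a prefix-free code. *)
Fixpoint formula_code (F : formula) : bitstring :=
  match F with
  | FConst b => [:: false; false; b]
  | FNot G => [:: false; true; false] ++ formula_code G
  | FAnd G H => [:: false; true; true] ++ formula_code G ++ formula_code H
  | FOr G H => [:: true; false; false] ++ formula_code G ++ formula_code H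
  | FAtom s => [:: true; false; true] ++ self_delim s
  end.

Definition TAUT : language := formula_code @` [set F | tautology F].

Definition proof_system (P : bitstring -> bitstring) : Prop :=
  polytime P /\ range P = TAUT.

Definition p_optimal (P : bitstring -> bitstring) : Prop :=
  proof_system P /\
  forall Q, proof_system Q ->
    exists f, polytime f /\ forall pi, P (f pi) = Q pi.

(* Main.v *)
(** Let P be p-optimal and let E have polynomial-size circuits. The function h
reads a string as a description d of a test followed by B blocks of b - 1 bits,
and replaces each block by the b-bit string whose index, among the b-bit strings
passing the test, it encodes. If at most half of the strings pass, then every string
made of B passing blocks is in the range of h, the B bits gained paying for d.

The description d gives, by small circuits D, a purported computation table of a
machine M, and, by small circuits D', a prover for the sum-check protocol over a
prime field of polylogarithmic size, arguing that D violates no local constraint of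
the table. A block is the random bits of the verifier, and passes if the verifier
accepts: always if D is right and D' is honest, and at most half of the time if D
violates a constraint. The violated constraints are summed with random weights,
given by the first half of the block, so that the sum is nonzero.

Suppose that an infinite NP set A misses the range of h. Let M look for P-proofs of
the propositional formula sigma_n stating that no a in A of length n + 1 consists
of blocks passing a test about the run of M on n; this self-reference is possible
because M is only an input of the machine whose computations sigma_n speaks about.
If sigma_n fails, then, as a is not in the range of h, the table given by d is right,
so M has found a P-proof of sigma_n, and sigma_n holds after all. So all sigma_n are
tautologies; add them as axioms to P. By p-optimality they have P-proofs computable
in time polynomial in n. The bits of the run of M on those proofs, and the answers of
the honest prover, are then languages in E, so they have circuits of size
polylogarithmic in n, which is less than the bound (log n)^(log log n) allowed by h.
The corresponding d makes every long a in A refute sigma_n. *)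

Require Import Defs.
From Stdlib Require Reals Lra.
From mathcomp Require Import all_boot all_algebra zify.
From mathcomp Require Import boolp classical_sets functions cardinality.
Set Implicit Arguments.
Unset Strict Implicit.
Unset Printing Implicit Defensive.

(** * A structured stack language and its compilation to Turing machines *)

(** Why the test cannot simply check the table of M cell by cell: the exponents are chosen in the
    wrong order. The formula sigma_n is as long as the computations of the test that it describes; M
    has to write sigma_n down, and its table is larger still. So the exponent [eM] of the side of
    that table is known only after the exponent [eT] of the test. The test can only afford a check
    whose cost depends on n and on the lengths of D and D', whatever the size of the table; this is
    what the sum-check protocol provides. The protocol needs random bits, and a plays their part: if
    at most half of all blocks passed, a string of passing blocks would be compressible, so a string
    outside the range of h certifies a table that nobody has read in full.

    Times, positions and n are all written in binary in the queries about the table. This is why its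
    bits, as well as the answers of the prover, form languages in E on inputs of length only
    logarithmic, or polylogarithmic, in n. *)

Inductive cmd :=
  | Skip
  | Push of nat & bool
  | Pop of nat
  | Seq of cmd & cmd
  | Case of nat & cmd & cmd & cmd
  | While of nat & cmd.

Definition store := nat -> bitstring.

Definition upd (s : store) r w : store := fun i => if i == r then w else s i.

(* [Case r c0 cF cT] branches on whether register r is empty, has top false or
   has top true. *)
Definition branch (w : bitstring) (c0 cF cT : cmd) :=
  match w with [::] => c0 | false :: _ => cF | true :: _ => cT end.

(** A register will be a stack kept on one tape, with its top under the head, so every instruction
    costs a bounded number of machine steps. *)
Inductive exec : cmd -> store -> nat -> store -> Prop :=
  | ExSkip s : exec Skip s 1 s
  | ExPush s r b : exec (Push r b) s 1 (upd s r (b :: s r))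
  | ExPop s r : exec (Pop r) s 1 (upd s r (behead (s r)))
  | ExSeq s c1 c2 n1 n2 s1 s2 :
      exec c1 s n1 s1 -> exec c2 s1 n2 s2 -> exec (Seq c1 c2) s (n1 + n2) s2
  | ExCase s r c0 cF cT n s' :
      exec (branch (s r) c0 cF cT) s n s' -> exec (Case r c0 cF cT) s n.+1 s'
  | ExWhile0 s r c : s r = [::] -> exec (While r c) s 1 s
  | ExWhileS s r c n n' s' s'' :
      s r <> [::] -> exec c s n s' -> exec (While r c) s' n' s'' ->
      exec (While r c) s (n + n').+1 s''.

Fixpoint regs_below K c :=
  match c with
  | Skip => true
  | Push r _ | Pop r => r < K
  | Seq c1 c2 => regs_below K c1 && regs_below K c2
  | Case r c0 cF cT =>
      [&& r < K, regs_below K c0, regs_below K cF & regs_below K cT]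
  | While r c => (r < K) && regs_below K c
  end.

Section Compile.
Variable K : nat.

Definition reading := {ffun 'I_K.+1 -> symbol}.
Definition action := {ffun 'I_K.+1 -> symbol * move}.
Definition tapes := {ffun 'I_K.+1 -> tape}.

(** A piece of a transition table with one entry and one exit; the next state [None] is the exit, to
    be redirected when fragments are plugged together. *)
Record frag := Frag {
  fstate : finType;
  fentry : fstate;
  fdelta : fstate -> reading -> option fstate * action }.

Definition reads (ts : tapes) : reading := [ffun i => tape_read (ts i)].
Definition act_on (a : action) (ts : tapes) : tapes :=
  [ffun i => tape_move (a i).2 (tape_write (a i).1 (ts i))].

Inductive run (F : frag) : fstate F -> tapes -> nat -> tapes -> Prop :=
  | RunExit q ts a :
      fdelta q (reads ts) = (None, a) -> run q ts 1 (act_on a ts)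
  | RunStep q q' ts a n ts' :
      fdelta q (reads ts) = (Some q', a) -> run q' (act_on a ts) n ts' ->
      run q ts n.+1 ts'.

(** The parameter [ex] is what the exit of F becomes inside F': the exit of F' again, or a state
    from which F' goes on. This covers sequencing, branching and loops at once. *)
Lemma run_embed (F F' : frag) (inj : fstate F -> fstate F') ex :
  (forall q rd, fdelta (inj q) rd =
     (if (fdelta q rd).1 is Some q' then Some (inj q') else ex,
      (fdelta q rd).2)) ->
  forall q ts n ts', run q ts n ts' ->
  match ex with
  | None => run (inj q) ts n ts'
  | Some e => forall m ts'', run e ts' m ts'' -> run (inj q) ts (n + m) ts''
  end.
Proof.
move=> H q ts n ts'; elim=> {q ts n ts'} [q ts a E|q q' ts a n ts' E _ IH].
  case: ex H => [e|] H; last by apply: RunExit; rewrite H E.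
  by move=> m ts'' r; apply: RunStep r; rewrite H E.
case: ex H IH => [e|] H IH; last by apply: RunStep IH; rewrite H E.
by move=> m ts'' r; rewrite addSn; apply: RunStep (IH _ _ r); rewrite H E.
Qed.

Definition keep (rd : reading) : action := [ffun i => (rd i, MoveStay)].
Definition keep_but (rd : reading) (r : nat) (x : symbol * move) : action :=
  [ffun i => if nat_of_ord i == r then x else (rd i, MoveStay)].
Definition reg (rd : reading) (r : nat) : symbol := rd (inord r).

Definition skip_frag :=
  @Frag unit tt (fun _ rd => (None, keep rd)).
Definition pop_frag r :=
  @Frag unit tt (fun _ rd => (None, keep_but rd r (None, MoveRight))).
Definition push_frag r b :=
  @Frag bool false (fun q rd =>
    if q then (None, keep_but rd r (Some b, MoveStay))
    else (Some true, keep_but rd r (reg rd r, MoveLeft))).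
Definition seq_frag (F G : frag) :=
  @Frag (fstate F + fstate G)%type (inl (fentry F)) (fun q rd =>
    match q with
    | inl q => (if (fdelta q rd).1 is Some q' then Some (inl q')
                else Some (inr (fentry G)), (fdelta q rd).2)
    | inr q => (if (fdelta q rd).1 is Some q' then Some (inr q')
                else None, (fdelta q rd).2)
    end).
Definition case_frag r (F0 F1 F2 : frag) :=
  @Frag (unit + (fstate F0 + (fstate F1 + fstate F2)))%type (inl tt)
   (fun q rd =>
    match q with
    | inl _ => (Some (match reg rd r with
                      | None => inr (inl (fentry F0))
                      | Some false => inr (inr (inl (fentry F1)))
                      | Some true => inr (inr (inr (fentry F2))) end), keep rd)
    | inr (inl q) => (if (fdelta q rd).1 is Some q' then Some (inr (inl q'))
                      else None, (fdelta q rd).2)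
    | inr (inr (inl q)) =>
       (if (fdelta q rd).1 is Some q' then Some (inr (inr (inl q')))
        else None, (fdelta q rd).2)
    | inr (inr (inr q)) =>
       (if (fdelta q rd).1 is Some q' then Some (inr (inr (inr q')))
        else None, (fdelta q rd).2)
    end).
Definition while_frag r (F : frag) :=
  @Frag (unit + fstate F)%type (inl tt) (fun q rd =>
    match q with
    | inl _ => (if reg rd r is None then None else Some (inr (fentry F)),
                keep rd)
    | inr q => (if (fdelta q rd).1 is Some q' then Some (inr q')
                else Some (inl tt), (fdelta q rd).2)
    end).

Fixpoint compile c :=
  match c with
  | Skip => skip_frag
  | Push r b => push_frag r b
  | Pop r => pop_frag r
  | Seq c1 c2 => seq_frag (compile c1) (compile c2)
  | Case r c0 cF cT => case_frag r (compile c0) (compile cF) (compile cT)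
  | While r c => while_frag r (compile c)
  end.

(** The numbers of blanks are left free because moves create and consume explicitly listed blanks.
    Everything to the left of the head is blank, so a push always has room. *)
Definition tape_holds (t : tape) (w : bitstring) :=
  (exists l, t.1 = nseq l None) /\ (exists k, t.2 = map some w ++ nseq k None).

Definition tapes_hold (ts : tapes) (s : store) :=
  forall i : 'I_K.+1, tape_holds (ts i) (s i).

Lemma tape_holds_read t w : tape_holds t w -> tape_read t = ohead w.
Proof. by case: t => l r [_ /= [k ->]]; case: w => //; case: k. Qed.

Lemma tape_holds_keep t w : tape_holds t w ->
  tape_holds (tape_move MoveStay (tape_write (tape_read t) t)) w.
Proof.
move=> H; split; first by case: H.
case: H => _ [k E]; rewrite /= /tape_read E.
by case: w k {E} => [|b w] [|k]; [exists 1|exists k.+1|exists 0|exists k.+1].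
Qed.

Lemma tape_holds_pop t w : tape_holds t w ->
  tape_holds (tape_move MoveRight (tape_write None t)) (behead w).
Proof.
move=> [[l El] [k E]]; split; rewrite /= ?El; first by exists l.+1.
by rewrite E; case: w k {E} => [|b w] [|k]; [exists 0|exists k|exists 0|exists k.+1].
Qed.

Lemma tape_holds_push1 t w : tape_holds t w ->
  let t' := tape_move MoveLeft (tape_write (tape_read t) t) in
  (exists l, t'.1 = nseq l None) /\
  (exists k, behead t'.2 = map some w ++ nseq k None).
Proof.
move=> H /=; split; first by case: H => [[[|l] ->] _]; [exists 0|exists l].
by have [_] := tape_holds_keep H.
Qed.

Lemma tapes_hold_keep ts s : tapes_hold ts s ->
  tapes_hold (act_on (keep (reads ts)) ts) s.
Proof. by move=> H i; rewrite !ffunE; apply: tape_holds_keep. Qed.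

Lemma tapes_hold_reg ts s r : r < K.+1 -> tapes_hold ts s ->
  reg (reads ts) r = ohead (s r).
Proof.
by move=> Hr H; rewrite /reg ffunE (tape_holds_read (H _)) inordK.
Qed.

(** The factor 2 comes from [Push], the only instruction that takes two machine steps: one moves
    left, one writes. *)
Lemma compile_correct c s n s' : exec c s n s' -> regs_below K.+1 c ->
  forall ts, tapes_hold ts s ->
  exists m ts', [/\ m <= 2 * n, run (fentry (compile c)) ts m ts' &
                    tapes_hold ts' s'].
Proof.
elim=> {c s n s'}.
- move=> s _ ts H; exists 1, (act_on (keep (reads ts)) ts); split=> //.
    exact: RunExit.
  exact: tapes_hold_keep.
- move=> s r b /= Hr ts H.
  pose ts1 := act_on (keep_but (reads ts) r (reg (reads ts) r, MoveLeft)) ts.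
  pose ts2 := act_on (keep_but (reads ts1) r (Some b, MoveStay)) ts1.
  exists 2, ts2; split=> //.
    apply: (@RunStep (push_frag r b) false true ts
      (keep_but (reads ts) r (reg (reads ts) r, MoveLeft)) 1) => //.
    exact: RunExit.
  move=> i; rewrite /ts2 /ts1 !ffunE /upd /=.
  case: eqP => [E|_]; last by do 2!apply: tape_holds_keep.
  have := tape_holds_push1 (H i).
  rewrite /reg ffunE -E inord_val => -[[l El] [k Ek]]; split.
    by exists l.
  by exists k; move: Ek => /= ->.
- move=> s r /= Hr ts H; exists 1, (act_on (keep_but (reads ts) r (None, MoveRight)) ts).
  split=> //; first exact: RunExit.
  move=> i; rewrite !ffunE /upd; case: eqP => [E|_]; last exact: tape_holds_keep.
  by rewrite -E; apply: tape_holds_pop.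
- move=> s c1 c2 n1 n2 s1 s2 _ IH1 _ IH2 /= /andP[R1 R2] ts H.
  have [m1 [ts1 [L1 U1 H1]]] := IH1 R1 _ H.
  have [m2 [ts2 [L2 U2 H2]]] := IH2 R2 _ H1.
  exists (m1 + m2), ts2; split=> //; first by rewrite mulnDr leq_add.
  have := @run_embed (compile c1) (seq_frag (compile c1) (compile c2)) inl
    (Some (inr (fentry (compile c2)))) (fun _ _ => erefl) _ _ _ _ U1.
  apply.
  exact: (@run_embed (compile c2) (seq_frag (compile c1) (compile c2)) inr
    None (fun _ _ => erefl)).
- move=> s r c0 cF cT n s' _ IH /= /and4P[Rr R0 RF RT] ts H.
  have Rb : regs_below K.+1 (branch (s r) c0 cF cT).
    by rewrite /branch; case: (s r) => // -[].
  have [m [ts' [L U H']]] := IH Rb _ (tapes_hold_keep H).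
  exists m.+1, ts'; split=> //; first by lia.
  have Er := tapes_hold_reg Rr H.
  move: U Er; rewrite /branch; case: (s r) => [|[] w] U /= Er.
  + apply: (@RunStep (case_frag r _ _ _) (inl tt) (inr (inl (fentry (compile c0)))) _ (keep (reads ts))).
      by rewrite /= Er.
    exact: (@run_embed (compile c0) (case_frag r _ _ _) (fun q => inr (inl q)) None).
  + apply: (@RunStep (case_frag r _ _ _) (inl tt) (inr (inr (inr (fentry (compile cT))))) _ (keep (reads ts))).
      by rewrite /= Er.
    exact: (@run_embed (compile cT) (case_frag r _ _ _)
             (fun q => inr (inr (inr q))) None).
  + apply: (@RunStep (case_frag r _ _ _) (inl tt) (inr (inr (inl (fentry (compile cF))))) _ (keep (reads ts))).
      by rewrite /= Er.
    exact: (@run_embed (compile cF) (case_frag r _ _ _)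
             (fun q => inr (inr (inl q))) None).
- move=> s r c E /= /andP[Rr Rc] ts H.
  exists 1, (act_on (keep (reads ts)) ts); split=> //; last exact: tapes_hold_keep.
  by apply: RunExit; rewrite /= (tapes_hold_reg Rr H) E.
- move=> s r c n n' s' s'' E _ IH1 _ IH2 /= /andP[Rr Rc] ts H.
  have [m1 [ts1 [L1 U1 H1]]] := IH1 Rc _ (tapes_hold_keep H).
  have [|m2 [ts2 [L2 U2 H2]]] := IH2 _ _ H1; first by rewrite /= Rr.
  exists (m1 + m2).+1, ts2; split=> //; first by lia.
  apply: (@RunStep (while_frag r _) (inl tt) (inr (fentry (compile c))) _ (keep (reads ts))).
    by rewrite /= (tapes_hold_reg Rr H); case: (s r) E => // -[].
  have := @run_embed (compile c) (while_frag r (compile c)) inr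
    (Some (inl tt)) (fun _ _ => erefl) _ _ _ _ U1.
  by apply.
Qed.

Definition frag_machine (F : frag) : machine :=
  @Machine K (option (fstate F)) (Some (fentry F)) (fun q => q == None)
    (fun q rd => if q is Some q' then fdelta q' rd else (None, keep rd)).

Lemma run_machine (F : frag) (q : fstate F) ts n ts' : run q ts n ts' ->
  iter n (@step (frag_machine F)) (Some q, ts) = (None, ts').
Proof.
elim=> {q ts n ts'} [q ts a E|q q' ts a n ts' E _ IH].
  by rewrite /= /step /= -/(reads ts) E.
by rewrite iterSr /= -IH /step /= -/(reads ts) E.
Qed.

Lemma exec_machine c x y (s : store) n s' :
  regs_below K.+1 c -> (forall i, s i = if i == 0 then x else [::]) ->
  exec c s n s' -> s' K = y ->
  exists m, [/\ m <= 2 * n,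
    halting (iter m (@step (frag_machine (compile c)))
               (init_config (frag_machine (compile c)) x)).1 &
    output (iter m (@step (frag_machine (compile c)))
               (init_config (frag_machine (compile c)) x)) = y].
Proof.
move=> Rc Hs Hc Ey.
set M := frag_machine _.
have H0 : tapes_hold (init_config M x).2 s.
  move=> i; rewrite ffunE Hs; split; first by exists 0.
  by exists 0; rewrite cats0 -val_eqE /=; case: ifP.
have [m [ts' [L U H]]] := compile_correct Hc Rc H0.
exists m; rewrite /init_config /= (run_machine U); split=> //.
rewrite /output /=; have [_ [k ->]] := H ord_max.
rewrite [nat_of_ord _]/= Ey; elim: y {Ey} => [|b y IH] /=; last by rewrite IH.
by case: k.
Qed.

End Compile.

(** * Time-bounded string functions *)

(** Runs a program as a subroutine on the registers from d on, while the registers below d hold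
    saved data. *)
Fixpoint shift d c :=
  match c with
  | Skip => Skip
  | Push r b => Push (r + d) b
  | Pop r => Pop (r + d)
  | Seq c1 c2 => Seq (shift d c1) (shift d c2)
  | Case r c0 cF cT => Case (r + d) (shift d c0) (shift d cF) (shift d cT)
  | While r c => While (r + d) (shift d c)
  end.

Lemma regs_below_shift d K c : regs_below K c -> regs_below (K + d) (shift d c).
Proof.
elim: c => //=; try by move=> *; lia.
Qed.

Lemma regs_below_leq K K' c : K <= K' -> regs_below K c -> regs_below K' c.
Proof.
move=> L; elim: c => //=; try by move=> *; lia.
Qed.

Lemma exec_shift d c s n s' : exec c s n s' ->
  forall S, (forall i, S (i + d) = s i) ->
  exists S', [/\ exec (shift d c) S n S', forall i, S' (i + d) = s' i &
                 forall i, i < d -> S' i = S i].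
Proof.
have updE s0 S r w : (forall i, S (i + d) = s0 i) ->
    (forall i, upd S (r + d) w (i + d) = upd s0 r w i) /\
    (forall i, i < d -> upd S (r + d) w i = S i).
  move=> H; rewrite /upd; split=> i; first by rewrite eqn_add2r H.
  by case: eqP => // ->; lia.
elim=> {c s n s'}.
- by move=> s S H; exists S; split=> //; constructor.
- move=> s r b S H; have [A B] := updE _ _ r (b :: s r) H.
  by exists (upd S (r + d) (b :: S (r + d))); rewrite H; split=> //; rewrite -H; constructor.
- move=> s r S H; have [A B] := updE _ _ r (behead (s r)) H.
  by exists (upd S (r + d) (behead (S (r + d)))); rewrite H; split=> //; rewrite -H; constructor.
- move=> s c1 c2 n1 n2 s1 s2 _ IH1 _ IH2 S H.
  have [S1 [X1 A1 B1]] := IH1 _ H; have [S2 [X2 A2 B2]] := IH2 _ A1.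
  exists S2; split=> //; first exact: ExSeq X1 X2.
  by move=> i L; rewrite B2 // B1.
- move=> s r c0 cF cT n s' _ IH S H; have [S' [X A B]] := IH _ H.
  exists S'; split=> //; apply: ExCase; rewrite H.
  by move: X; rewrite /branch; case: (s r) => // -[].
- by move=> s r c E S H; exists S; split=> //; apply: ExWhile0; rewrite H.
- move=> s r c n n' s' s'' E _ IH1 _ IH2 S H.
  have [S1 [X1 A1 B1]] := IH1 _ H; have [S2 [X2 A2 B2]] := IH2 _ A1.
  exists S2; split=> //; first by apply: ExWhileS X1 X2; rewrite H.
  by move=> i L; rewrite B2 // B1.
Qed.

Lemma exec_size c s n s' : exec c s n s' -> forall r, size (s' r) <= size (s r) + n.
Proof.
elim=> {c s n s'}.
- by move=> s r; lia.
- by move=> s r b i; rewrite /upd; case: eqP => [->|_] /=; lia.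
- by move=> s r i; rewrite /upd; case: eqP => [->|_] /=; rewrite ?size_behead; lia.
- by move=> s c1 c2 n1 n2 s1 s2 _ IH1 _ IH2 r; have := IH1 r; have := IH2 r; lia.
- by move=> s r c0 cF cT n s' _ IH i; have := IH i; lia.
- by move=> *; lia.
- by move=> s r c n n' s1 s2 _ _ IH1 _ IH2 i; have := IH1 i; have := IH2 i; lia.
Qed.

(** Scratch registers are empty before and again after the run, and registers from K on are left
    alone whatever they contain; so programs compose without cleaning up. The time depends on the
    input itself, which later allows bounds on a subset of the inputs. *)
Definition computes K c (f : bitstring -> bitstring) (t : bitstring -> nat) :=
  regs_below K c /\ forall s, (forall i, 0 < i < K -> s i = [::]) ->
    exists n, n <= t (s 0) /\ exec c s n (upd s 0 (f (s 0))).

Definition timed f t := exists K c, computes K c f t.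

Lemma timed_size f t x : timed f t -> size (f x) <= size x + t x.
Proof.
move=> [K [c [_ H]]].
have [|n [L /exec_size X]] := H (upd (fun=> [::]) 0 x).
  by move=> i /andP[i0 _]; rewrite /upd; case: eqP i0 => // ->.
by have := X 0; rewrite /upd /= in L *; lia.
Qed.

Lemma computes_shift K c f t d S : computes K c f t ->
  (forall i, d < i < d + K -> S i = [::]) ->
  exists n, n <= t (S d) /\ exec (shift d c) S n (upd S d (f (S d))).
Proof.
move=> [R H] E; have [|n [L X]] := H (fun i => S (i + d)).
  by move=> i /andP[? ?]; apply: E; apply/andP; split; lia.
exists n; split=> //.
have [S' [X' A B]] := exec_shift X (fun=> erefl).
suff -> : upd S d (f (S d)) = S' by [].
apply: funext => i; case: (ltnP i d) => Hi.
  by rewrite B // /upd; case: eqP => // E1; lia.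
by rewrite -(subnK Hi) A /upd (_ : (i - d + d == d) = (i - d == 0)) //; lia.
Qed.

(** * Moving, copying and coding the contents of registers *)

Lemma exec_leq c s n s' s'' : exec c s n s' -> s' = s'' -> exec c s n s''.
Proof. by move=> H <-. Qed.

Definition eat a (body : bool -> cmd) :=
  While a (Case a Skip (Seq (Pop a) (body false)) (Seq (Pop a) (body true))).

(** A body that neither reads nor changes register a makes the loop a fold over its content. Each
    bit costs the body plus [While], [Case] and [Pop]. *)
Lemma exec_eat a body (g : bool -> store -> store) k :
  (forall b s, exec (body b) s k (g b s)) ->
  (forall b s, g b s a = s a) ->
  (forall b s w, upd (g b s) a w = g b (upd s a w)) ->
  forall s, exec (eat a body) s ((k + 3) * size (s a) + 1)
    (foldl (fun s b => g b s) (upd s a [::]) (s a)).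
Proof.
move=> Hb Ha Hu s; move E: (s a) => w; elim: w s E => [|b w IH] s E /=.
  rewrite muln0; have -> : upd s a [::] = s.
    by apply: funext => i; rewrite /upd; case: eqP => // ->.
  exact: ExWhile0.
have -> : (k + 3) * (size w).+1 + 1 = (((1 + k).+1) + ((k + 3) * size w + 1)).+1 by lia.
apply: (@ExWhileS _ _ _ _ _ (g b (upd s a w))); first by rewrite E.
  apply: ExCase; rewrite E /branch.
  have X : exec (Seq (Pop a) (body b)) s (1 + k) (g b (upd s a w)).
    apply: ExSeq (Hb _ _); have := ExPop s a; by rewrite E.
  by case: b {E} X.
have := IH (g b (upd s a w)); rewrite Ha {1}/upd eqxx => /(_ erefl).
rewrite Hu /upd; congr (exec _ _ _ (foldl _ (g b _) _)).
by apply: funext => i; case: eqP.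
Qed.

Lemma upd_eq s r w i : i = r -> upd s r w i = w.
Proof. by move->; rewrite /upd eqxx. Qed.

Lemma upd_neq s r w i : i != r -> upd s r w i = s i.
Proof. by rewrite /upd => /negbTE ->. Qed.

Lemma exec_cast c s n n' s' s'' :
  exec c s n s' -> n = n' -> s' = s'' -> exec c s n' s''.
Proof. by move=> H <- <-. Qed.

(** Reverses the content, as any transfer between stacks does. *)
Definition mv a b := eat a (Push b).

Lemma foldl_push b s w : foldl (fun s x => upd s b (x :: s b)) s w = upd s b (rev w ++ s b).
Proof.
elim: w s => [|x w IH] s /=.
  by apply: funext => i; rewrite /upd; case: eqP => // ->.
rewrite IH rev_cons cat_rcons; apply: funext => i; rewrite /upd eqxx.
by case: eqP.
Qed.

Lemma exec_mv a b s : a != b -> exec (mv a b) s (4 * size (s a) + 1)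
  (upd (upd s a [::]) b (rev (s a) ++ s b)).
Proof.
move=> ab.
apply: exec_cast (@exec_eat a (Push b) (fun x s => upd s b (x :: s b)) 1 _ _ _ s) _ _ => //.
- by move=> x s0; apply: ExPush.
- by move=> x s0; rewrite /upd (negbTE ab).
- move=> x s0 w; apply: funext => i; rewrite /upd.
  by rewrite [b == a]eq_sym (negbTE ab); case: eqP => // ->; rewrite (negbTE ab).
by rewrite foldl_push upd_neq // eq_sym.
Qed.

Definition cp2 a b c := eat a (fun x => Seq (Push b x) (Push c x)).

Lemma exec_cp2 a b c s : a != b -> a != c -> b != c ->
  exec (cp2 a b c) s (5 * size (s a) + 1)
  (upd (upd (upd s a [::]) b (rev (s a) ++ s b)) c (rev (s a) ++ s c)).
Proof.
move=> ab ac bc.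
pose g x s := upd (upd s b (x :: s b)) c (x :: s c).
apply: exec_cast (@exec_eat a (fun x => Seq (Push b x) (Push c x)) g 2 _ _ _ s) _ _ => //.
- move=> x s0; rewrite /g; have -> : x :: s0 c = x :: (upd s0 b (x :: s0 b)) c.
    by rewrite /upd eq_sym (negbTE bc).
  by apply: (@ExSeq _ _ _ 1 1); constructor.
- by move=> x s0; rewrite /g /upd (negbTE ab) (negbTE ac).
- move=> x s0 w; apply: funext => i; rewrite /g /upd.
  rewrite [b == a]eq_sym [c == a]eq_sym (negbTE ab) (negbTE ac).
  by case: eqP => // ->; rewrite (negbTE ac) (negbTE ab).
have F w s0 : foldl (fun s x => g x s) s0 w =
    upd (upd s0 b (rev w ++ s0 b)) c (rev w ++ s0 c).
  elim: w s0 => [|x w IH] s0 /=.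
    by apply: funext => i; rewrite /upd; do 2!case: eqP => [->|] //.
  rewrite IH rev_cons !cat_rcons /g; apply: funext => i; rewrite /upd !eqxx.
  by rewrite (negbTE bc); do 2!case: eqP => // ?.
rewrite F; congr (upd (upd _ _ (_ ++ _)) _ (_ ++ _));
  by rewrite upd_neq // eq_sym.
Qed.

Definition enc2 a b := eat a (fun x => Seq (Push b x) (Push b true)).
Definition sd (w : bitstring) := flatten [seq [:: true; x] | x <- w].

Lemma exec_enc2 a b s : a != b -> exec (enc2 a b) s (5 * size (s a) + 1)
  (upd (upd s a [::]) b (sd (rev (s a)) ++ s b)).
Proof.
move=> ab; pose g x s := upd s b [:: true, x & s b].
apply: exec_cast (@exec_eat a (fun x => Seq (Push b x) (Push b true)) g 2 _ _ _ s) _ _ => //.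
- move=> x s0; have -> : g x s0 = upd (upd s0 b (x :: s0 b)) b
     (true :: (upd s0 b (x :: s0 b)) b).
    by apply: funext => i; rewrite /g /upd eqxx; case: eqP.
  by apply: (@ExSeq _ _ _ 1 1); constructor.
- by move=> x s0; rewrite /g /upd (negbTE ab).
- move=> x s0 w; apply: funext => i; rewrite /g /upd.
  by rewrite [b == a]eq_sym (negbTE ab); case: eqP => // ->; rewrite (negbTE ab).
have F w s0 : foldl (fun s x => g x s) s0 w = upd s0 b (sd (rev w) ++ s0 b).
  elim: w s0 => [|x w IH] s0 /=.
    by apply: funext => i; rewrite /upd; case: eqP => // ->.
  rewrite IH /g rev_cons /sd map_rcons flatten_rcons -catA /=.
  by apply: funext => i; rewrite /upd eqxx; case: eqP.
by rewrite F; congr (upd _ _ (_ ++ _)); rewrite upd_neq // eq_sym.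
Qed.

Definition clear a := eat a (fun=> Skip).
Lemma exec_clear a s : exec (clear a) s (4 * size (s a) + 1) (upd s a [::]).
Proof.
apply: exec_cast (@exec_eat a (fun=> Skip) (fun=> id) 1 _ _ _ s) _ _ => //.
  by move=> *; apply: ExSkip.
by elim: (s a).
Qed.

Lemma pair_codeE x w : pair_code x w = sd x ++ false :: w.
Proof. by rewrite /pair_code /self_delim -catA. Qed.

(* A total inverse of [pair_code]; the first component is accumulated in
   reverse in [acc]. *)
Fixpoint unpair_rec acc (x : bitstring) : bitstring * bitstring :=
  match x with
  | true :: b :: x' => unpair_rec (b :: acc) x'
  | false :: x' => (acc, x')
  | _ => (acc, [::])
  end.
Definition pfst x := rev (unpair_rec [::] x).1.
Definition psnd x := (unpair_rec [::] x).2.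

Lemma unpair_rec_sd acc x w :
  unpair_rec acc (sd x ++ false :: w) = (rev x ++ acc, w).
Proof. by elim: x acc => [|b x IH] acc //=; rewrite IH rev_cons cat_rcons. Qed.

Lemma pfst_pair x w : pfst (pair_code x w) = x.
Proof. by rewrite /pfst pair_codeE unpair_rec_sd cats0 revK. Qed.
Lemma psnd_pair x w : psnd (pair_code x w) = w.
Proof. by rewrite /psnd pair_codeE unpair_rec_sd. Qed.

Lemma size_unpair_rec acc x :
  size (unpair_rec acc x).1 + size (unpair_rec acc x).2 <= size acc + size x.
Proof.
have [n le_n] := ubnP (size x); elim: n x acc le_n => // n IH [|[] [|b x]] acc //= le_n; try lia.
by have := IH x (b :: acc); rewrite /=; lia.
Qed.
Lemma size_psnd x : size (psnd x) <= size x.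
Proof. by have := size_unpair_rec [::] x; rewrite /psnd /=; lia. Qed.
Lemma size_pfst x : size (pfst x) <= size x.
Proof. by have := size_unpair_rec [::] x; rewrite /pfst size_rev /=; lia. Qed.

(** Register 1 is a flag that stays up until the end marker is met, since the loop test can only see
    emptiness. Register 2 collects the first component, hence in reverse. *)
Definition decode := Seq (Push 1 true) (While 1 (Case 0 (Pop 1)
  (Seq (Pop 0) (Pop 1))
  (Seq (Pop 0) (Case 0 (Pop 1) (Seq (Pop 0) (Push 2 false))
                               (Seq (Pop 0) (Push 2 true)))))).

Ltac regs := apply: funext; do 6?[case] => //= *; rewrite /upd /=; do ?[by []].

Lemma exec_decode s : s 1 = [::] -> s 2 = [::] ->
  exists n, n <= 7 * size (s 0) + 7 /\
  exec decode s n (upd (upd s 0 (psnd (s 0))) 2 (rev (pfst (s 0)))).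
Proof.
move=> s1 s2.
have L : forall m w acc s, size w < m -> s 0 = w -> s 1 = [:: true] -> s 2 = acc ->
  exists n, n <= 7 * size w + 6 /\
  exec (While 1 (Case 0 (Pop 1)
  (Seq (Pop 0) (Pop 1))
  (Seq (Pop 0) (Case 0 (Pop 1) (Seq (Pop 0) (Push 2 false))
                               (Seq (Pop 0) (Push 2 true)))))) s n
   (upd (upd (upd s 0 (unpair_rec acc w).2) 2 (unpair_rec acc w).1) 1 [::]).
  elim=> // m IH [|[] [|b w]] acc {s1 s2}s Lm s0 s1 s2 //.
  - exists ((2 + 1).+1); split; first by [].
    apply: (@ExWhileS _ _ _ 2 1 (upd s 1 [::])); rewrite ?s1 //.
      by apply: ExCase; rewrite s0 /=; have := ExPop s 1; rewrite s1.
    apply: exec_leq; first by apply: ExWhile0; rewrite upd_eq.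
    by regs.
  - exists (((1 + 2).+1 + 1).+1); split; first by [].
    apply: (@ExWhileS _ _ _ _ _ (upd (upd s 0 [::]) 1 [::])); rewrite ?s1 //.
      apply: ExCase; rewrite s0 /=; apply: ExSeq; first exact: ExPop.
      apply: ExCase; rewrite s0 /=.
      by apply: exec_leq; [exact: ExPop|regs; rewrite s1].
    apply: exec_leq; first by apply: ExWhile0; rewrite upd_eq.
    by regs.
  - case: (IH w (b :: acc) (upd (upd s 0 w) 2 (b :: acc))) => //.
      by move: Lm => /=; lia.
    move=> n [Ln X].
    exists (((1 + (1 + 1).+1).+1 + n).+1); split; first by move: Ln; rewrite /=; lia.
    apply: (@ExWhileS _ _ _ _ _ (upd (upd s 0 w) 2 (b :: acc))); rewrite ?s1 //.
      apply: ExCase; rewrite s0 /=; apply: ExSeq; first exact: ExPop.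
      apply: ExCase; rewrite s0 /=; case: b Lm s0 X => Lm s0 X /=;
      (apply: ExSeq; [exact: ExPop| apply: exec_leq; [exact: ExPush|]]);
      by regs; rewrite s2.
    apply: exec_leq; first exact: X.
    by regs.
  - exists (((1 + 1).+1 + 1).+1); split; first by rewrite /=; lia.
    apply: (@ExWhileS _ _ _ _ _ (upd (upd s 0 [::]) 1 [::])); rewrite ?s1 //.
      apply: ExCase; rewrite s0 /=; apply: ExSeq; first exact: ExPop.
      by apply: exec_leq; [exact: ExPop|regs; rewrite ?s0 ?s1].
    apply: exec_leq; first by apply: ExWhile0; rewrite upd_eq.
    by regs.
  - exists (((1 + 1).+1 + 1).+1); split; first by rewrite /=; lia.
    apply: (@ExWhileS _ _ _ _ _ (upd (upd s 0 (b :: w)) 1 [::])); rewrite ?s1 //.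
      apply: ExCase; rewrite s0 /=; apply: ExSeq; first exact: ExPop.
      by apply: exec_leq; [exact: ExPop|regs; rewrite ?s0 ?s1].
    apply: exec_leq; first by apply: ExWhile0; rewrite upd_eq.
    by regs.
case: (L (size (s 0)).+1 (s 0) [::] (upd s 1 [:: true])) => // n [Ln X].
exists (1 + n); split; first by lia.
apply: ExSeq; first by have := ExPush s 1 true; rewrite s1; apply.
apply: exec_leq; first exact: X.
by rewrite /psnd /pfst revK; regs.
Qed.

Lemma timed_id : timed id (fun=> 1).
Proof.
exists 1, Skip; split=> // s H; exists 1; split=> //.
by apply: exec_cast (ExSkip s) _ _ => //; apply: funext => i; rewrite /upd; case: eqP => // ->.
Qed.

Lemma computes_weaken K K' c f t : K <= K' -> computes K c f t -> computes K' c f t.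
Proof.
move=> L [R H]; split; first exact: regs_below_leq R.
by move=> s E; apply: H => i /andP[a b]; apply: E; lia.
Qed.

Lemma timed_comp f g t u : timed f t -> timed g u ->
  timed (fun x => g (f x)) (fun x => t x + u (f x)).
Proof.
move=> [K1 [c1 H1]] [K2 [c2 H2]]; pose K := maxn K1 K2.
have [R1 {}H1] := computes_weaken (leq_maxl K1 K2) H1.
have [R2 {}H2] := computes_weaken (leq_maxr K1 K2) H2.
exists K, (Seq c1 c2); split=> /=; first by rewrite R1 R2.
move=> s E; have [n1 [L1 X1]] := H1 s E.
have [|n2 [L2 X2]] := H2 (upd s 0 (f (s 0))).
  by move=> i /andP[i0 iK]; rewrite upd_neq -?lt0n // E ?i0.
move: L2 X2; rewrite upd_eq // => L2 X2; exists (n1 + n2); split; first lia.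
by apply: exec_cast (ExSeq X1 X2) _ _ => //; apply: funext => i; rewrite /upd; case: eqP.
Qed.

Lemma timed_cons b : timed (cons b) (fun=> 1).
Proof.
exists 1, (Push 0 b); split=> // s H; exists 1; split=> //; exact: ExPush.
Qed.

Lemma timed_behead : timed behead (fun=> 1).
Proof.
exists 1, (Pop 0); split=> // s H; exists 1; split=> //; exact: ExPop.
Qed.

Lemma timed_case f0 fF fT t0 tF tT : timed f0 t0 -> timed fF tF -> timed fT tT ->
  timed (fun x => match x with [::] => f0 x | false :: _ => fF x | true :: _ => fT x end)
        (fun x => (match x with [::] => t0 x | false :: _ => tF x | true :: _ => tT x end).+1).
Proof.
move=> [K0 [c0 H0]] [K1 [c1 H1]] [K2 [c2 H2]]; pose K := (K0 + K1 + K2).+1.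
have [R0 {}H0] : computes K c0 f0 t0 by apply: computes_weaken H0; rewrite /K; lia.
have [R1 {}H1] : computes K c1 fF tF by apply: computes_weaken H1; rewrite /K; lia.
have [R2 {}H2] : computes K c2 fT tT by apply: computes_weaken H2; rewrite /K; lia.
exists K, (Case 0 c0 c1 c2); split=> /=; first by rewrite R0 R1 R2 /K.
move=> s E; case: (H0 s E) (H1 s E) (H2 s E) => n0 [L0 X0] [n1 [L1 X1]] [n2 [L2 X2]].
case E0 : (s 0) X0 X1 X2 L0 L1 L2 => [|[] w] X0 X1 X2 L0 L1 L2;
 [exists n0.+1|exists n2.+1|exists n1.+1]; (split; [lia|]); apply: ExCase; rewrite E0 //.
Qed.

Lemma timed_pair f g t u : timed f t -> timed g u ->
  timed (fun x => pair_code (f x) (g x))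
        (fun x => 40 * (size x + size (f x) + size (g x) + 1) + t x + u x).
Proof.
move=> [K1 [c1 H1]] [K2 [c2 H2]].
pose K := (K1 + K2 + 4).
(* Register 1 gets a copy of x and turns it into [g x]; then x goes to register 2 and becomes [f x];
   finally [f x] is encoded in front of [g x] in register 0. Detours through register 3 undo
   reversals. *)
exists K, (Seq (mv 0 2) (Seq (cp2 2 0 1) (Seq (shift 1 c2) (Seq (mv 0 3)
  (Seq (mv 3 2) (Seq (shift 2 c1) (Seq (mv 1 3) (Seq (mv 3 0) (Seq (mv 2 3)
   (Seq (Push 0 false) (enc2 3 0))))))))))); split.
  have R1 := regs_below_shift 2 (proj1 H1); have R2 := regs_below_shift 1 (proj1 H2).
  rewrite /= !(regs_below_leq _ R1) ?(regs_below_leq _ R2) /K; lia.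
move=> s E; have Es i : 0 < i < K -> s i = [::] by apply: E.
have [s1 s2 s3] : [/\ s 1 = [::], s 2 = [::] & s 3 = [::]] by split; apply: E; rewrite /K; lia.
set x := s 0.
pose S1 := upd s 1 x.
pose S2 := upd s 1 (g x).
have [|n2 [L2 X2]] := @computes_shift _ _ _ _ 1 S1 H2.
  by move=> i Hi; rewrite /S1 upd_neq ?Es //; rewrite /K; lia.
pose S3 := upd (upd (upd s 0 [::]) 1 (g x)) 2 x.
have [|n1 [L1 X1]] := @computes_shift _ _ _ _ 2 S3 H1.
  by move=> i Hi; rewrite /S3 !upd_neq ?Es //; rewrite /K; lia.
have {}L2 : n2 <= u x by move: L2; rewrite /S1 upd_eq.
have {}L1 : n1 <= t x by move: L1; rewrite /S3 upd_eq.
exists (4 * size x + 1 + (5 * size x + 1 + (n2 + (4 * size x + 1 + (4 * size x + 1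
  + (n1 + (4 * size (g x) + 1 + (4 * size (g x) + 1 + (4 * size (f x) + 1 +
  (1 + (5 * size (f x) + 1))))))))))).
split; first lia.
have M (a b : nat) (S S' : store) n : a != b -> n = 4 * size (S a) + 1 ->
  S' = upd (upd S a [::]) b (rev (S a) ++ S b) -> exec (mv a b) S n S'.
  by move=> ab -> ->; apply: exec_mv.
apply: (@ExSeq _ _ _ _ _ (upd (upd s 0 [::]) 2 (rev x))).
  by apply: M => //; rewrite s2 cats0.
apply: (@ExSeq _ _ _ _ _ S1).
  apply: exec_cast; first by apply: exec_cp2.
    by rewrite upd_eq // size_rev.
  by rewrite /S1; regs; rewrite ?s1 ?s2 ?cats0 ?revK.
apply: (@ExSeq _ _ _ _ _ S2).
  by apply: exec_cast X2 _ _ => //; rewrite /S1 /S2; regs.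
apply: (@ExSeq _ _ _ _ _ (upd (upd (upd s 0 [::]) 1 (g x)) 3 (rev x))).
  by apply: M => //; rewrite /S2; regs; rewrite s3 cats0.
apply: (@ExSeq _ _ _ _ _ S3).
  apply: M => //; first by rewrite upd_eq // size_rev.
  by rewrite /S3; regs; rewrite ?s2 ?s3 ?cats0 ?revK.
apply: (@ExSeq _ _ _ _ _ (upd (upd (upd s 0 [::]) 1 (g x)) 2 (f x))).
  by apply: exec_cast X1 _ _ => //; rewrite /S3; regs.
apply: (@ExSeq _ _ _ _ _ (upd (upd (upd s 0 [::]) 2 (f x)) 3 (rev (g x)))).
  by apply: M => //; regs; rewrite ?s1 ?s3 ?cats0.
apply: (@ExSeq _ _ _ _ _ (upd (upd s 0 (g x)) 2 (f x))).
  apply: M => //; first by rewrite upd_eq // size_rev.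
  by regs; rewrite ?s3 ?cats0 ?revK.
apply: (@ExSeq _ _ _ _ _ (upd (upd s 0 (g x)) 3 (rev (f x)))).
  by apply: M => //; regs; rewrite ?s2 ?s3 ?cats0 ?revK.
apply: (@ExSeq _ _ _ _ _ (upd (upd s 0 (false :: g x)) 3 (rev (f x)))).
  by apply: exec_cast (ExPush _ _ _) _ _ => //; regs.
apply: exec_cast; first by apply: exec_enc2.
  by rewrite upd_eq // size_rev.
by rewrite pair_codeE; regs; rewrite ?s3 ?revK.
Qed.

Lemma timed_pfst : timed pfst (fun x => 40 * size x + 40).
Proof.
exists 3, (Seq decode (Seq (clear 0) (mv 2 0))); split=> // s E.
have [s1 s2] : s 1 = [::] /\ s 2 = [::] by rewrite !E.
have [n [L X]] := exec_decode s1 s2.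
have := size_pfst (s 0); have := size_psnd (s 0) => L1 L2.
exists (n + (4 * size (psnd (s 0)) + 1 + (4 * size (pfst (s 0)) + 1))).
split; first by lia.
apply: ExSeq X _; apply: ExSeq.
  by apply: exec_cast; first exact: exec_clear.
apply: exec_cast; first exact: exec_mv.
  by rewrite /upd /= ?size_cat ?size_rev ?s1 ?s2 ?s3 ?addn0 /=.
by regs; rewrite ?revK ?cats0 ?s2.
Qed.

Lemma timed_psnd : timed psnd (fun x => 40 * size x + 40).
Proof.
exists 3, (Seq decode (clear 2)); split=> // s E.
have [s1 s2] : s 1 = [::] /\ s 2 = [::] by rewrite !E.
have [n [L X]] := exec_decode s1 s2.
have := size_pfst (s 0); have := size_psnd (s 0) => L1 L2.
exists (n + (4 * size (pfst (s 0)) + 1)); split; first by lia.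
apply: ExSeq X _; apply: exec_cast; first exact: exec_clear.
  by rewrite upd_eq // size_rev.
by regs; rewrite ?revK ?cats0 ?s2.
Qed.

(** The first component serves as a counter in unary. *)
Definition itr f x := iter (size (pfst x)) f (psnd x).

Lemma timed_itr f t : timed f t -> timed (itr f) (fun x => 40 * (size x + 1) +
   \sum_(i < size (pfst x)) (t (iter i f (psnd x)) + 3) + 10 * size (itr f x)).
Proof.
move=> [K [c H]].
exists (K + 4), (Seq decode (Seq (mv 0 3) (Seq (mv 2 0) (Seq (mv 3 1)
  (Seq (While 0 (Seq (Pop 0) (shift 1 c))) (Seq (mv 1 2) (mv 2 0))))))); split.
  have R := regs_below_shift 1 (proj1 H).
  rewrite /= !(regs_below_leq _ R); lia.
move=> s E; have Es i : 0 < i < K + 4 -> s i = [::] by apply: E.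
have [s1 s2 s3] : [/\ s 1 = [::], s 2 = [::] & s 3 = [::]] by split; apply: E; lia.
have [n [Ln X]] := exec_decode s1 s2.
set x := s 0 in X *; set k := pfst x in X *; set y := psnd x in X *.
have Lk : size k <= size x by apply: size_pfst.
have Ly : size y <= size x by apply: size_psnd.
have loop k' y' : exists m, m <= \sum_(i < size k') (t (iter i f y') + 3) + 1 /\
  exec (While 0 (Seq (Pop 0) (shift 1 c))) (upd (upd s 0 k') 1 y') m
    (upd (upd s 0 [::]) 1 (iter (size k') f y')).
  elim: k' y' => [|b k' IH] y'.
    exists 1; split; first lia.
    by apply: exec_cast; first exact: ExWhile0.
  have [m [Lm Xm]] := IH (f y').
  have [|m1 [L1 X1]] := @computes_shift _ _ _ _ 1 (upd (upd s 0 k') 1 y') H.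
    by move=> i Hi; rewrite !upd_neq ?Es //; lia.
  exists ((1 + m1 + m).+1); split.
    rewrite big_ord_recl /=.
    have -> : \sum_(i < size k') (t (f (iter i f y')) + 3) = \sum_(i < size k') (t (iter i f (f y')) + 3).
      by apply: eq_bigr => i _; rewrite -iterS iterSr.
    by move: L1; rewrite upd_eq //; lia.
  apply: (@ExWhileS _ _ _ _ _ (upd (upd s 0 k') 1 (f y'))).
  - by [].
  - apply: ExSeq; first exact: ExPop.
    have -> : upd (upd (upd s 0 (b :: k')) 1 y') 0 (behead (upd (upd s 0 (b :: k')) 1 y' 0)) =
      upd (upd s 0 k') 1 y' by regs.
    by apply: exec_cast X1 _ _ => //; regs.
  - by rewrite [size _]/= iterSr.
have [m [Lm Xm]] := loop k y.
pose z := itr f x; have Ez : iter (size k) f y = z by [].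
exists (n + (4 * size y + 1 + (4 * size k + 1 + (4 * size y + 1 + (m + (4 * size z + 1 +
  (4 * size z + 1))))))); split.
  move: Lm Ln Lk Ly; rewrite -/x -/k -/y -/z; move: (\sum_(i < _) _) => S; clear; move: (size x) (size y) (size k) (size z) => a1 a2 a3 a4; lia.
apply: ExSeq X _.
apply: ExSeq.
  by apply: exec_cast; first exact: exec_mv.
apply: ExSeq.
  apply: exec_cast; first exact: exec_mv.
    by rewrite /upd /= ?size_cat ?size_rev ?s1 ?s2 ?s3 ?addn0 /=.
  by [].
apply: ExSeq.
  apply: exec_cast; first exact: exec_mv.
  by rewrite /upd /= ?size_cat ?size_rev ?s1 ?s2 ?s3 ?addn0 /=.
  by [].
set S := (S in exec _ S _ _).
have -> : S = upd (upd s 0 k) 1 y.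
  by rewrite /S; regs; rewrite ?s1 ?s2 ?s3 ?cats0 ?revK.
apply: ExSeq Xm _. rewrite Ez; apply: ExSeq.
  by apply: exec_cast; first exact: exec_mv.
apply: exec_cast; first exact: exec_mv.
  by rewrite /upd /= ?size_cat ?size_rev ?s1 ?s2 ?s3 ?addn0 /=.
by regs; rewrite ?s1 ?s2 ?cats0 ?revK.
Qed.

(** The maximum over all inputs of length n turns a bound on inputs into one on lengths; the extra
    terms pay for carrying the result to the last tape. *)
Lemma timed_machine f t : timed f t ->
  exists M, computes_in_time M f (fun n => \max_(x : n.-tuple bool) (2 * (t x + 20 * (size x + size (f x)) + 20))).
Proof.
move=> [K [c H]].
have [R {}H] := computes_weaken (leqnSn K) H.
pose c' := Seq c (Seq (mv 0 K.+1) (mv K.+1 K.+2)).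
have R' : regs_below K.+3 c' by rewrite /= (regs_below_leq _ R); lia.
exists (frag_machine (compile K.+2 c')) => x.
pose s : store := fun i => if i == 0 then x else [::].
have [|n [L X]] := H s; first by move=> [|i].
have [s' [X' E']] : exists s', exec c' s (n + (4 * size (f x) + 1 + (4 * size (f x) + 1))) s'
    /\ s' K.+2 = f x.
  exists (upd (upd (upd s 0 [::]) K.+1 [::]) K.+2 (f x)); split; last by rewrite upd_eq.
  apply: ExSeq X _; apply: ExSeq.
    by apply: exec_cast; first exact: exec_mv.
  apply: exec_cast; first by apply: exec_mv; lia.
    by rewrite /upd /= eqxx size_cat size_rev addn0.
  apply: funext => i; rewrite /upd /s /= !eqxx.
  case: (i =P K.+2) => [_|_]; last by case: (i =P K.+1) => _ //; case: (i =P 0).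
  rewrite (_ : (K.+2 == K.+1) = false); last by lia.
  by rewrite !cats0 revK.
have [m [Lm Hm Om]] := @exec_machine K.+2 c' x (f x) s _ s' R' (fun=> erefl) X' E'.
exists m; split=> //.
have := @leq_bigmax_cond _ xpredT (fun x : (size x).-tuple bool =>
   (2 * (t x + 20 * (size x + size (f x)) + 20))) (in_tuple x) isT.
rewrite /=; apply: leq_trans; move: L; rewrite /s /=; lia.
Qed.

(** * Polynomial-time functions between encoded types *)

Lemma leq_pow m n e : m <= n -> m ^ e <= n ^ e.
Proof. by case: e => // e; rewrite leq_exp2r. Qed.

Lemma leq_exp2 n c c' : c <= c' -> (n + 2) ^ c <= (n + 2) ^ c'.
Proof. by move=> L; rewrite leq_pexp2l // addn2. Qed.

Lemma exp2_gt0 n c : 0 < (n + 2) ^ c.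
Proof. by rewrite expn_gt0 addn2. Qed.

(* [polyb g] is [poly_bounded g] in a form that is easier to compose. *)
Definition polyb (g : nat -> nat) := exists c, forall n, g n <= (n + 2) ^ c.

Lemma polyb_leq g g' : polyb g' -> (forall n, g n <= g' n) -> polyb g.
Proof. by move=> [c H] L; exists c => n; apply: leq_trans (L n) (H n). Qed.

Lemma polyb_const k : polyb (fun=> k).
Proof.
exists k => n; apply: leq_trans (ltnW (ltn_expl k (ltnSn 1))) _.
by rewrite leq_pow ?leq_addl.
Qed.

Lemma polyb_id : polyb id.
Proof. by exists 1 => n; rewrite expn1 leq_addr. Qed.

Lemma polyb_mul f g : polyb f -> polyb g -> polyb (fun n => f n * g n).
Proof. by move=> [a A] [b B]; exists (a + b) => n; rewrite expnD leq_mul. Qed.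

Lemma polyb_add f g : polyb f -> polyb g -> polyb (fun n => f n + g n).
Proof.
move=> [a A] [b B]; exists (a + b).+1 => n.
have := leq_exp2 n (leq_addr b a); have := leq_exp2 n (leq_addl a b).
have := A n; have := B n; rewrite expnS mulnDl; move: (_ ^ (a + b)) => *; lia.
Qed.

Lemma polyb_exp f k : polyb f -> polyb (fun n => f n ^ k).
Proof.
by move=> [a A]; exists (a * k) => n; rewrite expnM leq_pow.
Qed.

Lemma polyb_comp f g : polyb f -> polyb g -> polyb (fun n => f (g n)).
Proof.
move=> [a A] [b B]; exists (b.+2 * a) => n; apply: leq_trans (A _) _.
rewrite expnM leq_pow // !expnS; have := B n; have := exp2_gt0 n b.
by move: (_ ^ b) => x; nia.
Qed.

Lemma poly_boundedE g : poly_bounded g <-> polyb g.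
Proof.
split=> -[c H].
  apply: (@polyb_leq _ (fun n => n ^ c + c)) => //.
  apply: polyb_add (polyb_const c); apply: (@polyb_exp id c); exact: polyb_id.
(* For n <= 1 the additive constant dominates (n + 2)^c; for n >= 2 one has n + 2 <= n^2. *)
exists (2 * c + 3 ^ c) => n; apply: leq_trans (H n) _.
case: (leqP n 1) => Hn.
  apply: leq_trans (leq_addl _ _); apply: leq_trans (leq_addl _ _).
  by rewrite leq_pow //; lia.
apply: leq_trans (leq_addr _ _).
apply: (@leq_trans (n ^ (2 * c))); last by rewrite leq_pexp2l //; lia.
by rewrite expnM leq_pow // expnS expn1; nia.
Qed.

Ltac polyb := repeat first
  [ exact: polyb_id | exact: polyb_const | assumption
  | apply: polyb_add | apply: polyb_mul | apply: polyb_exp ].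

(* Polynomial time is only required on the inputs satisfying D, which will be
   the set of codes of the elements of some type. *)
Definition polyF (D : bitstring -> Prop) f := exists T g,
  [/\ polyb g, timed f T & forall x, D x -> T x <= g (size x)].

Lemma polyb_mono g : polyb g ->
  exists g', [/\ polyb g', {homo g' : m n / m <= n} & forall n, g n <= g' n].
Proof.
move=> [c H]; exists (fun n => (n + 2) ^ c); split=> //.
  by exists c.
by move=> m n L; rewrite leq_pow // leq_add2r.
Qed.

Section PolyF.
Variable D : bitstring -> Prop.

Lemma polyF_size f : polyF D f -> exists g, [/\ polyb g, {homo g : m n / m <= n} &
  forall x, D x -> size (f x) <= g (size x)].
Proof.
move=> [T [g [/polyb_mono[g' [P M L]] X H]]]; exists (fun n => n + g' n); split.
- by polyb.
- by move=> m n le; rewrite leq_add // M.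
- move=> x Dx; apply: leq_trans (timed_size x X) _; rewrite leq_add2l.
  exact: leq_trans (H x Dx) (L _).
Qed.

Lemma polyF_ext f f2 : polyF D f -> f =1 f2 -> polyF D f2.
Proof. by move=> H /funext <-. Qed.

Lemma polyF_id : polyF D id.
Proof. by exists (fun=> 1), (fun=> 1); split=> //; [polyb|exact: timed_id]. Qed.

Lemma polyF_comp E g f : polyF E g -> polyF D f -> (forall x, D x -> E (f x)) ->
  polyF D (fun x => g (f x)).
Proof.
move=> [U [u [/polyb_mono[u' [Pu Mu Lu]] Tu Hu]]] Hf DE.
have [b [Pb Mb Lb]] := polyF_size Hf; have [T [t [Pt Tt Ht]]] := Hf.
exists (fun x => T x + U (f x)), (fun n => t n + u' (b n)); split.
- by apply: polyb_add => //; apply: polyb_comp.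
- exact: timed_comp.
- move=> x Dx; rewrite leq_add ?Ht //.
  apply: leq_trans (Hu _ (DE _ Dx)) _; apply: leq_trans (Lu _) _.
  by apply: Mu; apply: Lb.
Qed.

Lemma polyF_cons b : polyF D (cons b).
Proof. by exists (fun=> 1), (fun=> 1); split=> //; [polyb|exact: timed_cons]. Qed.

Lemma polyF_behead : polyF D behead.
Proof. by exists (fun=> 1), (fun=> 1); split=> //; [polyb|exact: timed_behead]. Qed.

Lemma polyF_pfst : polyF D pfst.
Proof. by eexists _, (fun n => 40 * n + 40); split; [polyb|exact: timed_pfst|]. Qed.

Lemma polyF_psnd : polyF D psnd.
Proof. by eexists _, (fun n => 40 * n + 40); split; [polyb|exact: timed_psnd|]. Qed.

Lemma polyF_case f0 fF fT :
  polyF (fun x => D x /\ x = [::]) f0 ->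
  polyF (fun x => D x /\ head true x = false) fF ->
  polyF (fun x => D x /\ head false x = true) fT ->
  polyF D (fun x => match x with [::] => f0 x | false :: _ => fF x | true :: _ => fT x end).
Proof.
move=> [T0 [t0 [P0 X0 H0]]] [TF [tF [PF XF HF]]] [TT [tT [PT XT HT]]].
eexists _, (fun n => (t0 n + tF n + tT n) + 1); split; first by polyb.
  exact: timed_case X0 XF XT.
move=> [|[] x] Dx; rewrite addn1 ltnS /=.
- by rewrite -addnA; apply: leq_trans (leq_addr _ _); apply: H0.
- by apply: leq_trans (leq_addl _ _); apply: HT.
- by rewrite addnAC; apply: leq_trans (leq_addl _ _); apply: HF.
Qed.

Lemma polyF_pair f g : polyF D f -> polyF D g ->
  polyF D (fun x => pair_code (f x) (g x)).
Proof.
move=> Hf Hg; have [a [Pa _ La]] := polyF_size Hf; have [b [Pb _ Lb]] := polyF_size Hg.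
case: Hf Hg => T [t [Pt Tt Ht]] [U [u [Pu Tu Hu]]].
eexists _, (fun n => 40 * (n + a n + b n + 1) + t n + u n); split; first by polyb.
  exact: timed_pair Tt Tu.
move=> x Dx /=; apply: leq_add _ (Hu _ Dx); apply: leq_add _ (Ht _ Dx).
by rewrite leq_mul2l /= leq_add2r leq_add ?Lb // leq_add // La.
Qed.

(** A bound on the iterates has to be supplied: iterating a cheap function such as doubling a string
    can reach exponential lengths. *)
Lemma polyF_itr E f g : polyF E f -> polyb g ->
  (forall x i, D x -> i <= size (pfst x) ->
     E (iter i f (psnd x)) /\ size (iter i f (psnd x)) <= g (size x)) ->
  polyF D (itr f).
Proof.
move=> [T [t [/polyb_mono[t' [Pt Mt Lt]] X HT]]] Pg H.
eexists _, (fun n => 40 * (n + 1) + n * (t' (g n) + 3) + 10 * g n); split.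
- by polyb; apply: polyb_comp.
- exact: timed_itr X.
move=> x Dx; apply: leq_add; last by rewrite leq_mul2l /=; apply: (H _ _ Dx _).2.
rewrite leq_add2l.
apply: (@leq_trans (\sum_(i < size (pfst x)) (t' (g (size x)) + 3))).
  apply: leq_sum => i _; rewrite leq_add2r.
  have [Ei Si] := H x i Dx (ltnW (ltn_ord i)).
  exact: leq_trans (HT _ Ei) (leq_trans (Lt _) (Mt _ _ Si)).
by rewrite sum_nat_const card_ord leq_mul2r size_pfst orbT.
Qed.

End PolyF.

Lemma polyF_const D w : polyF D (fun=> w).
Proof.
have cT g f : polyF (fun=> True) g -> polyF D f -> polyF D (fun x => g (f x)).
  by move=> Hg Hf; apply: polyF_comp Hg Hf _.
elim: w => [|b w IH]; last exact: cT _ _ (polyF_cons _ b) IH.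
(* Decoding erases the input: [pfst (false :: x)] is empty for every x, and the pair of two empty
   words is [[:: false]]. *)
have H : polyF D (fun=> [:: false]).
  apply: (@polyF_ext _ (fun x => pair_code (pfst (false :: x)) (psnd (false :: pfst (false :: x))))).
    apply: polyF_pair; first exact: cT _ _ (polyF_pfst _) (polyF_cons _ _).
    apply: (cT _ _ (polyF_psnd _) (cT _ _ (polyF_cons _ _) _)).
    exact: cT _ _ (polyF_pfst _) (polyF_cons _ _).
  by [].
exact: cT _ _ (polyF_behead _) H.
Qed.

Lemma polyF_polytime f : polyF (fun=> True) f -> polytime f.
Proof.
move=> Hf; have [g [Pg _ Lg]] := polyF_size Hf; case: Hf => T [t [Pt HT Ht]].
have [M HM] := timed_machine HT; exists M; eexists; split; last exact: HM.
apply/poly_boundedE; apply: (@polyb_leq _ (fun n => 2 * (t n + 20 * (n + g n) + 20))).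
  by polyb.
move=> n; apply/bigmax_leqP => x _.
move: (Lg x I) (Ht x I); rewrite size_tuple; set a := T _; set b := size (f _); lia.
Qed.

(** * Encoded types and polynomial-time functions between them *)

Class encT (A : Type) := EncT {
  enc : A -> bitstring; dec : bitstring -> A; encK : cancel enc dec }.
#[global] Hint Mode encT ! : typeclass_instances.

#[local] Obligation Tactic := idtac.

(** A raw string, which is its own code. Bit strings seen as lists of booleans are encoded with
    three symbols per bit instead; [fp_Str] and [fp_unstr] convert between the two views. *)
Record str := Str { unstr : bitstring }.
#[global, program] Instance enc_str : encT str := {| enc := unstr; dec := Str |}.
Next Obligation. by case. Qed.
(** Unary, so that polynomial time means polynomial in the value; numbers in binary occur only as
    bit strings. *)
#[global, program] Instance enc_nat : encT nat :=
  {| enc n := nseq n true; dec := size |}.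
Next Obligation. by move=> n; rewrite size_nseq. Qed.
#[global, program] Instance enc_bool : encT bool :=
  {| enc b := [:: b]; dec := head false |}.
Next Obligation. by []. Qed.
#[global, program] Instance enc_prod A B (eA : encT A) (eB : encT B) : encT (A * B)%type :=
  {| enc q := pair_code (enc q.1) (enc q.2); dec w := (dec (pfst w), dec (psnd w)) |}.
Next Obligation. by move=> A B eA eB [a b]; rewrite pfst_pair psnd_pair !encK. Qed.

Definition enc_list A (eA : encT A) : seq A -> bitstring :=
  foldr (fun a w => pair_code (enc a) w) [::].
(* the first argument is fuel *)
Fixpoint dec_list A (eA : encT A) n w : seq A :=
  if n is n.+1 then
    if w is [::] then [::] else dec (pfst w) :: dec_list eA n (psnd w)
  else [::].

Lemma size_pair_code x w : size (pair_code x w) = 2 * size x + 1 + size w.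
Proof.
rewrite pair_codeE size_cat /= /sd size_flatten /shape -map_comp.
have -> : sumn [seq (size \o (fun b => [:: true; b])) i | i <- x] = 2 * size x.
  by elim: x => //= b x ->; lia.
by lia.
Qed.

Lemma enc_listK A (eA : encT A) :
  cancel (enc_list eA) (fun w => dec_list eA (size w) w).
Proof.
move=> l; suff: forall n, size (enc_list eA l) <= n -> dec_list eA n (enc_list eA l) = l by apply.
elim: l => [|a l IH] [|n] //=; rewrite size_pair_code; first lia.
move=> L; case E: (pair_code _ _) => [|b w]; first by case/nilP/negP: E; rewrite /nilp size_pair_code; lia.
by rewrite -E pfst_pair psnd_pair encK IH //; lia.
Qed.

#[global] Instance enc_seq A (eA : encT A) : encT (seq A) :=
  {| enc := enc_list eA; dec w := dec_list eA (size w) w; encK := enc_listK eA |}.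

Definition codes A {eA : encT A} (x : bitstring) := exists a : A, x = enc a.

(** On strings that are not codes the function g may be arbitrary, and arbitrarily slow. *)
Definition fp A B {eA : encT A} {eB : encT B} (f : A -> B) :=
  exists2 g, polyF (@codes A eA) g & forall a, g (enc a) = enc (f a).

Definition esz A {eA : encT A} (a : A) := size (enc a).

Lemma esz_pair A B (eA : encT A) (eB : encT B) (q : A * B) :
  esz q = 2 * esz q.1 + 1 + esz q.2.
Proof. exact: size_pair_code. Qed.
Lemma esz_cons A (eA : encT A) (a : A) l : esz (a :: l) = 2 * esz a + 1 + esz l.
Proof. exact: size_pair_code. Qed.
Lemma esz_nil A (eA : encT A) : esz ([::] : seq A) = 0.
Proof. by []. Qed.
Lemma esz_nat (n : nat) : esz n = n.
Proof. exact: size_nseq. Qed.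
Lemma esz_bool (b : bool) : esz b = 1.
Proof. by []. Qed.
Lemma esz_str (s : str) : esz s = size (unstr s).
Proof. by []. Qed.

Lemma fp_size A B {eA : encT A} {eB : encT B} (f : A -> B) : fp f ->
  exists g, [/\ polyb g, {homo g : m n / m <= n} & forall a, esz (f a) <= g (esz a)].
Proof.
move=> [F /polyF_size[g [P M L]] E]; exists g; split=> // a.
by rewrite /esz -E; apply: L; exists a.
Qed.

Section Fp.
Context {A B C : Type} {eA : encT A} {eB : encT B} {eC : encT C}.

Lemma fp_ext (f g : A -> B) : fp f -> f =1 g -> fp g.
Proof. by move=> H /funext <-. Qed.

Lemma fp_id : fp (fun a : A => a).
Proof. by exists id; first exact: polyF_id. Qed.

Lemma fp_comp (g : B -> C) (f : A -> B) : fp g -> fp f -> fp (fun a => g (f a)).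
Proof.
move=> [G PG EG] [F PF EF]; exists (fun x => G (F x)); last by move=> a; rewrite EF EG.
by apply: polyF_comp PG PF _ => x [a ->]; exists (f a).
Qed.

Lemma fp_const (b : B) : fp (fun _ : A => b).
Proof. by exists (fun=> enc b); first exact: polyF_const. Qed.

Lemma fp_pair (f : A -> B) (g : A -> C) : fp f -> fp g -> fp (fun a => (f a, g a)).
Proof.
move=> [F PF EF] [G PG EG]; exists (fun x => pair_code (F x) (G x)).
  exact: polyF_pair.
by move=> a; rewrite EF EG.
Qed.

Lemma polyF_then (F G : bitstring -> bitstring) D :
  polyF D F -> polyF (fun=> True) G -> polyF D (fun x => G (F x)).
Proof. by move=> HF HG; apply: polyF_comp HG HF _. Qed.

Lemma fp_fst (f : A -> B * C) : fp f -> fp (fun a => (f a).1).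
Proof.
move=> [F PF EF]; exists (fun x => pfst (F x)); first exact: polyF_then (polyF_pfst _).
by move=> a; rewrite EF pfst_pair.
Qed.

Lemma fp_snd (f : A -> B * C) : fp f -> fp (fun a => (f a).2).
Proof.
move=> [F PF EF]; exists (fun x => psnd (F x)); first exact: polyF_then (polyF_psnd _).
by move=> a; rewrite EF psnd_pair.
Qed.

Lemma fp_if (b : A -> bool) (f g : A -> B) : fp b -> fp f -> fp g ->
  fp (fun a => if b a then f a else g a).
Proof.
move=> [b' Pb Eb] [F PF EF] [G PG EG].
(* When [b' x] is the code of a bit c, [pair_code (b' x) x] is [[:: true, c, false & x]]. Without
   its first bit it starts with the outcome of the test, and [tl] gives x back. *)
pose tl (x : bitstring) := behead (behead x).
pose h x := match x with [::] => [::]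
                       | false :: _ => G (tl x)
                       | true :: _ => F (tl x) end.
exists (fun x => h (behead (pair_code (b' x) x))); last first.
  by move=> a; rewrite Eb /h /tl; case: (b a); rewrite /= ?EF ?EG.
pose E (x : bitstring) : Prop := exists a, x = behead (pair_code (@enc _ enc_bool (b a)) (@enc _ eA a)).
have Pt : polyF E tl by apply: polyF_then (polyF_behead _); exact: polyF_behead.
have Et x : E x -> @codes A _ (tl x) by move=> [a ->]; exists a.
have sub f' D D' : polyF D' f' -> (forall x, D x -> D' x) -> polyF D f'.
  by move=> [T [t [p X H]]] S; exists T, t; split=> // x /S/H.
apply: (@polyF_comp _ E).
- apply: polyF_case; first exact: polyF_const.
    by apply: (sub _ _ E (polyF_comp PG Pt Et)) => x [].
  by apply: (sub _ _ E (polyF_comp PF Pt Et)) => x [].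
- apply: polyF_then (polyF_behead _); apply: polyF_pair => //; exact: polyF_id.
- by move=> x [a ->]; exists a; rewrite Eb.
Qed.

Lemma fp_cons (f : A -> B) (g : A -> seq B) : fp f -> fp g -> fp (fun a => f a :: g a).
Proof.
move=> [F PF EF] [G PG EG]; exists (fun x => pair_code (F x) (G x)).
  exact: polyF_pair.
by move=> a; rewrite EF EG.
Qed.

Lemma fp_behead (f : A -> seq B) : fp f -> fp (fun a => behead (f a)).
Proof.
move=> [F PF EF]; exists (fun x => psnd (F x)); first exact: polyF_then (polyF_psnd _).
by move=> a; rewrite EF; case: (f a) => //= b l; rewrite psnd_pair.
Qed.

Lemma fp_nilp (f : A -> seq B) : fp f -> fp (fun a => nilp (f a)).
Proof.
move=> [F PF EF].
pose h (x : bitstring) := match x with [::] => [:: true] | false :: _ => [:: false] | true :: _ => [:: false] end.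
exists (fun x => h (F x)).
  apply: polyF_then => //; apply: polyF_case; exact: polyF_const.
move=> a; rewrite EF; case: (f a) => //= b l.
by rewrite pair_codeE; case: (enc b).
Qed.

End Fp.

Section FpIter.
Context {A B : Type} {eA : encT A} {eB : encT B}.

Lemma fp_head (f : A -> seq B) (d : A -> B) : fp f -> fp d ->
  fp (fun a => head (d a) (f a)).
Proof.
move=> Hf Hd.
have [F PF EF] : fp (fun a => if nilp (f a) then [:: d a] else f a).
  apply: fp_if => //; first exact: fp_nilp.
  by apply: fp_cons => //; exists (fun=> [::]); first exact: polyF_const.
exists (fun x => pfst (F x)); first exact: polyF_then (polyF_pfst _).
by move=> a; rewrite EF; case: (f a) => [|b l]; rewrite /= pfst_pair.
Qed.

Lemma fp_iter (n : A -> nat) (F : A -> B -> B) (s : A -> B) g :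
  fp n -> fp (fun q => F q.1 q.2) -> fp s -> polyb g ->
  (forall a i, i <= n a -> esz (iter i (F a) (s a)) <= g (esz a)) ->
  fp (fun a => iter (n a) (F a) (s a)).
Proof.
move=> [n' Pn En] [F' PF EF] [s' Ps Es] Pg H.
(* The parameter a travels along with the state, because [itr] iterates a function of one
   argument. *)
pose phi x := pair_code (pfst x) (F' x).
have Pphi : polyF (@codes (A * B) _) phi by apply: polyF_pair => //; exact: polyF_pfst.
pose st x := pair_code (n' x) (pair_code x (s' x)).
have Pst : polyF (@codes A _) st by do 2!apply: polyF_pair => //; exact: polyF_id.
have E a i : iter i phi (pair_code (enc a) (enc (s a))) =
   pair_code (enc a) (enc (iter i (F a) (s a))).
  by elim: i => //= i ->; rewrite /phi pfst_pair (EF (a, _)).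
exists (fun x => psnd (itr phi (st x))); last first.
  by move=> a; rewrite /itr /st pfst_pair psnd_pair En Es size_nseq E psnd_pair.
apply: polyF_then (polyF_psnd _).
pose bnd m := 2 * m + 1 + g m.
have [g' [Pg' Mg Lg]] := polyb_mono Pg.
apply: (@polyF_comp _ (fun y => exists a : A, y = st (enc a))) Pst _; last first.
  by move=> x [a ->]; exists a.
apply: (@polyF_itr _ (@codes (A * B) _) _ (fun m => 2 * m + 1 + g' m)) => //.
  by polyb.
move=> x i [a ->]; rewrite /st En Es pfst_pair psnd_pair size_nseq => Li.
rewrite E; split; first by exists (a, iter i (F a) (s a)).
rewrite !size_pair_code size_nseq; have L : size (enc a) <= 2 * n a + 1 + (2 * size (enc a) + 1 + size (enc (s a))) by lia.
have := leq_trans (H a i Li) (leq_trans (Lg _) (Mg _ _ L)).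
by rewrite /esz; lia.
Qed.

End FpIter.

(** The tactic [fpa] proves [fp] goals by descent on the body of the function. The tactics it calls
    are hooks, redefined as new closure properties become available; hypotheses on functions of
    several arguments are used in uncurried form. *)
Ltac fp_prim := fail.
Ltac fp_ho := match goal with
  | H : fp ?n |- fp (fun q => ?n (@?f q)) => apply: (fp_comp H)
  | H : fp (fun q => ?F q.1 q.2) |- fp (fun x => ?F (@?f x) (@?g x)) =>
      apply: (fp_comp (f := fun x => (f x, g x)) H); apply: fp_pair
  | H : fp (fun q => ?F q.1 q.2.1 q.2.2) |- fp (fun x => ?F (@?f x) (@?g x) (@?h x)) =>
      apply: (fp_comp (f := fun x => (f x, (g x, h x))) H); apply: fp_pair; [|apply: fp_pair]
  end.
Ltac fp_step := first
  [ exact: fp_id | exact: fp_const | assumption | apply: fp_fst | apply: fp_snd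
  | apply: fp_if | apply: fp_cons | apply: fp_behead | apply: fp_nilp | apply: fp_head
  | fp_prim | fp_ho | apply: fp_pair ].
Ltac fpa := cbv beta; repeat (fp_step; cbv beta).

(** * Sizes of codes, and closure under arithmetic and list operations *)

Section EszList.
Context {A : Type} {eA : encT A}.
Implicit Types l : seq A.

Lemma esz_sumn l : esz l = sumn [seq 2 * esz a + 1 | a <- l].
Proof. by elim: l => //= a l <-; rewrite esz_cons; lia. Qed.

Lemma esz_cat l1 l2 : esz (l1 ++ l2) = esz l1 + esz l2.
Proof. by rewrite !esz_sumn map_cat sumn_cat. Qed.

Lemma esz_rev l : esz (rev l) = esz l.
Proof. by rewrite !esz_sumn map_rev sumn_rev. Qed.

Lemma esz_take i l : esz (take i l) <= esz l.
Proof. by rewrite -{2}(cat_take_drop i l) esz_cat leq_addr. Qed.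

Lemma esz_drop i l : esz (drop i l) <= esz l.
Proof. by rewrite -{2}(cat_take_drop i l) esz_cat leq_addl. Qed.

Lemma size_esz l : size l <= esz l.
Proof. by elim: l => //= a l; rewrite esz_cons; lia. Qed.

Lemma esz_filter p l : esz (filter p l) <= esz l.
Proof. by elim: l => //= a l IH; case: ifP => _; rewrite !esz_cons; lia. Qed.

Lemma esz_leq l m : (forall i, i < size l -> forall d, esz (nth d l i) <= m) ->
  esz l <= size l * (2 * m + 1).
Proof.
elim: l => //= a l IH H; rewrite esz_cons mulSn.
have := H 0 isT a; have := IH (fun i => H i.+1); rewrite /=; lia.
Qed.

Lemma esz_mem l i d : i < size l -> esz (nth d l i) <= esz l.
Proof.
by elim: l i => //= a l IH [|i] /= L; rewrite esz_cons; [lia|have := IH i L; lia].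
Qed.
End EszList.

Section FpNat.
Context {X : Type} {eX : encT X}.
Implicit Types f g n m : X -> nat.

Lemma fp_esz A {eA : encT A} (f : X -> A) : fp f -> fp (fun x => esz (f x)).
Proof.
move=> Hf; apply: (@fp_comp _ _ _ _ _ _ (@esz A _) f) => //.
exists (fun x => itr (cons true) (pair_code x [::])); last first.
  by move=> a; rewrite /itr pfst_pair psnd_pair /esz /=; elim: (size _) => //= n ->.
apply: (@polyF_comp _ (fun y => exists x, y = pair_code x [::])).
- apply: (@polyF_itr _ (fun=> True) _ id); [exact: polyF_cons|exact: polyb_id|].
  move=> _ i [x ->]; rewrite pfst_pair psnd_pair => Hi; split=> //.
  have -> : iter i (cons true) [::] = nseq i true by elim: i {Hi} => //= i ->.
  by rewrite size_nseq size_pair_code; lia.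
- by apply: polyF_pair; [exact: polyF_id|exact: polyF_const].
- by move=> x _; exists x.
Qed.

Lemma fp_succ n : fp n -> fp (fun x => (n x).+1).
Proof.
move=> Hn; apply: (@fp_comp _ _ _ _ _ _ S n) => //.
by exists (cons true); [exact: polyF_cons|].
Qed.

Lemma fp_pred n : fp n -> fp (fun x => (n x).-1).
Proof.
move=> Hn; apply: (@fp_comp _ _ _ _ _ _ predn n) => //.
by exists behead; [exact: polyF_behead|case].
Qed.

Lemma fp_eq0 n : fp n -> fp (fun x => n x == 0).
Proof.
move=> Hn; apply: (@fp_comp _ _ _ _ _ _ (fun k => k == 0) n) => //.
exists (fun w : bitstring => match w with [::] => [:: true] | false :: _ => [:: false] | true :: _ => [:: false] end).
  by apply: polyF_case; exact: polyF_const.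
by case.
Qed.

End FpNat.

Ltac fp_prim ::= first [ apply: fp_esz | apply: fp_succ | apply: fp_pred | apply: fp_eq0 ].

Section FpAdd.
Context {X : Type} {eX : encT X}.
Implicit Types f g n m : X -> nat.

Lemma fp_add n m : fp n -> fp m -> fp (fun x => n x + m x).
Proof.
move=> Hn Hm; apply: (@fp_comp _ _ _ _ _ _ (fun q : nat * nat => q.1 + q.2) (fun x => (n x, m x))).
  apply: (@fp_ext _ _ _ _ (fun q : nat * nat => iter q.1 S q.2)); last first.
    by move=> [a b] /=; elim: a => //= a ->; rewrite addSn.
  apply: (@fp_iter _ _ _ _ _ (fun (_ : nat * nat) => S) _ (fun k => k)).
  - by fpa.
  - by fpa.
  - by fpa.
  - exact: polyb_id.
  - move=> [a b] i /= Hi; rewrite esz_pair /= !esz_nat.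
    by have -> : iter i S b = i + b; [elim: i {Hi} => //= i ->|lia].
exact: fp_pair.
Qed.
End FpAdd.

Ltac fp_prim ::= first [ apply: fp_esz | apply: fp_succ | apply: fp_pred | apply: fp_eq0 | apply: fp_add ].

Section FpSub.
Context {X : Type} {eX : encT X}.
Implicit Types f g n m : X -> nat.

Lemma fp_sub n m : fp n -> fp m -> fp (fun x => n x - m x).
Proof.
move=> Hn Hm.
have E a b : iter b predn a = a - b by elim: b a => [|b IH] a /=; rewrite ?IH; lia.
apply: (@fp_ext _ _ _ _ (fun x => iter (m x) predn (n x))); last by move=> x; rewrite E.
have [g [Pg _ Lg]] := fp_size Hn.
apply: (@fp_iter _ _ _ _ _ (fun=> predn) _ g) => //; first by fpa.
move=> x i _; rewrite E esz_nat; apply: leq_trans (Lg x); rewrite esz_nat; lia.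
Qed.

Lemma fp_leq n m : fp n -> fp m -> fp (fun x => n x <= m x).
Proof. by move=> Hn Hm; apply: fp_eq0; apply: fp_sub. Qed.

Lemma fp_ltn n m : fp n -> fp m -> fp (fun x => n x < m x).
Proof. by move=> Hn Hm; apply: fp_leq => //; apply: fp_succ. Qed.

Lemma fp_negb (b : X -> bool) : fp b -> fp (fun x => ~~ b x).
Proof.
move=> Hb; apply: (@fp_ext _ _ _ _ (fun x => if b x then false else true)); last by move=> x; case: (b x).
by apply: fp_if => //; apply: fp_const.
Qed.

Lemma fp_and (b c : X -> bool) : fp b -> fp c -> fp (fun x => b x && c x).
Proof. by move=> Hb Hc; apply: fp_if => //; apply: fp_const. Qed.

Lemma fp_or (b c : X -> bool) : fp b -> fp c -> fp (fun x => b x || c x).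
Proof. by move=> Hb Hc; apply: fp_if => //; apply: fp_const. Qed.

Lemma fp_eqb (b c : X -> bool) : fp b -> fp c -> fp (fun x => b x == c x).
Proof.
move=> Hb Hc; apply: (@fp_ext _ _ _ _ (fun x => if b x then c x else ~~ c x)); last by move=> x; case: (b x); case: (c x).
by apply: fp_if => //; apply: fp_negb.
Qed.

Lemma fp_eqn n m : fp n -> fp m -> fp (fun x => n x == m x).
Proof.
move=> Hn Hm; apply: (@fp_ext _ _ _ _ (fun x => (n x <= m x) && (m x <= n x))); last by move=> x; rewrite eqn_leq.
by apply: fp_and; apply: fp_leq.
Qed.

Lemma fp_mul n m : fp n -> fp m -> fp (fun x => n x * m x).
Proof.
move=> Hn Hm.
have E a b : iter a (addn b) 0 = a * b by elim: a => //= a ->; rewrite mulSn.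
apply: (@fp_ext _ _ _ _ (fun x => iter (n x) (addn (m x)) 0)); last by move=> x; rewrite E.
have [g [Pg _ Lg]] := fp_size Hn; have [h [Ph _ Lh]] := fp_size Hm.
apply: (@fp_iter _ _ _ _ _ (fun x => addn (m x)) _ (fun k => g k * h k)) => //.
- apply: fp_add; last by fpa.
  by apply: (@fp_comp _ _ _ _ _ _ m) => //; apply/fp_fst/fp_id.
- exact: fp_const.
- by polyb.
- move=> x i Hi; rewrite E esz_nat; have := Lg x; have := Lh x; rewrite !esz_nat => L1 L2.
  by rewrite leq_mul //; apply: leq_trans Hi L2.
Qed.
End FpSub.

Ltac fp_arith := first
  [ apply: fp_esz | apply: fp_succ | apply: fp_pred | apply: fp_eq0 | apply: fp_add
  | apply: fp_sub | apply: fp_ltn | apply: fp_leq | apply: fp_negb | apply: fp_and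
  | apply: fp_or | apply: fp_eqb | apply: fp_eqn | apply: fp_mul ].
Ltac fp_prim ::= fp_arith.

Section FpList.
Context {X E S : Type} {eX : encT X} {eE : encT E} {eS : encT S}.

Lemma fp_foldl (F : X -> S -> E -> S) (s : X -> S) (l : X -> seq E) g :
  fp (fun q : X * (S * E) => F q.1 q.2.1 q.2.2) -> fp s -> fp l -> polyb g ->
  (forall x i, i <= size (l x) -> esz (foldl (F x) (s x) (take i (l x))) <= g (esz x)) ->
  fp (fun x => foldl (F x) (s x) (l x)).
Proof.
move=> HF Hs Hl Pg B.
(* [head] needs a default element; over an empty type every list is empty and nothing is to be
   folded. *)
have [[d]|nE] := pselect (inhabited E); last first.
  by apply: fp_ext Hs _ => x; case: (l x) => // e; case: nE.
pose step x (q : S * seq E) :=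
  if nilp q.2 then q else (F x q.1 (head d q.2), behead q.2).
have st x i : i <= size (l x) -> iter i (step x) (s x, l x) =
    (foldl (F x) (s x) (take i (l x)), drop i (l x)).
  elim: i => [|i IH] L; first by rewrite take0 drop0.
  rewrite iterS IH ?(ltnW L) // /step /= (take_nth d L) foldl_rcons (drop_nth d L).
  by rewrite /= /nilp.
have st' x i : iter i (step x) (s x, l x) = (foldl (F x) (s x) (take i (l x)), drop i (l x)).
  case: (leqP i (size (l x))) => [/st//|L].
  rewrite -(subnK (ltnW L)) iterD st // addnC; set j := i - _.
  rewrite !take_oversize ?leq_addr // !drop_oversize ?leq_addr //.
  by elim: j => //= j ->.
have [h [Ph _ Lh]] := fp_size Hl.
(* The size of the code is at least the length of the list, and [step] idles once the list is used
   up. *)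
apply: (@fp_ext _ _ _ _ (fun x => (iter (esz (l x)) (step x) (s x, l x)).1)); last first.
  by move=> x; rewrite st' take_oversize // size_esz.
apply: fp_fst; apply: (@fp_iter _ _ _ _ _ _ _ (fun k => 2 * g k + 1 + h k)).
- exact: fp_esz.
- apply: fp_if; first by fpa.
    by fpa.
  apply: fp_pair; last by fpa.
  apply: (@fp_comp _ _ _ _ _ _ (fun q : X * (S * E) => F q.1 q.2.1 q.2.2)
           (fun q : X * (S * seq E) => (q.1, (q.2.1, head d q.2.2)))) HF _.
  apply: fp_pair; first by fpa.
  apply: fp_pair; first by fpa.
  by apply: fp_head; [by fpa|exact: fp_const].
- exact: fp_pair.
- by polyb.
- move=> x i _; rewrite st' esz_pair /=; apply: leq_add.
    rewrite leq_add2r leq_mul2l /=.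
    case: (leqP i (size (l x))) => [/B//|L].
    by rewrite take_oversize ?(ltnW L) //; have := B x (size (l x)) (leqnn _); rewrite take_size.
  exact: leq_trans (esz_drop _ _) (Lh x).
Qed.

End FpList.

Section FpList2.
Context {X E : Type} {eX : encT X} {eE : encT E}.
Implicit Types l : X -> seq E.

Lemma foldl_consE (l acc : seq E) : foldl (fun s a => a :: s) acc l = rev l ++ acc.
Proof. by elim: l acc => //= a l IH acc; rewrite IH rev_cons cat_rcons. Qed.

Lemma fp_catrev l l' : fp l -> fp l' -> fp (fun x => rev (l x) ++ l' x).
Proof.
move=> Hl Hl'.
apply: (@fp_ext _ _ _ _ (fun x => foldl (fun s a => a :: s) (l' x) (l x))); last first.
  by move=> x; rewrite foldl_consE.
have [g [Pg _ Lg]] := fp_size Hl; have [h [Ph _ Lh]] := fp_size Hl'.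
apply: (@fp_foldl _ _ _ _ _ _ (fun=> fun s a => a :: s) _ _ (fun k => g k + h k)) => //.
- by apply: fp_cons; [by fpa|by fpa].
- by polyb.
- move=> x i _; rewrite foldl_consE esz_cat esz_rev leq_add ?Lh //.
  exact: leq_trans (esz_take _ _) (Lg x).
Qed.

Lemma fp_nil : fp (fun _ : X => [::] : seq E).
Proof. exact: fp_const. Qed.

Lemma fp_rev l : fp l -> fp (fun x => rev (l x)).
Proof.
move=> Hl; apply: (@fp_ext _ _ _ _ (fun x => rev (l x) ++ [::])); last by move=> x; rewrite cats0.
by apply: fp_catrev => //; exact: fp_nil.
Qed.

Lemma fp_rcons l e : fp l -> fp e -> fp (fun x => rcons (l x) (e x)).
Proof.
move=> Hl He; apply: (@fp_ext _ _ _ _ (fun x => rev (e x :: (rev (l x) ++ [::])))); last first.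
  by move=> x; rewrite rev_cons cats0 revK.
by apply: fp_rev; apply: fp_cons => //; apply: fp_catrev => //; exact: fp_nil.
Qed.
End FpList2.

Ltac fp_prim ::= first
  [ apply: fp_catrev | apply: fp_rev | apply: fp_rcons | fp_arith ].

Section FpList3.
Context {X E : Type} {eX : encT X} {eE : encT E}.
Implicit Types l : X -> seq E.

Lemma fp_cat l l' : fp l -> fp l' -> fp (fun x => l x ++ l' x).
Proof.
move=> Hl Hl'; apply: (@fp_ext _ _ _ _ (fun x => rev (rev (l x)) ++ l' x)).
  by apply: fp_catrev => //; apply: fp_rev.
by move=> x; rewrite revK.
Qed.

End FpList3.

Ltac fp_prim ::= first
  [ apply: fp_cat | apply: fp_catrev | apply: fp_rev | apply: fp_rcons | fp_arith ].

Section FpList3b.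
Context {X E : Type} {eX : encT X} {eE : encT E}.
Implicit Types l : X -> seq E.

Lemma fp_map B {eB : encT B} (F : X -> E -> B) l :
  fp (fun q => F q.1 q.2) -> fp l -> fp (fun x => [seq F x e | e <- l x]).
Proof.
move=> HF Hl.
apply: (@fp_ext _ _ _ _ (fun x => rev (foldl (fun s e => F x e :: s) [::] (l x)))); last first.
  move=> x; rewrite -[LHS]cats0.
  suff H s : rev (foldl (fun s e => F x e :: s) s (l x)) = rev s ++ [seq F x e | e <- l x] by rewrite H cats0.
  by elim: (l x) s => [|e l' IH] s /=; rewrite ?cats0 // IH rev_cons cat_rcons.
apply: fp_rev.
have [g [Pg _ Lg]] := fp_size Hl; have [h [Ph Mh Lh]] := fp_size HF.
apply: (@fp_foldl _ _ _ _ _ _ (fun x s e => F x e :: s) _ _ (fun k => g k * (2 * h (2 * k + 1 + g k) + 1))) => //.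
- apply: fp_cons; last by fpa.
  apply: (@fp_comp _ _ _ _ _ _ (fun q => F q.1 q.2) (fun q : X * (seq B * E) => (q.1, q.2.2))) => //.
  by apply: fp_pair; [by fpa|by fpa].
- exact: fp_nil.
- by polyb; apply: (polyb_comp Ph); polyb.
- move=> x i _ /=.
  have : size (take i (l x)) <= g (esz x).
    apply: leq_trans (Lg x); apply: leq_trans (size_esz _); by rewrite size_take_min geq_minr.
  have : forall d j, j < size (take i (l x)) -> esz (nth d (take i (l x)) j) <= g (esz x).
    move=> d j Lj; apply: leq_trans (esz_mem d Lj) _.
    exact: leq_trans (esz_take _ _) (Lg x).
  move: (take i (l x)) (g (esz x)) => l' G H1 H2.
  have H (s : seq B) : esz (foldl (fun s e => F x e :: s) s l') <= esz s + size l' * (2 * h (2 * esz x + 1 + G) + 1); last first.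
    by apply: leq_trans (H _) _; rewrite esz_nil add0n leq_mul.
  elim: l' H1 s {H2} => [|e l' IH] H1 s /=; first by lia.
  apply: leq_trans (IH (fun d j => H1 d j.+1) _) _.
  rewrite esz_cons mulSn.
  have HH : esz (x, e) <= 2 * esz x + 1 + G.
    by rewrite esz_pair leq_add2l; exact: (H1 e 0 isT).
  by have := leq_trans (Lh (x, e)) (Mh _ _ HH); rewrite /=; lia.
Qed.

Lemma fp_filter (p : X -> E -> bool) l :
  fp (fun q => p q.1 q.2) -> fp l -> fp (fun x => [seq e <- l x | p x e]).
Proof.
move=> Hp Hl.
have H x s (l' : seq E) : foldl (fun s e => if p x e then e :: s else s) s l' = rev [seq e <- l' | p x e] ++ s.
  by elim: l' s => //= e l' IH s; rewrite IH; case: ifP; rewrite ?rev_cons ?cat_rcons.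
apply: (@fp_ext _ _ _ _ (fun x => rev (foldl (fun s e => if p x e then e :: s else s) [::] (l x)))); last first.
  by move=> x; rewrite H cats0 revK.
apply: fp_rev.
have [g [Pg _ Lg]] := fp_size Hl.
apply: (@fp_foldl _ _ _ _ _ _ (fun x s e => if p x e then e :: s else s) _ _ g) => //.
- apply: fp_if; last by fpa.
    apply: (@fp_comp _ _ _ _ _ _ (fun q => p q.1 q.2) (fun q : X * (seq E * E) => (q.1, q.2.2))) => //.
    by apply: fp_pair; [by fpa|by fpa].
  by apply: fp_cons; [by fpa|by fpa].
- exact: fp_nil.
- move=> x i _; rewrite H cats0 esz_rev.
  exact: leq_trans (esz_filter _ _) (leq_trans (esz_take _ _) (Lg x)).
Qed.

Lemma fp_flatten (ls : X -> seq (seq E)) : fp ls -> fp (fun x => flatten (ls x)).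
Proof.
move=> Hl; have H s (l' : seq (seq E)) : foldl cat s l' = s ++ flatten l' :> seq E.
  by elim: l' s => [|a l' IH] s /=; rewrite ?cats0 // IH catA.
apply: (@fp_ext _ _ _ _ (fun x => foldl cat [::] (ls x))); last by move=> x; rewrite H.
have [g [Pg _ Lg]] := fp_size Hl.
apply: (@fp_foldl _ _ _ _ _ _ (fun x => cat) _ _ g) => //.
- by apply: fp_cat; [by fpa|by fpa].
- exact: fp_nil.
- move=> x i _; rewrite H /=; apply: leq_trans (Lg x); apply: leq_trans (esz_take i _).
  by elim: (take i _) => //= a l' IH; rewrite esz_cat esz_cons; lia.
Qed.

Lemma fp_listsize l : fp l -> fp (fun x => size (l x)).
Proof.
move=> Hl; have H k (l' : seq E) : foldl (fun k _ => k.+1) k l' = k + size l' by elim: l' k => [|a l' IH] k /=; rewrite ?addn0 // IH; lia.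
apply: (@fp_ext _ _ _ _ (fun x => foldl (fun k _ => k.+1) 0 (l x))); last by move=> x; rewrite H.
have [g [Pg _ Lg]] := fp_size Hl.
apply: (@fp_foldl _ _ _ _ _ _ (fun x k _ => k.+1) _ _ g) => //.
- by fpa.
- exact: fp_const.
- move=> x i _; rewrite H esz_nat; apply: leq_trans (Lg x); apply: leq_trans (size_esz _).
  by rewrite size_take_min geq_minr.
Qed.

Lemma fp_has (p : X -> E -> bool) l :
  fp (fun q => p q.1 q.2) -> fp l -> fp (fun x => has (p x) (l x)).
Proof.
move=> Hp Hl; apply: (@fp_ext _ _ _ _ (fun x => ~~ nilp [seq e <- l x | p x e])).
  by apply: fp_negb; apply: fp_nilp; apply: fp_filter.
by move=> x; rewrite /nilp size_filter has_count lt0n.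
Qed.

Lemma fp_all (p : X -> E -> bool) l :
  fp (fun q => p q.1 q.2) -> fp l -> fp (fun x => all (p x) (l x)).
Proof.
move=> Hp Hl; apply: (@fp_ext _ _ _ _ (fun x => ~~ has (fun e => ~~ p x e) (l x))).
  by apply: fp_negb; apply: fp_has => //; apply: fp_negb.
by move=> x; rewrite has_predC negbK.
Qed.

Lemma fp_drop (n : X -> nat) l : fp n -> fp l -> fp (fun x => drop (n x) (l x)).
Proof.
move=> Hn Hl.
have H i (l' : seq E) : iter i behead l' = drop i l' :> seq E.
  by elim: i => [|i IH]; rewrite ?drop0 // iterS IH -drop1 drop_drop add1n.
apply: (@fp_ext _ _ _ _ (fun x => iter (n x) behead (l x))) => //.
have [g [Pg _ Lg]] := fp_size Hl.
apply: (@fp_iter _ _ _ _ _ (fun=> behead) _ g) => //; first by fpa.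
by move=> x i _; rewrite H; exact: leq_trans (esz_drop _ _) (Lg x).
Qed.

Lemma fp_nth (d : X -> E) l (n : X -> nat) : fp d -> fp l -> fp n ->
  fp (fun x => nth (d x) (l x) (n x)).
Proof.
move=> Hd Hl Hn; apply: (@fp_ext _ _ _ _ (fun x => head (d x) (drop (n x) (l x)))).
  by apply: fp_head => //; apply: fp_drop.
by move=> x; rewrite -nth0 nth_drop addn0.
Qed.

Lemma fp_last (d : X -> E) l : fp d -> fp l -> fp (fun x => last (d x) (l x)).
Proof.
move=> Hd Hl; apply: (@fp_ext _ _ _ _ (fun x => head (d x) (rev (l x)))).
  by apply: fp_head => //; apply: fp_rev.
by move=> x; case/lastP: (l x) => //= s y; rewrite rev_rcons last_rcons.
Qed.

Lemma fp_nseq (n : X -> nat) (e : X -> E) : fp n -> fp e -> fp (fun x => nseq (n x) (e x)).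
Proof.
move=> Hn He; have H i a : iter i (cons a) [::] = nseq i a :> seq E by elim: i => //= i ->.
apply: (@fp_ext _ _ _ _ (fun x => iter (n x) (cons (e x)) [::])) => //.
have [g [Pg _ Lg]] := fp_size Hn; have [h [Ph _ Lh]] := fp_size He.
apply: (@fp_iter _ _ _ _ _ (fun x => cons (e x)) _ (fun k => g k * (2 * h k + 1))) => //.
- apply: fp_cons; last by fpa.
  by apply: (@fp_comp _ _ _ _ _ _ e) => //; by fpa.
- exact: fp_nil.
- by polyb.
move=> x i Li; rewrite H; have := Lg x; rewrite esz_nat => Ln.
have -> : esz (nseq i (e x)) = i * (2 * esz (e x) + 1).
  by elim: i {Li} => //= i IH; rewrite esz_cons IH; lia.
by rewrite leq_mul ?(leq_trans Li) // leq_add2r leq_mul2l /=.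
Qed.
End FpList3b.

Ltac fp_lists := first
  [ apply: fp_map | apply: fp_filter | apply: fp_flatten | apply: fp_listsize
  | apply: fp_has | apply: fp_all | apply: fp_drop | apply: fp_nth | apply: fp_last
  | apply: fp_nseq | apply: fp_cat | apply: fp_rev | apply: fp_rcons | fp_arith ].
Ltac fp_prim ::= fp_lists.

Section FpList4.
Context {X E : Type} {eX : encT X} {eE : encT E}.
Implicit Types l : X -> seq E.

Lemma fp_take (n : X -> nat) l : fp n -> fp l -> fp (fun x => take (n x) (l x)).
Proof.
move=> Hn Hl; apply: (@fp_ext _ _ _ _ (fun x => rev (drop (size (l x) - n x) (rev (l x))))); last first.
  move=> x; rewrite drop_rev revK; case: (leqP (n x) (size (l x))) => L; first by rewrite subKn.
  rewrite [RHS]take_oversize ?(ltnW L) // take_oversize //; lia.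
apply: fp_rev; apply: fp_drop; last exact: fp_rev.
by apply: fp_sub => //; apply: fp_listsize.
Qed.

Lemma fp_iota (m n : X -> nat) : fp m -> fp n -> fp (fun x => iota (m x) (n x)).
Proof.
move=> Hm Hn; have H i k : iter i (fun l : seq nat => k + size l :: l) [::] = rev (iota k i).
  by elim: i => // i IH; rewrite iterS IH size_rev size_iota -addn1 iotaD rev_cat.
apply: (@fp_ext _ _ _ _ (fun x => rev (iter (n x) (fun l : seq nat => m x + size l :: l) [::]))); last first.
  by move=> x; rewrite H revK.
have [g [Pg _ Lg]] := fp_size Hn; have [h [Ph _ Lh]] := fp_size Hm.
apply: fp_rev; apply: (@fp_iter _ _ _ _ _ (fun x (l : seq nat) => m x + size l :: l) _ (fun k => g k * (2 * (g k + h k) + 1))) => //.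
- apply: fp_cons; last by fpa.
  apply: fp_add; last by fpa.
  by apply: (@fp_comp _ _ _ _ _ _ m) => //; by fpa.
- exact: fp_nil.
- by polyb.
move=> x i Li; rewrite H esz_rev; have := Lg x; have := Lh x; rewrite !esz_nat => Lm Ln.
apply: leq_trans (@esz_leq _ _ _ (g (esz x) + h (esz x)) _) _; last first.
  by rewrite size_iota leq_mul2r (leq_trans Li) ?orbT.
by rewrite size_iota => j Lj d; rewrite nth_iota // esz_nat; lia.
Qed.

Lemma fp_modn (n m : X -> nat) : fp n -> fp m -> fp (fun x => n x %% m x).
Proof.
move=> Hn Hm.
pose st d r := if r.+1 == d then 0 else r.+1.
have H d i : 0 < d -> iter i (st d) 0 = i %% d.
  move=> d0; elim: i => [|i IH]; first by rewrite mod0n.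
  rewrite iterS IH /st -[in RHS]addn1 -modnDml addn1.
  have := ltn_pmod i d0; case: eqP => [->|]; first by rewrite modnn.
  by move=> ne L; rewrite [RHS]modn_small //; lia.
have H2 i d : iter i (st d) 0 <= i by elim: i => //= i IH; rewrite /st; case: ifP.
apply: (@fp_ext _ _ _ _ (fun x => if m x == 0 then n x else iter (n x) (st (m x)) 0)); last first.
  by move=> x; case: eqP => [->|]; rewrite ?modn0 // => ne; rewrite H //; lia.
have [g [Pg _ Lg]] := fp_size Hn.
apply: fp_if => //; first exact: fp_eq0.
apply: (@fp_iter _ _ _ _ _ (fun x => st (m x)) _ g) => //.
- rewrite /st; apply: fp_if; last by fpa.
    apply: fp_eqn; first by fpa.
    by apply: (@fp_comp _ _ _ _ _ _ m) => //; by fpa.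
  exact: fp_const.
- exact: fp_const.
- by move=> x i Li; rewrite esz_nat; apply: leq_trans (H2 _ _) _; apply: leq_trans Li _; have := Lg x; rewrite esz_nat.
Qed.

Lemma fp_find (p : X -> E -> bool) l :
  fp (fun q => p q.1 q.2) -> fp l -> fp (fun x => find (p x) (l x)).
Proof.
move=> Hp Hl.
pose st x (q : bool * nat) e := if q.1 then q else if p x e then (true, q.2) else (false, q.2.+1).
have H x b k (l' : seq E) : foldl (st x) (b, k) l' = if b then (b, k) else (has (p x) l', k + find (p x) l').
  elim: l' b k => [|e l' IH] b k /=; first by rewrite addn0; case: b.
  rewrite {2}/st /=; case: b => /=; first by rewrite IH.
  by case: (p x e); rewrite IH /= ?addn0 // addSnnS.
apply: (@fp_ext _ _ _ _ (fun x => (foldl (st x) (false, 0) (l x)).2)); last by move=> x; rewrite H.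
have [g [Pg _ Lg]] := fp_size Hl.
apply: fp_snd; apply: (@fp_foldl _ _ _ _ _ _ st _ _ (fun k => 3 + g k)) => //.
- apply: fp_if; [by fpa|by fpa|].
  apply: fp_if.
  + apply: (@fp_comp _ _ _ _ _ _ (fun q => p q.1 q.2) (fun q : X * (bool * nat * E) => (q.1, q.2.2))) => //.
    by apply: fp_pair; [by fpa|by fpa].
  + by apply: fp_pair; [exact: fp_const|by fpa].
  + by apply: fp_pair; [exact: fp_const|by fpa].
- exact: fp_const.
- by polyb.
- move=> x i _; rewrite H esz_pair /= esz_bool esz_nat leq_add2l add0n.
  apply: leq_trans (Lg x); apply: leq_trans (size_esz _).
  apply: leq_trans (find_size _ _) _; by rewrite size_take_min geq_minr.
Qed.
End FpList4.

Ltac fp_prim ::= first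
  [ apply: fp_take | apply: fp_iota | apply: fp_modn | apply: fp_find | fp_lists ].

Section FpStr.
Context {X : Type} {eX : encT X}.

Lemma fp_code A {eA : encT A} (f : X -> A) : fp f -> fp (fun x => Str (enc (f x))).
Proof. by move=> [g P H]; exists g. Qed.

Lemma fp_unstr (s : X -> str) : fp s -> fp (fun x => unstr (s x) : seq bool).
Proof.
move=> Hs.
have Hhd (f : str * seq bool -> str) : fp f -> fp (fun q => head false (unstr (f q))).
  move=> Hf; apply: (@fp_comp _ _ _ _ _ _ (fun t => head false (unstr t))) => //.
  exists (fun w => match w with [::] => [:: false] | false :: _ => [:: false] | true :: _ => [:: true] end).
    by apply: polyF_case; exact: polyF_const.
  by move=> [[|[] w]].
have Hbh (f : str * seq bool -> str) : fp f -> fp (fun q => Str (behead (unstr (f q)))).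
  move=> Hf; apply: (@fp_comp _ _ _ _ _ _ (fun t => Str (behead (unstr t)))) => //.
  by exists behead; first exact: polyF_behead.
pose st (q : str * seq bool) := (Str (behead (unstr q.1)), head false (unstr q.1) :: q.2).
have H i w : i <= size w -> iter i st (Str w, [::]) = (Str (drop i w), rev (take i w)).
  elim: i => [|i IH] L; first by rewrite drop0 take0.
  rewrite iterS IH ?(ltnW L) // /st /= (take_nth false L) rev_rcons (drop_nth false L) //=.
apply: (@fp_ext _ _ _ _ (fun x => rev (iter (esz (s x)) st (s x, [::])).2)); last first.
  by move=> x; case: (s x) => w; rewrite H // esz_str /= take_size revK.
have [g [Pg _ Lg]] := fp_size Hs.
apply: fp_rev; apply: fp_snd; apply: (@fp_iter _ _ _ _ _ (fun=> st) _ (fun k => 2 * g k + 1 + 3 * g k)) => //.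
- exact: fp_esz.
- have P : fp (fun q : X * (str * seq bool) => q.2) by fpa.
  apply: fp_pair; first exact: (fp_comp (Hbh _ (fp_fst fp_id)) P).
  apply: fp_cons; last by fpa.
  exact: (fp_comp (Hhd _ (fp_fst fp_id)) P).
- by apply: fp_pair => //; exact: fp_nil.
- by polyb.
move=> x i; have := Lg x; case: (s x) => w; rewrite esz_str /= => L Li.
rewrite H // esz_pair /= esz_str esz_rev esz_sumn.
have -> : sumn [seq 2 * esz a + 1 | a <- take i w] = 3 * i.
  by rewrite -[in RHS](size_takel Li); elim: (take i w) => //= b l ->; rewrite esz_bool; lia.
by rewrite size_drop; lia.
Qed.

Lemma fp_Str (l : X -> seq bool) : fp l -> fp (fun x => Str (l x)).
Proof.
move=> Hl.
pose st (t : str) b := if b then Str (true :: unstr t) else Str (false :: unstr t).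
have H t l' : foldl st t l' = Str (rev l' ++ unstr t).
  by elim: l' t => [|b l' IH] [w] //=; rewrite IH /st; case: b; rewrite rev_cons cat_rcons.
apply: (@fp_ext _ _ _ _ (fun x => foldl st (Str [::]) (rev (l x)))); last first.
  by move=> x; rewrite H revK cats0.
have [g [Pg _ Lg]] := fp_size (fp_rev Hl).
have Hc b : fp (fun q : X * (str * bool) => Str (b :: unstr q.2.1)).
  apply: (@fp_comp _ _ _ _ _ _ (fun t => Str (b :: unstr t))); last by fpa.
  by exists (cons b); first exact: polyF_cons.
apply: (@fp_foldl _ _ _ _ _ _ (fun=> st) _ _ g) => //.
- by apply: fp_if => //; by fpa.
- exact: fp_const.
- exact: fp_rev.
- move=> x i _; rewrite H cats0 esz_str /= size_rev; apply: leq_trans (Lg x).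
  by apply: leq_trans (size_esz _); by rewrite size_take_min geq_minr.
Qed.
End FpStr.

(** Codes are compared bit by bit, which is enough because [encK] makes [enc] injective. *)
Lemma fp_eq X {eX : encT X} (E : eqType) {eA : encT E} (f g : X -> E) :
  fp f -> fp g -> fp (fun x => f x == g x).
Proof.
move=> Hf Hg.
pose st (q : bool * seq bool) b := (q.1 && (~~ nilp q.2 && (head false q.2 == b)), behead q.2).
have H (l : seq bool) b r : (foldl st (b, r) l).1 && nilp (foldl st (b, r) l).2 = b && (l == r).
  elim: l b r => [|c l IH] b r /=; first by case: r.
  rewrite [st (b, r) c]/st /= IH; case: r => [|d r] /=; rewrite ?andbF //.
  by rewrite eqseq_cons -andbA [c == d]eq_sym.
apply: (@fp_ext _ _ _ _ (fun x => (foldl st (true, enc (g x) : seq bool) (enc (f x))).1 &&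
   nilp (foldl st (true, enc (g x) : seq bool) (enc (f x))).2)); last first.
  move=> x; rewrite H /=; apply/eqP/eqP => [|->] // E1.
  by rewrite -(encK (f x)) E1 encK.
have Hb (h : X -> E) : fp h -> fp (fun x => enc (h x) : seq bool).
  by move=> Hh; exact: (fp_unstr (fp_code Hh)).
have [G [PG _ LG]] := fp_size (Hb _ Hg).
have Hq : fp (fun x => foldl st (true, enc (g x)) (enc (f x))).
  apply: (@fp_foldl _ _ _ _ _ _ (fun=> st) _ _ (fun k => 3 + G k)).
  - apply: fp_pair; last by fpa.
    apply: fp_and; first by fpa.
    apply: fp_and; first by fpa.
    apply: fp_eqb; last by fpa.
    by apply: fp_head; [by fpa|exact: fp_const].
  - by apply: fp_pair; [exact: fp_const|exact: Hb].
  - exact: Hb.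
  - by polyb.
  - move=> x i _; rewrite esz_pair esz_bool leq_add2l; apply: leq_trans (LG x).
    have K l b (r : seq bool) : esz (foldl st (b, r) l).2 <= esz r.
      elim: l b r => //= c l IH b r; apply: leq_trans (IH _ _) _.
      by rewrite -drop1; exact: esz_drop.
    exact: K.
by apply: fp_and; [exact: fp_fst|by fpa].
Qed.

Ltac fp_ho ::= match goal with
  | |- fp (fun x => ?F (@?f x) (@?g x) (@?h x)) =>
    match goal with H : fp _ |- _ =>
      refine (fp_comp (f := fun x => (f x, (g x, h x))) H _) end;
    apply: fp_pair; [|apply: fp_pair]
  | |- fp (fun x => ?F (@?f x) (@?g x)) =>
    match goal with H : fp _ |- _ =>
      refine (fp_comp (f := fun x => (f x, g x)) H _) end; apply: fp_pair
  | |- fp (fun x => ?F (@?f x)) =>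
    match goal with H : fp _ |- _ => refine (fp_comp (f := f) H _) end
  end.
Ltac fp_user := fail.
Ltac fp_hyp := match goal with
  | H : fp ?n |- fp (fun q => ?n q) => exact: H
  | H : fp ?n |- fp ?n => exact: H
  | |- _ => fp_ho
  end.
Ltac fp_step ::= lazymatch goal with
  | |- fp (fun x => x) => exact: fp_id
  | |- fp (fun _ => ?c) => exact: fp_const
  | |- fp (fun x => fst (@?f x)) => first [apply: fp_fst | fp_hyp]
  | |- fp (fun x => snd (@?f x)) => first [apply: fp_snd | fp_hyp]
  | |- fp (fun x => pair (@?f x) (@?g x)) => apply: fp_pair
  | |- fp (fun x => cons (@?f x) (@?g x)) => apply: fp_cons
  | |- fp (fun x => andb (@?f x) (@?g x)) => apply: fp_and
  | |- fp (fun x => orb (@?f x) (@?g x)) => apply: fp_or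
  | |- fp (fun x => negb (@?f x)) => apply: fp_negb
  | |- fp (fun x => if _ then _ else _) => apply: fp_if
  | |- fp (fun x => behead (@?f x)) => apply: fp_behead
  | |- fp (fun x => nilp (@?f x)) => apply: fp_nilp
  | |- fp (fun x => head (@?d x) (@?f x)) => apply: fp_head
  | |- fp (fun x => esz (@?f x)) => apply: fp_esz
  | |- fp (fun x => S (@?f x)) => apply: fp_succ
  | |- fp (fun x => predn (@?f x)) => apply: fp_pred
  | |- fp (fun x => addn (@?f x) (@?g x)) => apply: fp_add
  | |- fp (fun x => subn (@?f x) (@?g x)) => apply: fp_sub
  | |- fp (fun x => muln (@?f x) (@?g x)) => apply: fp_mul
  | |- fp (fun x => leq (@?f x) (@?g x)) => apply: fp_leq
  | |- fp (fun x => modn (@?f x) (@?g x)) => apply: fp_modn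
  | |- fp (fun x => eq_op (@?f x) (@?g x)) => apply: fp_eq
  | |- fp (fun x => cat (@?f x) (@?g x)) => apply: fp_cat
  | |- fp (fun x => rev (@?f x)) => apply: fp_rev
  | |- fp (fun x => rcons (@?f x) (@?g x)) => apply: fp_rcons
  | |- fp (fun x => map (@?F x) (@?l x)) => apply: fp_map
  | |- fp (fun x => filter (@?F x) (@?l x)) => apply: fp_filter
  | |- fp (fun x => has (@?F x) (@?l x)) => apply: fp_has
  | |- fp (fun x => all (@?F x) (@?l x)) => apply: fp_all
  | |- fp (fun x => find (@?F x) (@?l x)) => apply: fp_find
  | |- fp (fun x => flatten (@?l x)) => apply: fp_flatten
  | |- fp (fun x => size (unstr (@?s x))) => apply: (fp_esz (A := str))
  | |- fp (fun x => size (@?l x)) => apply: fp_listsize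
  | |- fp (fun x => drop (@?f x) (@?g x)) => apply: fp_drop
  | |- fp (fun x => take (@?f x) (@?g x)) => apply: fp_take
  | |- fp (fun x => iota (@?f x) (@?g x)) => apply: fp_iota
  | |- fp (fun x => nseq (@?f x) (@?g x)) => apply: fp_nseq
  | |- fp (fun x => nth (@?d x) (@?f x) (@?g x)) => apply: fp_nth
  | |- fp (fun x => last (@?d x) (@?f x)) => apply: fp_last
  | |- fp (fun x => unstr (@?f x)) => apply: fp_unstr
  | |- fp (fun x => Str (enc (@?f x))) => apply: fp_code
  | |- fp (fun x => Str (@?f x)) => first [fp_user | fp_hyp | apply: fp_Str]
  | |- @fp ?A ?B ?eA ?eB ?g => lazymatch g with
      | (fun _ => _) => first [fp_user | fp_hyp]
      | _ => first [fp_hyp | change (@fp A B eA eB (fun x => g x))]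
      end
  end.

(** * Decoding, and simulation of Turing machines *)

(** For machines that receive structured data as a raw string. Decoders are total, so ill-formed
    strings also yield some value. *)
Class decT (A : Type) {eA : encT A} := fp_decT : fp (fun s : str => @dec A eA (unstr s)).

Lemma fp_dec X A {eX : encT X} {eA : encT A} {dA : @decT A _} (s : X -> str) :
  fp s -> fp (fun x => @dec A eA (unstr (s x))).
Proof. by move=> Hs; exact: (fp_comp dA Hs). Qed.

Lemma fp_pfst X {eX : encT X} (s : X -> str) : fp s -> fp (fun x => Str (pfst (unstr (s x)))).
Proof.
move=> Hs; apply: (fp_comp (g := fun t => Str (pfst (unstr t)))) Hs.
by exists pfst; first exact: polyF_pfst.
Qed.

Lemma fp_psnd X {eX : encT X} (s : X -> str) : fp s -> fp (fun x => Str (psnd (unstr (s x)))).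
Proof.
move=> Hs; apply: (fp_comp (g := fun t => Str (psnd (unstr t)))) Hs.
by exists psnd; first exact: polyF_psnd.
Qed.

Lemma fp_pow X {eX : encT X} (n : X -> nat) c : fp n -> fp (fun x => n x ^ c).
Proof.
move=> Hn; elim: c => [|c IH]; first exact: fp_const.
by apply: (@fp_ext _ _ _ _ (fun x => n x * n x ^ c)); [apply: fp_mul|move=> x; rewrite expnS].
Qed.

Ltac fp_user ::= lazymatch goal with
  | |- fp (fun x => Str (pfst (@?f x))) => apply: fp_pfst
  | |- fp (fun x => Str (psnd (@?f x))) => apply: fp_psnd
  | |- fp (fun x => expn (@?f x) ?c) => apply: fp_pow
  | |- fp (fun x => dec (unstr (@?f x))) => apply: fp_dec
  end.

#[global] Instance dec_str : @decT str _.
Proof. by apply: (@fp_ext _ _ _ _ id); [exact: fp_id|case]. Qed.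

#[global] Instance dec_nat : @decT nat _.
Proof. by apply: (@fp_ext _ _ _ _ (fun s : str => esz s)); [by fpa|by case]. Qed.

#[global] Instance dec_bool : @decT bool _.
Proof. by rewrite /decT /=; fpa. Qed.

#[global] Instance dec_prod A B (eA : encT A) (eB : encT B) (dA : @decT A _) (dB : @decT B _) :
  @decT (A * B)%type _.
Proof.
rewrite /decT /=; apply: fp_pair.
  by apply: (fp_dec (s := fun t => Str (pfst (unstr t)))); apply: fp_pfst; exact: fp_id.
by apply: (fp_dec (s := fun t => Str (psnd (unstr t)))); apply: fp_psnd; exact: fp_id.
Qed.

#[global] Instance dec_seq A (eA : encT A) (dA : @decT A _) : @decT (seq A) _.
Proof.
rewrite /decT /=.
pose st (q : str * seq A) := if nilp (unstr q.1) then q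
  else (Str (psnd (unstr q.1)), @dec A eA (pfst (unstr q.1)) :: q.2).
have H n w acc : (iter n st (Str w, acc)).2 = rev (dec_list eA n w) ++ acc.
  elim: n w acc => // n IH [|b w] acc; rewrite iterSr.
    have Z m : iter m st (Str [::], acc) = (Str [::], acc) by elim: m => //= m ->.
    by rewrite [st _]/= Z.
  by rewrite {1}/st /nilp /= IH rev_cons cat_rcons.
apply: (@fp_ext _ _ _ _ (fun s => rev (iter (esz s) st (s, [::])).2)); last first.
  by move=> [w]; rewrite H cats0 revK.
have [g [Pg Mg Lg]] := fp_size dA.
apply: fp_rev; apply: fp_snd.
apply: (@fp_iter _ _ _ _ _ (fun=> st) _ (fun k => 2 * k + 1 + k * (2 * g k + 1))).
- by fpa.
- rewrite /st; apply: fp_if; [by fpa|by fpa|apply: fp_pair].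
    by apply: fp_psnd; fpa.
  apply: fp_cons; last by fpa.
  by apply: (fp_dec (s := fun q : str * (str * seq A) => Str (pfst (unstr q.2.1)))); apply: fp_pfst; fpa.
- by fpa.
- by polyb.
move=> [w] i; rewrite esz_str /= => Li.
have K : size (unstr (iter i st (Str w, [::])).1) <= size w /\
   esz (iter i st (Str w, [::])).2 <= i * (2 * g (size w) + 1).
  elim: i {Li} => //= i; case: (iter i st _) => [[v] acc] /= [L1 L2].
  rewrite /st /=; case: ifP => _ /=; first by split=> //; apply: leq_trans L2 _; rewrite leq_mul2r leqnSn orbT.
  split; first exact: leq_trans (size_psnd _) L1.
  have HL : esz (Str (pfst v)) <= size w by exact: leq_trans (size_pfst _) L1.
  by have := leq_trans (Lg (Str (pfst v))) (Mg _ _ HL); rewrite esz_cons mulSn /=; lia.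
rewrite esz_pair esz_str; case: K => K1 K2; apply: leq_add; first lia.
by apply: leq_trans K2 _; rewrite leq_mul2r Li orbT.
Qed.

(** On a finite list any function is a table of constants. This brings transition functions, and
    later the letters of tableaux, into the calculus. *)
Lemma fp_fin X (A : eqType) B {eX : encT X} {eA : encT A} {eB : encT B}
  (l : seq A) (f : A -> B) d (a : X -> A) :
  fp a -> fp (fun x => if a x \in l then f (a x) else d).
Proof.
move=> Ha; elim: l => [|e l IH]; first exact: fp_const.
apply: (@fp_ext _ _ _ _ (fun x => if a x == e then f e else if a x \in l then f (a x) else d)).
  by apply: fp_if => //; [apply: fp_eq => //|]; exact: fp_const.
by move=> x; rewrite in_cons; case: eqP => [->|].
Qed.


Lemma enc_symK : cancel (fun s : symbol => if s is Some b then [:: b] else [::])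
  (@ohead bool).
Proof. by case. Qed.
#[global] Instance enc_optb : encT (option bool) := {| encK := enc_symK |}.
#[global] Instance enc_sym : encT symbol := enc_optb.

Lemma esz_sym (s : symbol) : esz s <= 1.
Proof. by case: s. Qed.

Section Simulation.
Variable M : machine.
Let k := (ntapes_pred M).+1.
Local Notation stape := (seq symbol * seq symbol)%type.

Definition cfg_code (c : config M) : nat * seq stape :=
  (nat_of_ord (enum_rank c.1), [seq c.2 i | i <- enum 'I_k]).

Definition move_code m := match m with MoveLeft => 0 | MoveStay => 1 | MoveRight => 2 end.

Definition act_code (q : state M) (rd : {ffun 'I_k -> symbol}) : bool * (nat * seq (symbol * nat)) :=
  (halting q, (nat_of_ord (enum_rank (delta q rd).1),
     [seq (((delta q rd).2 i).1, move_code ((delta q rd).2 i).2) | i <- enum 'I_k])).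

Definition sim_keys : seq (nat * seq symbol) :=
  [seq (nat_of_ord (enum_rank z.1), [seq z.2 i | i <- enum 'I_k]) | z : state M * {ffun 'I_k -> symbol}].

Definition sim_delta (key : nat * seq symbol) :=
  act_code (nth (start M) (enum (state M)) key.1) [ffun i : 'I_k => nth None key.2 i].

Definition sim_tape (a : symbol * nat) (t : stape) : stape :=
  let w := a.1 :: behead t.2 in
  if a.2 == 0 then (behead t.1, head None t.1 :: w)
  else if a.2 == 1 then (t.1, w) else (head None w :: t.1, behead w).

Definition sim_lookup (key : nat * seq symbol) : bool * (nat * seq (symbol * nat)) :=
  if key \in sim_keys then sim_delta key else (true, (0, [::])).

Lemma fp_sim_lookup : fp sim_lookup.
Proof. exact: (fp_fin sim_keys sim_delta (true, (0, [::])) fp_id). Qed.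

Definition sim_step (c : nat * seq stape) : nat * seq stape :=
  if (sim_lookup (c.1, [seq head None t.2 | t <- c.2])).1 then c else
  ((sim_lookup (c.1, [seq head None t.2 | t <- c.2])).2.1,
   [seq sim_tape (nth (None, 0) (sim_lookup (c.1, [seq head None t.2 | t <- c.2])).2.2 i) (nth ([::], [::]) c.2 i)
            | i <- iota 0 (size c.2)]).

Lemma nth_enum_map T (f : 'I_k -> T) d (i : 'I_k) : nth d [seq f j | j <- enum 'I_k] i = f i.
Proof. by rewrite (nth_map i) ?size_enum_ord // nth_ord_enum. Qed.

Lemma sim_stepE c : sim_step (cfg_code c) = cfg_code (step c).
Proof.
case: c => q ts; rewrite /sim_step /sim_lookup.
set key := (_, [seq head None t.2 | t <- _]).
have Ek : key = (nat_of_ord (enum_rank q), [seq [ffun i => tape_read (ts i)] i | i <- enum 'I_k]).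
  by rewrite /key /cfg_code /= -map_comp; congr (_, _); apply: eq_map => i; rewrite ffunE.
have -> : key \in sim_keys.
  by rewrite Ek; apply/mapP; exists (q, [ffun i => tape_read (ts i)]); rewrite ?mem_enum.
rewrite /sim_delta Ek /= nth_enum_rank.
have -> : [ffun i : 'I_k => nth None [seq [ffun i0 => tape_read (ts i0)] i0 | i0 <- enum 'I_k] i] =
   [ffun i => tape_read (ts i)].
  by apply/ffunP => i; rewrite ffunE nth_enum_map.
rewrite /act_code /step /=; case: (halting q) => //=.
case: (delta _ _) => q' act /=; congr (_, _).
rewrite size_map size_enum_ord -val_enum_ord -map_comp.
apply: eq_map => i /=; rewrite !nth_enum_map ffunE /sim_tape /tape_move /tape_write.
by case: (act i) => a [].
Qed.

Lemma sim_iter n c : iter n sim_step (cfg_code c) = cfg_code (iter n (@step M) c).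
Proof. by elim: n => //= n ->; rewrite sim_stepE. Qed.

Lemma step_tape_size (c : config M) i :
  size ((step c).2 i).1 + size ((step c).2 i).2 <= size (c.2 i).1 + size (c.2 i).2 + 2.
Proof.
rewrite /step; case: ifP => _; first lia.
case: (delta _ _) => q act /=; rewrite ffunE; case: (act i) => a [] /=;
  rewrite ?size_behead; lia.
Qed.

Lemma init_tape_size x i :
  size ((init_config M x).2 i).1 + size ((init_config M x).2 i).2 <= size x.
Proof. by rewrite /init_config /= ffunE; case: ifP => _ /=; rewrite ?size_map. Qed.

Lemma iter_tape_size n x i (c := iter n (@step M) (init_config M x)) :
  size (c.2 i).1 + size (c.2 i).2 <= size x + 2 * n.
Proof.
rewrite /c; elim: n {c} => [|n IH]; first by have := init_tape_size x i; rewrite /=; lia.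
rewrite iterS; apply: leq_trans (step_tape_size _ _) _.
by rewrite mulnS (addnC 2) addnA leq_add2r.
Qed.

Lemma esz_syms (l : seq symbol) : esz l <= 3 * size l.
Proof. by elim: l => //= s l IH; rewrite esz_cons; have := esz_sym s; lia. Qed.

Lemma cfg_esz n x : esz (cfg_code (iter n (@step M) (init_config M x))) <=
  2 * #|state M| + 1 + k * (2 * (6 * (size x + 2 * n) + 1) + 1).
Proof.
rewrite esz_pair esz_nat; apply: leq_add.
  by rewrite leq_add2r leq_mul2l /= ltnW.
apply: leq_trans (@esz_leq _ _ _ (6 * (size x + 2 * n) + 1) _) _; last by rewrite size_map size_enum_ord.
move=> i; rewrite size_map size_enum_ord => Li d.
rewrite -[i]/(nat_of_ord (Ordinal Li)) nth_enum_map esz_pair.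
have := iter_tape_size n x (Ordinal Li).
cbv zeta; set t := _ (Ordinal Li); move: (esz_syms t.1) (esz_syms t.2).
by move: (esz t.1) (esz t.2) (size t.1) (size t.2) => a b c e; lia.
Qed.

(** The machine is fixed and the number of steps is in unary; a step lengthens a tape by at most two
    cells, which bounds the iterates. *)
Lemma fp_sim : fp (fun q : str * nat => cfg_code (iter q.2 (@step M) (init_config M (unstr q.1)))).
Proof.
have Ec x : cfg_code (init_config M x) =
    (nat_of_ord (enum_rank (start M)), ([::], [seq Some b | b <- x]) :: nseq (ntapes_pred M) ([::], [::])).
  congr (_, _); rewrite enum_ordSl /= ffunE eqxx; congr (_ :: _).
  rewrite -map_comp -[in RHS](size_enum_ord (ntapes_pred M)).
  by elim: (enum _) => //= i l ->; rewrite ffunE -val_eqE.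
apply: (@fp_ext _ _ _ _ (fun q : str * nat => iter q.2 sim_step (nat_of_ord (enum_rank (start M)),
   ([::], [seq Some b | b <- unstr q.1]) :: nseq (ntapes_pred M) ([::], [::])))); last first.
  by move=> q; rewrite -Ec sim_iter.
apply: (@fp_iter _ _ _ _ _ (fun=> sim_step) _ (fun m => 2 * #|state M| + 1 + k * (2 * (6 * (m + 2 * m) + 1) + 1))).
- by fpa.
- have Ht : fp (fun z : (symbol * nat) * stape => sim_tape z.1 z.2) by rewrite /sim_tape; fpa.
  have Hl := fp_sim_lookup.
  by rewrite /sim_step; fpa.
- have Hs : fp (Some : bool -> symbol) by exists id; first exact: polyF_id.
  by fpa.
- by polyb.
move=> [[x] n] i /= Li; rewrite -Ec sim_iter; apply: leq_trans (cfg_esz _ _) _.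
have : esz (Str x, n) = 2 * size x + 1 + n by rewrite esz_pair esz_nat esz_str.
move=> ->; rewrite leq_add2l leq_mul2l; apply/orP; right; lia.
Qed.

Lemma iter_halted (c : config M) n m : halting (iter n (@step M) c).1 -> n <= m ->
  iter m (@step M) c = iter n (@step M) c.
Proof.
move=> H /subnK <-; rewrite iterD; move: (m - n) (iter n _ c) H => j c' H.
by elim: j => //= j ->; rewrite /step H.
Qed.

End Simulation.

Lemma bits_until_blankE s :
  bits_until_blank s = [seq x == Some true | x <- take (find (fun y : symbol => y == None) s) s].
Proof. by elim: s => [|[[]|] s IH] //=; rewrite IH. Qed.

(** Functions known only through a machine (a proof system, an NP verifier, a translation of proofs)
    enter the calculus here, by a clocked simulation. Running past the halting time is harmless
    since [step] fixes halted configurations. *)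
Lemma polytime_fp X {eX : encT X} f (s : X -> str) : polytime f -> fp s ->
  fp (fun x => Str (f (unstr (s x)))).
Proof.
move=> [M [t [/poly_boundedE[c Hc] HM]]] Hs.
apply: (fp_comp (g := fun z => Str (f (unstr z)))) Hs.
have Hsim := fp_sim M; have Hn : fp (fun z : str => (z, (esz z + 2) ^ c)).
  by apply: fp_pair; [fpa|apply: fp_pow; fpa].
have Hc1 := fp_comp Hsim Hn; cbv beta in Hc1.
have Hl : fp (fun z : str => (last ([::], [::]) (cfg_code (iter ((esz z + 2) ^ c) (@step M) (init_config M (unstr z)))).2).2).
  by apply: fp_snd; apply: fp_last; [fpa|apply: fp_snd].
apply: (@fp_ext _ _ _ _ (fun z => Str [seq x == Some true | x <- take (find (fun y : symbol => y == None)
   (last ([::], [::]) (cfg_code (iter ((esz z + 2) ^ c) (@step M) (init_config M (unstr z)))).2).2)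
   (last ([::], [::]) (cfg_code (iter ((esz z + 2) ^ c) (@step M) (init_config M (unstr z)))).2).2])).
  apply: fp_Str; apply: fp_map; first by fpa.
  by apply: fp_take => //; apply: fp_find => //; fpa.
move=> [x]; congr Str; rewrite -bits_until_blankE.
have [n [Ln Hn' Ho]] := HM x.
have -> : iter ((esz (Str x) + 2) ^ c) (@step M) (init_config M (unstr (Str x))) =
   iter n (@step M) (init_config M x).
  by apply: iter_halted => //; apply: leq_trans Ln (Hc _).
rewrite -Ho /output /=; congr (bits_until_blank _.2).
rewrite (last_nth ([::], [::])) size_map size_enum_ord /=.
exact: (nth_enum_map _ _ ord_max).
Qed.

Lemma fp_polytime (f : bitstring -> bitstring) : fp (fun s => Str (f (unstr s))) -> polytime f.
Proof.
move=> [g [T [t [Pt HT Ht]]] E]; apply: polyF_polytime.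
have -> : f = g by apply: funext => x; rewrite (E (Str x)).
by exists T, t; split=> // x _; apply: Ht; exists (Str x).
Qed.

(** * Binary numbers and local constraint systems *)

Fixpoint words n : seq bitstring :=
  if n is n.+1 then [seq false :: w | w <- words n] ++ [seq true :: w | w <- words n]
  else [:: [::]].

Lemma size_words n : size (words n) = 2 ^ n.
Proof. by elim: n => //= n IH; rewrite size_cat !size_map IH expnS mul2n addnn. Qed.

Lemma mem_words n w : (w \in words n) = (size w == n).
Proof.
have inj b : injective (cons b : bitstring -> bitstring) by move=> u v [].
have ne b c (u : bitstring) l : b != c -> (b :: u \in [seq c :: w | w <- l]) = false.
  by move=> bc; apply/negbTE/mapP => -[v _ [E]]; rewrite E eqxx in bc.
elim: n w => [|n IH] [|b w] //=; rewrite mem_cat.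
  by apply/negbTE; rewrite negb_or; apply/andP; split; apply/mapP => -[].
by case: b; rewrite (mem_map (@inj _)) ?ne ?IH ?orbF ?eqSS.
Qed.

Lemma uniq_words n : uniq (words n).
Proof.
elim: n => //= n IH; rewrite cat_uniq !map_inj_uniq ?IH; try by move=> u v [].
by rewrite andbT; apply/hasPn => _ /mapP[w _ ->]; apply/mapP => -[].
Qed.

(* The most significant bit comes first. *)
Definition bval (w : bitstring) := foldl (fun v (b : bool) => 2 * v + b) 0 w.

Lemma bval_rcons w b : bval (rcons w b) = 2 * bval w + b.
Proof. by rewrite /bval -cats1 foldl_cat. Qed.

Lemma bval_lt w : bval w < 2 ^ size w.
Proof.
elim/last_ind: w => // w b IH; rewrite bval_rcons size_rcons expnS.
by case: b; lia.
Qed.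

Definition bits_step (q : nat * bitstring) := (q.1./2, odd q.1 :: q.2).
Definition bits l p := (iter l bits_step (p, [::])).2.

Lemma bitsS l p : bits l.+1 p = rcons (bits l p./2) (odd p).
Proof.
suff H acc : (iter l bits_step (p./2, acc)).2 = bits l p./2 ++ acc.
  by rewrite /bits iterSr /bits_step /= H cats1.
rewrite /bits; elim: l (p./2) acc => // l IH q acc.
by rewrite !iterSr /bits_step /= !(IH _ (_ :: _)) -catA.
Qed.

Lemma size_bits l p : size (bits l p) = l.
Proof. by elim: l p => // l IH p; rewrite bitsS size_rcons IH. Qed.

Lemma bval_bits l p : p < 2 ^ l -> bval (bits l p) = p.
Proof.
elim: l p => [|l IH] p; first by case: p.
rewrite bitsS bval_rcons expnS => H; rewrite IH; last by lia.
by rewrite mul2n addnC odd_double_half.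
Qed.

Lemma bits_bval w : bits (size w) (bval w) = w.
Proof.
elim/last_ind: w => // w b IH; rewrite size_rcons bitsS bval_rcons.
rewrite mul2n addnC half_bit_double IH oddD odd_double addbF.
by case: b.
Qed.

Definition dcode x y : bool * bool :=
  if x == y then (false, false) else if y == x.+1 then (false, true)
  else if x == y.+1 then (true, false) else (true, true).

(** Appending the low bits a and b changes the difference D = y - x into 2D + b - a. From 0 it goes
    to -1, 0 or 1; from 1 or -1 it stays or leaves; once |D| >= 2 it never comes back. *)
Definition dnext (d : bool * bool) (a b : bool) : bool * bool :=
  match d with
  | (false, false) => (a && ~~ b, ~~ a && b)
  | (false, true) => (~~ (a && ~~ b), true)
  | (true, false) => (true, ~~ (~~ a && b))
  | (true, true) => d
  end.

Lemma dnextE x y a b : dnext (dcode x y) a b = dcode (2 * x + a) (2 * y + b).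
Proof.
rewrite /dcode; case: eqP => [->|ne1].
  by case: a; case: b => /=; do ?case: eqP => //= *; exfalso; lia.
case: eqP => [->|ne2]; first by case: a; case: b => /=; do ?case: eqP => //= *; exfalso; lia.
case: eqP => [->|ne3]; first by case: a; case: b => /=; do ?case: eqP => //= *; exfalso; lia.
by case: a; case: b => /=; do ?case: eqP => //= *; exfalso; lia.
Qed.

(* The state of an automaton reading two words in parallel; it compares their
   values (equal, successor, predecessor, other) and tests whether the first
   word consists of 0s, or of 1s. *)
Definition pstep (s : bitstring) (a b : bool) : bitstring :=
  let d := dnext (nth false s 0, nth false s 1) a b in
  [:: d.1; d.2; nth false s 2 && ~~ a; nth false s 3 && a].
Definition pstart : bitstring := [:: false; false; true; true].
Definition pst (t t' : bitstring) : bitstring :=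
  foldl (fun s ab => pstep s ab.1 ab.2) pstart (zip t t').

Lemma pstE t t' : size t = size t' -> pst t t' =
  [:: (dcode (bval t) (bval t')).1; (dcode (bval t) (bval t')).2;
      bval t == 0; (bval t).+1 == 2 ^ size t].
Proof.
elim/last_ind: t t' => [|t a IH] t'; first by case: t'.
case/lastP: t' => [|t' b]; first by rewrite size_rcons.
rewrite !size_rcons => -[E]; rewrite /pst zip_rcons // foldl_rcons -/(pst t t') IH //.
have -> d u v c e : pstep [:: d.1; d.2; u; v] c e =
  [:: (dnext d c e).1; (dnext d c e).2; u && ~~ c; v && c] by case: d.
rewrite dnextE !bval_rcons.
do 2!congr (_ :: _); congr [:: _; _].
  by rewrite addn_eq0 muln_eq0 /=; case: a.
rewrite expnS; have := bval_lt t; move: (2 ^ _) (bval t) => N x L.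
by case: a; [case: eqP => ?; case: eqP => ? //=; lia|rewrite andbF; case: eqP => //; lia].
Qed.

(* A system (B, viol) constrains the assignments v of B bits to the cells of a
   2^l x 2^l grid whose rows are times and whose columns are positions. *)
Definition sysT := (nat * seq bitstring)%type.
Definition assignment := nat -> bitstring -> bitstring -> bool.

Definition letter_bits B (v : assignment) t p := [seq v f t p | f <- iota 0 B].

Definition pair_word B (v : assignment) t p t' p' :=
  pst t t' ++ pst p p' ++ letter_bits B v t p ++ letter_bits B v t' p'.

(** All pairs of cells are constrained, and whether two cells are neighbours is read from the word
    itself, through the automaton states. Thus one finite set of forbidden words serves for all
    l. *)
Definition holds (s : sysT) l (v : assignment) := forall t p t' p',
  size t = l -> size p = l -> size t' = l -> size p' = l ->
  pair_word s.1 v t p t' p' \notin s.2.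

(** Two bits per symbol because a cell can also be blank: bit 0 means true and bit 1 means false. *)
Definition starts_with (xs : bitstring) l (v : assignment) := forall i, i < size xs ->
  v 0 (bits l 0) (bits l i) = nth false xs i /\
  v 1 (bits l 0) (bits l i) = ~~ nth false xs i.

Section Tableau.
Variable M : machine.
Let k := (ntapes_pred M).+1.
Local Notation syms := {ffun 'I_k -> symbol}.
Local Notation letter := ((state M * syms) * (syms * syms))%type.

(** A one-hot code, preceded by the two bits about the first tape that [starts_with] reads. *)
Definition letter_code (x : letter) : bitstring :=
  (x.2.1 ord0 == Some true) :: (x.2.1 ord0 == Some false) ::
  [seq x == y | y <- enum {: letter}].
Definition nbits := #|{: letter}|.+2.

Lemma size_letter_code x : size (letter_code x) = nbits.
Proof. by rewrite /= size_map -cardE. Qed.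

Lemma letter_code_inj : injective letter_code.
Proof.
move=> x y [_ _ E].
by move/eq_in_map: E => /(_ x (mem_enum _ x)); rewrite eqxx => /esym/eqP.
Qed.

(** Positions are relative to the heads, so that a head move shifts a whole tape by one cell and a
    step relates neighbouring cells only. The state and the scanned symbols are copied into every
    cell of the row, to be available locally. *)
Definition letter_at (c : config M) p : letter :=
  ((c.1, [ffun i => tape_read (c.2 i)]),
   ([ffun i => nth None (c.2 i).2 p], [ffun i => nth None (c.2 i).1 p])).

Definition next_right m a (R L : nat -> symbol) p :=
  let W p := if p == 0 then a else R p in
  match m with
  | MoveStay => W p
  | MoveLeft => if p is p'.+1 then W p' else L 0
  | MoveRight => R p.+1
  end.
Definition next_left m a (R L : nat -> symbol) p :=
  match m with
  | MoveStay => L p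
  | MoveLeft => L p.+1
  | MoveRight => if p is p'.+1 then L p' else a
  end : symbol.

Lemma nth_tape_move m a t p :
  nth None (tape_move m (tape_write a t)).2 p = next_right m a (nth None t.2) (nth None t.1) p /\
  nth None (tape_move m (tape_write a t)).1 p = next_left m a (nth None t.2) (nth None t.1) p.
Proof.
by case: t => l r; case: m; case: p => [|[|p]] /=; rewrite ?nth_behead ?nth0; case: l; case: r.
Qed.

(** The flags [zt], [mt] and [zp] stand for the first row, the last row and the first column. *)
Definition cell_ok zt mt zp (x : letter) :=
  [&& zp ==> (x.1.2 == x.2.1),
      zt ==> [&& x.1.1 == start M, x.2.2 == [ffun=> None] &
                 [forall i, (i != ord0) ==> (x.2.1 i == None)]] &
      (mt && zp) ==> halting x.1.1 && (x.2.1 ord_max == Some true)].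
(** In the first row, blanks of the first tape spread to the right, so that this row is a bit string
    followed by blanks. *)
Definition row_ok zt (x y : letter) :=
  (y.1 == x.1) && (zt && (x.2.1 ord0 == None) ==> (y.2.1 ord0 == None)).
(* y is one time step after x, and at the same position, one position to the
   right, or one position to the left respectively *)
Definition up_ok zp (x y : letter) :=
  if halting x.1.1 then (y.1.1 == x.1.1) && (y.2 == x.2) else
  (y.1.1 == (delta x.1.1 x.1.2).1) &&
  [forall i, let a := (delta x.1.1 x.1.2).2 i in
     match a.2 with
     | MoveStay => (y.2.1 i == if zp then a.1 else x.2.1 i) && (y.2.2 i == x.2.2 i)
     | MoveLeft => zp ==> (y.2.1 i == x.2.2 i)
     | MoveRight => zp ==> (y.2.2 i == a.1)
     end].
Definition up_right_ok zp (x y : letter) :=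
  ~~ halting x.1.1 ==> [forall i, let a := (delta x.1.1 x.1.2).2 i in
     match a.2 with
     | MoveStay => true
     | MoveLeft => y.2.1 i == if zp then a.1 else x.2.1 i
     | MoveRight => y.2.2 i == x.2.2 i
     end].
Definition up_left_ok (x y : letter) :=
  ~~ halting x.1.1 ==> [forall i, let a := (delta x.1.1 x.1.2).2 i in
     match a.2 with
     | MoveStay => true
     | MoveLeft => y.2.2 i == x.2.2 i
     | MoveRight => y.2.1 i == x.2.1 i
     end].

Definition pair_ok (dt dp : bool * bool) zt mt zp (x y : letter) :=
  match dt, dp with
  | (false, false), (false, false) => cell_ok zt mt zp x
  | (false, false), (false, true) => row_ok zt x y
  | (false, true), (false, false) => up_ok zp x y
  | (false, true), (false, true) => up_right_ok zp x y
  | (false, true), (true, false) => up_left_ok x y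
  | _, _ => true
  end.

Definition word_ok (w : bitstring) :=
  [exists x, exists y, [&& take nbits (drop 8 w) == letter_code x,
     drop nbits (drop 8 w) == letter_code y &
     pair_ok (nth false w 0, nth false w 1) (nth false w 4, nth false w 5)
       (nth false w 2) (nth false w 3) (nth false w 6) x y]].

Definition tableau_sys : sysT :=
  (nbits, [seq w <- words (8 + nbits + nbits) | ~~ word_ok w]).

Lemma tableau_sys_viol w : w \notin tableau_sys.2 -> size w = 8 + nbits + nbits -> word_ok w.
Proof.
by rewrite mem_filter mem_words => H E; move: H; rewrite E eqxx andbT negbK.
Qed.

Lemma size_pst t t' : size (pst t t') = 4.
Proof.
rewrite /pst; suff H s l : size s = 4 -> size (foldl (fun s (ab : bool * bool) => pstep s ab.1 ab.2) s l) = 4.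
  exact: H.
by elim: l s => // ab l IH s _; apply: IH.
Qed.

Lemma size_letter_bits B v t p : size (letter_bits B v t p) = B.
Proof. by rewrite size_map size_iota. Qed.

Lemma word_okE v t p t' p' :
  size t = size t' -> size p = size p' ->
  word_ok (pair_word nbits v t p t' p') =
  [exists x, exists y, [&& letter_bits nbits v t p == letter_code x,
     letter_bits nbits v t' p' == letter_code y &
     pair_ok (dcode (bval t) (bval t')) (dcode (bval p) (bval p'))
       (bval t == 0) ((bval t).+1 == 2 ^ size t) (bval p == 0) x y]].
Proof.
have W d1 d2 z m e1 e2 y u (A C : bitstring) : size A = nbits ->
    word_ok ([:: d1; d2; z; m; e1; e2; y; u] ++ A ++ C) = [exists x, exists x',
      [&& A == letter_code x, C == letter_code x' & pair_ok (d1, d2) (e1, e2) z m y x x']].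
  move=> H; rewrite /word_ok (@drop_size_cat _ 8 [:: d1; d2; z; m; e1; e2; y; u]) //.
  by rewrite take_size_cat // drop_size_cat.
move=> Et Ep; rewrite /pair_word !pstE // catA [[:: _; _; _; _] ++ _]/= W ?size_letter_bits //.
by rewrite -!surjective_pairing.
Qed.

Lemma tableau_complete l z xs :
  let cf n := iter n (@step M) (init_config M z) in
  let v f t p := nth false (letter_code (letter_at (cf (bval t)) (bval p))) f in
  halting (cf (2 ^ l).-1).1 -> head None ((cf (2 ^ l).-1).2 ord_max).2 = Some true ->
  prefix xs z -> size xs <= 2 ^ l ->
  holds tableau_sys l v /\ starts_with xs l v.
Proof.
move=> cf v Hh Ho Hz Hx.
have Ev t p : letter_bits nbits v t p = letter_code (letter_at (cf (bval t)) (bval p)).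
  apply: (@eq_from_nth _ false); first by rewrite size_letter_bits size_letter_code.
  by rewrite size_letter_bits => f Hf; rewrite (nth_map 0) ?size_iota // nth_iota.
split=> [t p t' p' Et Ep Et' Ep'|i Hi].
  rewrite mem_filter negb_and negbK; apply/orP; left.
  rewrite word_okE; [|by rewrite Et Et'|by rewrite Ep Ep'].
  apply/existsP; exists (letter_at (cf (bval t)) (bval p)).
  apply/existsP; exists (letter_at (cf (bval t')) (bval p')).
  rewrite !Ev !eqxx /=.
  have stp : cf (bval t).+1 = step (cf (bval t)) by [].
  rewrite /pair_ok {1}/dcode; case: eqP => [tt'|_].
    rewrite -tt' /dcode; case: eqP => [_|_].
      apply/and3P; split; apply/implyP => /=.
      - by move/eqP=> ->; apply/eqP/ffunP => j; rewrite !ffunE; exact: (esym (nth0 _ _)).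
      - move/eqP=> ->; rewrite /cf /= /init_config /= eqxx /=; apply/andP; split.
          by apply/eqP/ffunP => j; rewrite !ffunE nth_nil.
        by apply/forallP => j; apply/implyP => /negbTE nj; rewrite !ffunE nj nth_nil.
      - move=> /andP[/eqP tm /eqP ->]; rewrite ffunE -[bval t]/(bval t).+1.-1 tm Et Hh.
        by apply/eqP; rewrite -Ho; exact: (nth0 _ _).
    case: eqP => [->|_]; last by case: ifP.
    rewrite /row_ok /= eqxx /=; apply/implyP => /andP[/eqP -> ].
    rewrite /cf /= !ffunE /=; case: (leqP (size z) (bval p)) => Hp; last first.
      by rewrite (nth_map false).
    by rewrite !nth_default ?eqxx // size_map // (leq_trans Hp).
  case: eqP => [->|_]; last by case: ifP.
  rewrite stp; move: (cf (bval t)) => c.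
  have N (H : halting c.1 = false) i q := nth_tape_move ((delta c.1 [ffun i => tape_read (c.2 i)]).2 i).2
     ((delta c.1 [ffun i => tape_read (c.2 i)]).2 i).1 (c.2 i) q.
  have S (H : halting c.1 = false) : step c = ((delta c.1 [ffun i => tape_read (c.2 i)]).1,
     [ffun i => tape_move ((delta c.1 [ffun i => tape_read (c.2 i)]).2 i).2
        (tape_write ((delta c.1 [ffun i => tape_read (c.2 i)]).2 i).1 (c.2 i))]).
    by rewrite /step H; case: (delta _ _).
  rewrite {1}/dcode; case: eqP => [->|_].
    rewrite /up_ok /=; case H: (halting c.1); first by rewrite /step H !eqxx.
    rewrite S //= eqxx /=; apply/forallP => i; have [N1 N2] := N H i (bval p').
    rewrite !ffunE N1 N2; case: (_ .2) => /=.
    + by apply/implyP => /eqP ->.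
    + by rewrite !eqxx.
    + by apply/implyP => /eqP ->.
  case: eqP => [->|_].
    rewrite /up_right_ok /=; apply/implyP => /negbTE H; apply/forallP => i.
    have [N1 N2] := N H i (bval p).+1.
    by rewrite S // !ffunE N1 N2; case: (_ .2) => /=.
  case: eqP => [->|_] //.
  rewrite /up_left_ok /=; apply/implyP => /negbTE H; apply/forallP => i.
  have [N1 N2] := N H i (bval p').
  by rewrite S // !ffunE N1 N2; case: (_ .2) => /=.
rewrite /v /= !ffunE bval_bits ?bval_bits ?expn_gt0 ?(leq_trans Hi) //= ffunE /=.
have [y Ez] := prefixP Hz.
rewrite Ez (nth_map false) ?nth_cat ?Hi; last by rewrite size_cat (leq_trans Hi) ?leq_addr.
by case: (nth _ _ _).
Qed.

(** The constraints prescribe a prefix xs of the input only; the rest y is read off the first row.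
    This is how a falsified formula will provide a witness for the test. *)
Lemma tableau_sound l v xs : size xs <= 2 ^ l ->
  holds tableau_sys l v -> starts_with xs l v ->
  exists y, let c := iter (2 ^ l).-1 (@step M) (init_config M (xs ++ y)) in
    halting c.1 /\ head None (c.2 ord_max).2 = Some true.
Proof.
move=> Hx Hv Hs; pose N := 2 ^ l; have N0 : 0 < N by rewrite expn_gt0.
pose lb t p := letter_bits nbits v (bits l t) (bits l p).
have P t p t' p' : t < N -> p < N -> t' < N -> p' < N -> exists x y,
    [/\ lb t p = letter_code x, lb t' p' = letter_code y &
     pair_ok (dcode t t') (dcode p p') (t == 0) (t.+1 == N) (p == 0) x y].
  move=> Ht Hp Ht' Hp'.
  have := Hv (bits l t) (bits l p) (bits l t') (bits l p').
  rewrite !size_bits => /(_ erefl erefl erefl erefl) /tableau_sys_viol.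
  rewrite !size_cat !size_pst !size_letter_bits => /(_ erefl).
  rewrite word_okE ?size_bits // !bval_bits // => /existsP[x /existsP[y /and3P[/eqP A /eqP B C]]].
  by exists x, y.
pose dl : letter := letter_at (init_config M [::]) 0.
pose lam t p : letter := odflt dl [pick x | lb t p == letter_code x].
have lamE t p x : lb t p = letter_code x -> lam t p = x.
  move=> E; rewrite /lam; case: pickP => [y /eqP Ey|/(_ x)]; last by rewrite E eqxx.
  by apply: letter_code_inj; rewrite -E.
have OK t p t' p' : t < N -> p < N -> t' < N -> p' < N ->
    pair_ok (dcode t t') (dcode p p') (t == 0) (t.+1 == N) (p == 0) (lam t p) (lam t' p').
  by move=> Ht Hp Ht' Hp'; have [x [y [/lamE -> /lamE -> ]]] := P _ _ _ _ Ht Hp Ht' Hp'.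
have d0 x : dcode x x = (false, false) by rewrite /dcode eqxx.
have d1 x : dcode x x.+1 = (false, true) by rewrite /dcode eqxx; case: eqP => // E; lia.
have d2 x : dcode x.+1 x = (true, false).
  by rewrite /dcode eqxx; case: eqP => [|_]; [lia|case: eqP => //; lia].
pose R0 := [seq (lam 0 p).2.1 ord0 | p <- iota 0 N].
pose z := bits_until_blank R0.
have C00 p : p < N -> cell_ok true (1 == N) (p == 0) (lam 0 p).
  by move=> Hp; have := OK 0 p 0 p N0 Hp N0 Hp; rewrite !d0.
have blank p : p.+1 < N -> (lam 0 p).2.1 ord0 = None -> (lam 0 p.+1).2.1 ord0 = None.
  move=> Hp E; have := OK 0 p 0 p.+1 N0 (ltnW Hp) N0 Hp; rewrite d0 d1 /= /row_ok.
  by rewrite E eqxx => /andP[_ /eqP].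
have zE p : p < N -> nth None (map some z) p = (lam 0 p).2.1 ord0.
  have K (s : seq symbol) : (forall i, i.+1 < size s -> nth None s i = None -> nth None s i.+1 = None) ->
      forall i, nth None (map some (bits_until_blank s)) i = nth None s i.
    elim: s => [|[b|] s IH] H i /=; first by rewrite !nth_nil.
      by case: i => //= i; apply: IH => j Hj; apply: (H j.+1).
    rewrite nth_nil; suff : forall i, nth None (None :: s) i = None by move->.
    elim=> // j IHj; case: (ltnP j.+1 (size s).+1) => L; first exact: (H j).
    by rewrite nth_default.
  move=> Hp; rewrite K; first by rewrite (nth_map 0) ?size_iota // nth_iota.
  move=> i; rewrite size_map size_iota => Hi.
  rewrite !(nth_map 0) ?size_iota ?(ltnW Hi) // !nth_iota ?(ltnW Hi) //.
  exact: blank.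
have codeE t p : t < N -> p < N -> lb t p = letter_code (lam t p).
  by move=> Ht Hp; have [x [y [E _ _]]] := P t p t p Ht Hp Ht Hp; rewrite (lamE _ _ _ E).
have xsE i : i < size xs -> (lam 0 i).2.1 ord0 = Some (nth false xs i).
  move=> Hi; have Hi2 := leq_trans Hi Hx; have [H0 H1] := Hs i Hi.
  have := codeE 0 i N0 Hi2; rewrite /lb /letter_bits /nbits /= => -[].
  by rewrite H0 H1; case: (nth _ _ _) => [/esym/eqP|_ /esym/eqP].
have [y Ez] : exists y, z = xs ++ y.
  exists (drop (size xs) z); rewrite -[LHS](cat_take_drop (size xs)); congr (_ ++ _).
  have Lz : size xs <= size z.
    rewrite leqNgt; apply/negP => L; have := xsE _ L.
    by rewrite -zE ?(leq_trans L) // nth_default // size_map.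
  apply: (@eq_from_nth _ false); first by rewrite size_takel.
  rewrite size_takel // => i Hi; rewrite nth_take //.
  have := xsE _ Hi; rewrite -zE ?(leq_trans Hi) // (nth_map false) ?(leq_trans Hi) //.
  by case.
exists y; rewrite -Ez /=; pose cf n := iter n (@step M) (init_config M z).
(* Nothing is known beyond the right edge of the grid, and cell (t + 1, p) depends on cell (t, p +
   1). So the letters are right in the triangle t + p < N, which still contains the first cell of
   the last row. *)
have main t p : t + p < N -> lam t p = letter_at (cf t) p.
  elim: t p => [|t IH] p Hp.
    have glob q : q < N -> (lam 0 q).1 = (start M, [ffun i => tape_read ((cf 0).2 i)]).
      have R i q' : q' < N -> (lam 0 q').2.1 i = nth None ((cf 0).2 i).2 q'.
        move=> Hq'; rewrite /cf /= ffunE /=; case: (altP (i =P ord0)) => [->|ni].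
          by rewrite -zE.
        have /and3P[_ /implyP/(_ isT)/and3P[_ _ /forallP ER] _] := C00 _ Hq'.
        by have := ER i; rewrite ni /= => /eqP ->; rewrite nth_nil.
      elim: q => [|q IHq] Hq.
        have /and3P[/implyP/(_ isT)/eqP E1 /implyP/(_ isT)/and3P[/eqP E2 _ _] _] := C00 _ Hq.
        rewrite [LHS]surjective_pairing E1 E2; congr (_, _); apply/ffunP => i.
        by rewrite R // [RHS]ffunE; exact: (nth0 _ _).
      have := OK 0 q 0 q.+1 N0 (ltnW Hq) N0 Hq; rewrite d0 d1 /= /row_ok => /andP[/eqP -> _].
      exact: IHq (ltnW Hq).
    rewrite add0n in Hp.
    have /and3P[_ /implyP/(_ isT)/and3P[_ /eqP EL /forallP ER] _] := C00 _ Hp.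
    rewrite [LHS]surjective_pairing glob // [(lam 0 p).2]surjective_pairing EL.
    congr (_, (_, _)); apply/ffunP => i; rewrite !ffunE /=; last by rewrite nth_nil.
    case: (altP (i =P ord0)) => [->|ni]; first by rewrite -zE.
    by have := ER i; rewrite ni /= => /eqP ->; rewrite nth_nil.
  have Ht : t < N by lia.
  have Ht' : t.+1 < N by lia.
  pose c := cf t; have stp : cf t.+1 = step c by [].
  have IH0 q : t + q < N -> lam t q = letter_at c q by apply: IH.
  have U q : t.+1 + q < N -> up_ok (q == 0) (letter_at c q) (lam t.+1 q).
    by move=> Hq; rewrite -IH0; [have := OK t q t.+1 q; rewrite d1 d0 => /(_ Ht); apply; lia|lia].
  have UR q : t.+1 + q.+1 < N -> up_right_ok (q == 0) (letter_at c q) (lam t.+1 q.+1).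
    by move=> Hq; rewrite -IH0; [have := OK t q t.+1 q.+1; rewrite !d1 => /(_ Ht); apply; lia|lia].
  have UL q : t.+1 + q < N -> up_left_ok (letter_at c q.+1) (lam t.+1 q).
    by move=> Hq; rewrite -IH0; [have := OK t q.+1 t.+1 q; rewrite d1 d2 => /(_ Ht); apply; lia|lia].
  have Row q : t.+1 + q.+1 < N -> (lam t.+1 q.+1).1 = (lam t.+1 q).1.
    by move=> Hq; have := OK t.+1 q t.+1 q.+1; rewrite d0 d1 => /(_ Ht') H; have /andP[/eqP] : row_ok (t.+1 == 0) (lam t.+1 q) (lam t.+1 q.+1) by apply: H; lia.
  have Cell0 : (lam t.+1 0).1.2 = (lam t.+1 0).2.1.
    by have := OK t.+1 0 t.+1 0; rewrite !d0 => /(_ Ht' N0 Ht' N0) /and3P[/implyP/(_ isT)/eqP].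
  have State q : t.+1 + q < N -> (lam t.+1 q).1.1 = (step c).1.
    move=> /U; rewrite /up_ok /step /=; case H: (halting c.1); first by case/andP => /eqP.
    by case: (delta _ _) => q' act /andP[/eqP].
  have LR q : t.+1 + q < N -> (lam t.+1 q).2 = (letter_at (step c) q).2.
    move=> Hq; have := U q Hq; rewrite /up_ok /=; case H: (halting c.1).
      by move=> /andP[_ /eqP ->]; rewrite /step H.
    move=> /andP[_ /forallP Uq]; rewrite [LHS]surjective_pairing /letter_at /=.
    rewrite /step H; case E: (delta _ _) => [q' act] /=.
    have UR' q1 : q = q1.+1 -> forall i, match (act i).2 with MoveStay => true
       | MoveLeft => (lam t.+1 q).2.1 i == if q1 == 0 then (act i).1 else nth None (c.2 i).2 q1
       | MoveRight => (lam t.+1 q).2.2 i == nth None (c.2 i).1 q1 end.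
      move=> Eq i; rewrite Eq in Hq *; have := UR q1 Hq; rewrite /up_right_ok /= H /= => /forallP/(_ i).
      by rewrite E /=; case: (act i) => a [] //=; rewrite ?ffunE.
    have UL' i : match (act i).2 with MoveStay => true
       | MoveLeft => (lam t.+1 q).2.2 i == nth None (c.2 i).1 q.+1
       | MoveRight => (lam t.+1 q).2.1 i == nth None (c.2 i).2 q.+1 end.
      have := UL q Hq; rewrite /up_left_ok /= H /= => /forallP/(_ i).
      by rewrite E /=; case: (act i) => a [] //=; rewrite ?ffunE.
    congr (_, _); apply/ffunP => i; have := Uq i; have := UL' i; rewrite E /= !ffunE;
      have [N1 N2] := nth_tape_move (act i).2 (act i).1 (c.2 i) q; rewrite ?N1 ?N2.
      case Ea: (act i).2 => /=.
      + by move=> _; case Eq: q => [|q1] /=; [move/eqP|move=> _; have := UR' q1 Eq i; rewrite Ea Eq => /eqP].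
      + by move=> _ /andP[/eqP].
      + by move=> /eqP.
    case Ea: (act i).2 => /=.
    + by move=> /eqP.
    + by move=> _ /andP[_ /eqP].
    + by move=> _; case Eq: q => [|q1] /=; [move/eqP|move=> _; have := UR' q1 Eq i; rewrite Ea Eq => /eqP].
  have Glob q : t.+1 + q < N -> (lam t.+1 q).1 = (letter_at (step c) q).1.
    elim: q => [|q IHq] Hq; last by rewrite Row // IHq //; lia.
    by rewrite [LHS]surjective_pairing Cell0 LR ?State //=; congr (_, _); apply/ffunP => i; rewrite !ffunE; exact: (nth0 _ _).
  by rewrite stp [LHS]surjective_pairing LR // Glob.
have E : lam N.-1 0 = letter_at (cf N.-1) 0 by apply: main; lia.
have := OK N.-1 0 N.-1 0; rewrite !d0 prednK // eqxx => H.
have /and3P[_ _ /implyP/(_ isT)] : cell_ok (N.-1 == 0) true true (lam N.-1 0) by apply: H; lia.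
by rewrite E /= ffunE => /andP[Hh /eqP Ho].
Qed.
End Tableau.

(** * The propositional translation of a system *)

#[global] Instance enc_bs : encT bitstring := enc_seq enc_bool.
#[global] Instance dec_bs : @decT bitstring _ := @dec_seq bool enc_bool dec_bool.

Definition word_step pad (l : seq bitstring) : seq bitstring :=
  if 2 * size l <= pad then [seq false :: w | w <- l] ++ [seq true :: w | w <- l] else [::].

Lemma word_stepE k pad : 2 ^ k <= pad -> iter k (word_step pad) [:: [::]] = words k.
Proof.
elim: k => // k IH L; rewrite iterS IH; last by rewrite (leq_trans _ L) // leq_exp2l.
by rewrite /word_step size_words -expnS L.
Qed.

(** The list has 2^k elements, so a unary number of that order must be at hand. The guard in
    [word_step] limits every iterate to [pad + 1] words. *)
Lemma fp_words X {eX : encT X} (k pad : X -> nat) : fp k -> fp pad ->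
  (forall x, 2 ^ k x <= pad x) -> fp (fun x => words (k x)).
Proof.
move=> Hk Hp L.
apply: (@fp_ext _ _ _ _ (fun x => iter (k x) (word_step (pad x)) [:: [::]])); last first.
  by move=> x; apply: word_stepE.
have [g [Pg _ Lg]] := fp_size Hk; have [h [Ph _ Lh]] := fp_size Hp.
apply: (@fp_iter _ _ _ _ _ (fun x => word_step (pad x)) _
  (fun n => (h n + 1) * (2 * (3 * g n) + 1))) => //.
- by rewrite /word_step; fpa.
- by fpa.
- by polyb.
move=> x i Hi.
have := Lg x; have := Lh x; rewrite !esz_nat => L1 L2.
have [S1 S2] : size (iter i (word_step (pad x)) [:: [::]]) <= pad x + 1 /\
   forall w, w \in iter i (word_step (pad x)) [:: [::]] -> size w <= i.
  elim: i {Hi} => [|i [IH1 IH2]]; first by split; [rewrite addn1|move=> w; rewrite inE => /eqP ->].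
  rewrite iterS; move: (iter i _ _) IH1 IH2 => l IH1 IH2.
  rewrite /word_step; case: ifP => // Hl; split; first by rewrite size_cat !size_map addnn -mul2n (leq_trans Hl) // leq_addr.
  by move=> w; rewrite mem_cat => /orP[] /mapP[u /IH2 Hu ->].
apply: leq_trans (@esz_leq _ _ _ (3 * i) _) _.
  move=> j Hj d; have := S2 _ (mem_nth d Hj); move: (nth _ _ _) => w Hw.
  apply: leq_trans (@esz_leq _ _ _ 1 _) _ => //.
  by rewrite mulnC leq_mul2l /=; exact: Hw.
by apply: leq_mul; [apply: leq_trans S1 _; rewrite leq_add2r|lia].
Qed.

Definition atom f (t p : bitstring) : bitstring :=
  pair_code (nseq f true) (pair_code t p).

Lemma fp_pair_code X {eX : encT X} (f g : X -> seq bool) :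
  fp f -> fp g -> fp (fun x => pair_code (f x) (g x) : seq bool).
Proof.
move=> Hf Hg; apply: (@fp_ext _ _ _ _ (fun x => flatten [seq [:: true; b] | b <- f x] ++ [:: false] ++ g x)).
  by fpa.
by move=> x; rewrite /pair_code /self_delim catA.
Qed.

Lemma fp_atom X {eX : encT X} (f : X -> nat) (t p : X -> seq bool) :
  fp f -> fp t -> fp p -> fp (fun x => atom (f x) (t x) (p x) : seq bool).
Proof.
by move=> Hf Ht Hp; apply: fp_pair_code; [fpa|apply: fp_pair_code].
Qed.

Lemma dnext1 d a b : (dnext d a b).1 =
  d.1 || (if d.2 then ~~ (a && ~~ b) else a && ~~ b).
Proof. by case: d => [[] []]; case: a; case: b. Qed.
Lemma dnext2 d a b : (dnext d a b).2 =
  d.2 || (if d.1 then ~~ (~~ a && b) else ~~ a && b).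
Proof. by case: d => [[] []]; case: a; case: b. Qed.

Lemma fp_pst X {eX : encT X} (t p : X -> seq bool) :
  fp t -> fp p -> fp (fun x => pst (t x) (p x) : seq bool).
Proof.
move=> Ht Hp.
pose st (q : seq bool * seq bool) a := if nilp q.2 then q else (pstep q.1 a (head false q.2), behead q.2).
have E s u w : (foldl st (s, w) u).1 = foldl (fun s ab => pstep s ab.1 ab.2) s (zip u w).
  elim: u w s => [|a u IH] [|b w] s //=; last by rewrite {2}/st /= IH.
  by rewrite /st /= -/st; elim: u {IH} => //= c u; rewrite /st.
apply: (@fp_ext _ _ _ _ (fun x => (foldl st (pstart, p x) (t x)).1)); last by move=> x; rewrite E.
have [g [Pg _ Lg]] := fp_size Hp.
apply: fp_fst; apply: (@fp_foldl _ _ _ _ _ _ (fun=> st) _ _ (fun n => 2 * 12 + 1 + g n)).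
- rewrite /st /pstep.
  have Hd : fp (fun q : bool * bool * (bool * bool) => dnext q.1 q.2.1 q.2.2).
    apply: (@fp_ext _ _ _ _ (fun q : bool * bool * (bool * bool) =>
      (q.1.1 || (if q.1.2 then ~~ (q.2.1 && ~~ q.2.2) else q.2.1 && ~~ q.2.2),
       q.1.2 || (if q.1.1 then ~~ (~~ q.2.1 && q.2.2) else ~~ q.2.1 && q.2.2)))).
      by fpa.
    by move=> q; rewrite -dnext1 -dnext2 -surjective_pairing.
  by fpa.
- by fpa.
- by [].
- by polyb.
move=> x i _.
have K u q : size q.1 = 4 -> size (foldl st q u).1 = 4 /\ esz (foldl st q u).2 <= esz q.2.
  elim: u q => //= a u IH q Hq; have [|A B] := IH (st q a).
    by rewrite /st; case: ifP.
  split=> //; apply: leq_trans B _; rewrite /st; case: ifP => //= _.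
  by rewrite -drop1; exact: esz_drop.
have [K1 K2] := K (take i (t x)) (pstart, p x) erefl.
rewrite esz_pair; apply: leq_add; last exact: leq_trans K2 (Lg x).
rewrite leq_add2r leq_mul2l /=; apply: leq_trans (@esz_leq _ _ _ 1 _) _ => //.
by rewrite K1.
Qed.

Ltac fp_user ::= lazymatch goal with
  | |- fp (fun x => Str (pfst (@?f x))) => apply: fp_pfst
  | |- fp (fun x => Str (psnd (@?f x))) => apply: fp_psnd
  | |- fp (fun x => expn (@?f x) ?c) => apply: fp_pow
  | |- fp (fun x => dec (unstr (@?f x))) => apply: fp_dec
  | |- fp (fun x => pair_code (@?f x) (@?g x)) => apply: fp_pair_code
  | |- fp (fun x => atom (@?f x) (@?g x) (@?h x)) => apply: fp_atom
  | |- fp (fun x => pst (@?f x) (@?g x)) => apply: fp_pst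
  end.

Lemma fp_half X {eX : encT X} (n : X -> nat) : fp n -> fp (fun x => (n x)./2).
Proof.
move=> Hn; apply: (@fp_ext _ _ _ _ (fun x => size [seq i <- iota 0 (n x) | i %% 2 == 1])).
  by fpa.
move=> x; elim: (n x) => // k IH.
by rewrite -[k.+1]addn1 iotaD filter_cat size_cat IH /= add0n modn2; case E: (odd k) => /=; lia.
Qed.

Lemma fp_odd X {eX : encT X} (n : X -> nat) : fp n -> fp (fun x => odd (n x)).
Proof.
move=> Hn; apply: (@fp_ext _ _ _ _ (fun x => n x %% 2 == 1)); first by fpa.
by move=> x; rewrite modn2; case: (odd _).
Qed.

Lemma fp_bits X {eX : encT X} (l p : X -> nat) :
  fp l -> fp p -> fp (fun x => bits (l x) (p x) : seq bool).
Proof.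
move=> Hl Hp; have [g [Pg _ Lg]] := fp_size Hl; have [h [Ph _ Lh]] := fp_size Hp.
apply: fp_snd; apply: (@fp_iter _ _ _ _ _ (fun=> bits_step) _ (fun n => 2 * h n + 1 + 3 * g n)).
- by [].
- rewrite /bits_step; apply: fp_pair; first by apply: fp_half; fpa.
  by apply: fp_cons; [apply: fp_odd|]; fpa.
- by fpa.
- by polyb.
move=> x i Hi; have := Lg x; have := Lh x; rewrite !esz_nat => L1 L2.
have [A B] : (iter i bits_step (p x, [::])).1 <= p x /\
    size (iter i bits_step (p x, [::])).2 = i.
  elim: i {Hi} => //= i [A B]; rewrite B; split=> //.
  by apply: leq_trans A; move: (iter _ _ _).1 => m; lia.
rewrite esz_pair esz_nat; apply: leq_add; first by lia.
apply: leq_trans (@esz_leq _ _ _ 1 _) _ => //; rewrite B.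
by rewrite mulnC leq_mul2l (leq_trans Hi).
Qed.

Definition lit (q : bool * bitstring) := if q.1 then FAtom q.2 else FNot (FAtom q.2).
Definition dnf (T : seq (seq (bool * bitstring))) : formula :=
  foldr FOr (FConst false) [seq foldr FAnd (FConst true) [seq lit q | q <- tm] | tm <- T].

Lemma dnf_eval V T :
  formula_eval V (dnf T) = has (fun tm => all (fun q => V q.2 == q.1) tm) T.
Proof.
elim: T => //= tm T ->; congr (_ || _).
by elim: tm => //= q tm ->; rewrite /lit; case: q => [[] a] /=; case: (V a).
Qed.

(** Formulas never are encoded data; their codes are written directly as flat words, built by list
    operations. *)
Definition dnf_code (T : seq (seq (bool * bitstring))) : bitstring :=
  flatten [seq [:: true; false; false] ++ flatten [seq [:: false; true; true] ++
     (if q.1 then [::] else [:: false; true; false]) ++ [:: true; false; true] ++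
     pair_code q.2 [::] | q <- tm] ++ [:: false; false; true] | tm <- T] ++
  [:: false; false; false].

Lemma dnf_codeE T : formula_code (dnf T) = dnf_code T.
Proof.
have E q : formula_code (lit q) = (if q.1 then [::] else [:: false; true; false]) ++
    [:: true; false; true] ++ pair_code q.2 [::].
  by rewrite /lit /pair_code cats0; case: q.1.
rewrite /dnf_code /dnf; elim: T => //= tm T ->; rewrite -catA; congr [:: _, _, _ & _ ++ _].
by elim: tm => //= q tm ->; rewrite E; case: q.1; rewrite /= -?catA.
Qed.

Lemma fp_dnf_code X {eX : encT X} (T : X -> seq (seq (bool * seq bool))) :
  fp T -> fp (fun x => dnf_code (T x) : seq bool).
Proof. by move=> HT; rewrite /dnf_code; fpa. Qed.

Definition pair_term B (w t p t' p' : bitstring) : seq (bool * bitstring) :=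
  [seq (nth false w (8 + f), atom f t p) | f <- iota 0 B] ++
  [seq (nth false w (8 + B + f), atom f t' p') | f <- iota 0 B].

(** One term per possible violation: four grid words and a forbidden word with the right automaton
    states, or a wrong bit of the prefix. Hence falsifying valuations are the assignments that obey
    the system. *)
Definition sys_terms (s : sysT) l (xs : bitstring) (W : seq bitstring) :=
  flatten [seq flatten [seq flatten [seq flatten [seq
    [seq pair_term s.1 w t p t' p' | w <- s.2 &
       (take 8 w == pst t t' ++ pst p p') && (size w == 8 + s.1 + s.1)]
    | p' <- W] | t' <- W] | p <- W] | t <- W] ++
  [seq [:: (~~ nth false xs i, atom 0 (bits l 0) (bits l i))] | i <- iota 0 (size xs)] ++
  [seq [:: (nth false xs i, atom 1 (bits l 0) (bits l i))] | i <- iota 0 (size xs)].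

Definition sys_formula s l xs := dnf (sys_terms s l xs (words l)).

Definition assignment_of (V : bitstring -> bool) : assignment := fun f t p => V (atom f t p).
Definition valuation_of (v : assignment) : bitstring -> bool :=
  fun s => v (size (pfst s)) (pfst (psnd s)) (psnd (psnd s)).

Lemma valuation_ofK v : assignment_of (valuation_of v) = v.
Proof.
apply: funext => f; apply: funext => t; apply: funext => p.
by rewrite /assignment_of /valuation_of /atom !(pfst_pair, psnd_pair) size_nseq.
Qed.

Lemma pair_term_all V B (w t p t' p' : bitstring) :
  size w = 8 + B + B -> take 8 w = pst t t' ++ pst p p' ->
  all (fun q => V q.2 == q.1) (pair_term B w t p t' p') =
  (pair_word B (assignment_of V) t p t' p' == w).
Proof.
move=> Sw Tw; rewrite -{2}(cat_take_drop 8 w) Tw /pair_word.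
rewrite [in RHS]catA eqseq_cat // eqxx /=.
rewrite -(cat_take_drop B (drop 8 w)) eqseq_cat; last first.
  by rewrite size_letter_bits size_takel // size_drop Sw; lia.
have K g u : size u = B -> (forall f, f < B -> nth false u f = g f) -> forall t p,
    (letter_bits B (assignment_of V) t p == u) =
    all (fun f => V (atom f t p) == g f) (iota 0 B).
  move=> Su H t0 p0; apply/eqP/allP => [E f|H2].
    rewrite mem_iota add0n => Hf; rewrite -H // -E (nth_map 0) ?size_iota // nth_iota //.
  apply: (@eq_from_nth _ false); first by rewrite size_letter_bits.
  rewrite size_letter_bits => f Hf; rewrite (nth_map 0) ?size_iota // nth_iota //= H //.
  by apply/eqP/H2; rewrite mem_iota.
rewrite (K (fun f => nth false w (8 + f))); [|by rewrite size_takel // size_drop Sw; lia|].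
  rewrite (K (fun f => nth false w (8 + B + f))); [|by rewrite !size_drop Sw; lia|].
    by rewrite /pair_term all_cat !all_map.
  by move=> f Hf; rewrite !nth_drop addnA.
by move=> f Hf; rewrite nth_take // nth_drop.
Qed.

Lemma sys_formula_eval V s l xs :
  formula_eval V (sys_formula s l xs) = false <->
  holds s l (assignment_of V) /\ starts_with xs l (assignment_of V).
Proof.
rewrite dnf_eval; split=> [H|[H1 H2]].
  have {}H tm : tm \in sys_terms s l xs (words l) -> all (fun q => V q.2 == q.1) tm = false.
    by move=> Htm; apply/negbTE/negP => A; move/negbT/hasPn/(_ tm Htm): H; rewrite A.
  split=> [t p t' p' Et Ep Et' Ep'|i Hi].
    apply/negP => Hw; have Sw : size (pair_word s.1 (assignment_of V) t p t' p') = 8 + s.1 + s.1.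
      by rewrite !size_cat !size_pst !size_letter_bits.
    have Tw : take 8 (pair_word s.1 (assignment_of V) t p t' p') = pst t t' ++ pst p p'.
      by rewrite /pair_word catA take_size_cat // size_cat !size_pst.
    have := H (pair_term s.1 (pair_word s.1 (assignment_of V) t p t' p') t p t' p').
    rewrite pair_term_all // eqxx; set tm := pair_term _ _ _ _ _ _.
    move=> X; suff /X : tm \in sys_terms s l xs (words l) by [].
    rewrite mem_cat; apply/orP; left.
    apply/flatten_mapP; exists t; first by rewrite mem_words Et.
    apply/flatten_mapP; exists p; first by rewrite mem_words Ep.
    apply/flatten_mapP; exists t'; first by rewrite mem_words Et'.
    apply/flatten_mapP; exists p'; first by rewrite mem_words Ep'.
    by apply/mapP; eexists; last by []; rewrite mem_filter Tw Sw !eqxx.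
  split.
    have := H [:: (~~ nth false xs i, atom 0 (bits l 0) (bits l i))].
    rewrite /= andbT /assignment_of => X; suff /X : [:: (~~ nth false xs i, atom 0 (bits l 0) (bits l i))] \in sys_terms s l xs (words l).
      by case: (V _); case: (nth _ _ _).
    by rewrite !mem_cat; apply/or3P; apply: Or32; apply/mapP; exists i; rewrite ?mem_iota.
  have := H [:: (nth false xs i, atom 1 (bits l 0) (bits l i))].
  rewrite /= andbT /assignment_of => X; suff /X : [:: (nth false xs i, atom 1 (bits l 0) (bits l i))] \in sys_terms s l xs (words l).
    by case: (V _); case: (nth _ _ _).
  by rewrite !mem_cat; apply/or3P; apply: Or33; apply/mapP; exists i; rewrite ?mem_iota.
apply/negbTE/hasPn => tm; rewrite !mem_cat => /or3P[].
- move=> /flatten_mapP[t]; rewrite mem_words => /eqP Et /flatten_mapP[p]; rewrite mem_words => /eqP Ep.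
  move=> /flatten_mapP[t']; rewrite mem_words => /eqP Et' /flatten_mapP[p']; rewrite mem_words => /eqP Ep'.
  move=> /mapP[w]; rewrite mem_filter => /andP[/andP[/eqP Tw /eqP Sw] Hw] ->.
  rewrite pair_term_all //; apply/negP => /eqP E.
  by have := H1 t p t' p' Et Ep Et' Ep'; rewrite E Hw.
- move=> /mapP[i]; rewrite mem_iota add0n => /H2[E _] ->.
  by move: E; rewrite /= /assignment_of => ->; case: (nth _ _ _).
- move=> /mapP[i]; rewrite mem_iota add0n => /H2[_ E] ->.
  by move: E; rewrite /= /assignment_of => ->; case: (nth _ _ _).
Qed.

Lemma fp_sys_code X {eX : encT X} (s : X -> sysT) (l pad : X -> nat) (xs : X -> seq bool) :
  fp s -> fp l -> fp xs -> fp pad -> (forall x, 2 ^ l x <= pad x) ->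
  fp (fun x => formula_code (sys_formula (s x) (l x) (xs x)) : seq bool).
Proof.
move=> Hs Hl Hx Hp L.
apply: (@fp_ext _ _ _ _ (fun x => dnf_code (sys_terms (s x) (l x) (xs x) (words (l x))))); last first.
  by move=> x; rewrite dnf_codeE.
apply: fp_dnf_code; have HW := fp_words Hl Hp L.
apply: (@fp_comp _ _ _ _ _ _ (fun y : sysT * (nat * (seq bool * seq (seq bool))) =>
   sys_terms y.1 y.2.1 y.2.2.1 y.2.2.2) (fun x => (s x, (l x, (xs x, words (l x)))))); last by fpa.
rewrite /sys_terms /pair_term.
by fpa; apply: fp_bits; fpa.
Qed.

Lemma self_delim_inj x y u w : self_delim x ++ u = self_delim y ++ w -> x = y /\ u = w.
Proof.
rewrite -!/(pair_code _ _) => E; split.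
  by rewrite -(pfst_pair x u) E pfst_pair.
by rewrite -(psnd_pair x u) E psnd_pair.
Qed.

Lemma formula_code_inj F G u w : formula_code F ++ u = formula_code G ++ w -> F = G /\ u = w.
Proof.
elim: F G u w => [a|b|F IH|F1 IH1 F2 IH2|F1 IH1 F2 IH2] [a'|b'|G|G1 G2|G1 G2] u w //=;
  try by case: b; try case: b'.
- by case=> /self_delim_inj[-> ->].
- by case=> -> ->.
- by case=> /IH[-> ->].
- by rewrite -!catA => -[] /IH1[-> /IH2[-> ->]].
- by rewrite -!catA => -[] /IH1[-> /IH2[-> ->]].
Qed.

(** * Circuits detecting a violation *)

(* A generalised gate (refs, table): its value is true when the values of the
   earlier wires refs form a word of table. *)
Definition gateT := (seq nat * seq bitstring)%type.

Definition gate_value (vals : bitstring) (g : gateT) : bool :=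
  [seq nth false vals i | i <- g.1] \in g.2.

Definition wires (vals : bitstring) (C : seq gateT) : bitstring :=
  foldl (fun vals g => rcons vals (gate_value vals g)) vals C.

Lemma wires_cat vals C1 C2 : wires vals (C1 ++ C2) = wires (wires vals C1) C2.
Proof. exact: foldl_cat. Qed.

Lemma wires_rcons vals C g :
  wires vals (rcons C g) = rcons (wires vals C) (gate_value (wires vals C) g).
Proof. by rewrite /wires foldl_rcons. Qed.

Lemma size_wires vals C : size (wires vals C) = size vals + size C.
Proof.
elim/last_ind: C => [|C g IH]; first by rewrite addn0.
by rewrite wires_rcons !size_rcons IH addnS.
Qed.

Lemma prefix_wires vals C : exists h, wires vals C = vals ++ h /\ size h = size C.
Proof.
exists (drop (size vals) (wires vals C)).
have E : take (size vals) (wires vals C) = vals.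
  elim/last_ind: C => [|C g IH]; first by rewrite take_size.
  rewrite wires_rcons -{3}IH -cats1 takel_cat // size_wires leq_addr.
  by [].
by rewrite -{2}E cat_take_drop size_drop size_wires addKn.
Qed.

Definition gwf (g : gateT) : bool := uniq g.2 && all (fun w => size w == size g.1) g.2.

Definition const_gate (b : bool) : gateT := ([::], if b then [:: [::]] else [::]).
Definition copy_gate i : gateT := ([:: i], [:: [:: true]]).

Lemma const_gateE vals b : gate_value vals (const_gate b) = b.
Proof. by case: b. Qed.
Lemma copy_gateE vals i : gate_value vals (copy_gate i) = nth false vals i.
Proof. by rewrite /gate_value /= inE; case: (nth _ _ _). Qed.

Lemma wires_const vals w : wires vals [seq const_gate c | c <- w] = vals ++ w.
Proof.
elim/last_ind: w => [|w c IH]; first by rewrite cats0.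
by rewrite map_rcons wires_rcons IH const_gateE rcons_cat.
Qed.

Lemma nth_cat_r T (d : T) s1 s2 i : nth d (s1 ++ s2) (size s1 + i) = nth d s2 i.
Proof. by rewrite nth_cat ltnNge leq_addr addKn. Qed.

(* [pst] as a circuit: four wires per column, after the four wires of the
   initial state; base is the index of the first of them. *)
Definition auto_table j : seq bitstring :=
  [seq w <- words 6 | nth false (pstep (take 4 w) (nth false w 4) (nth false w 5)) j].
Definition auto_gate base a b i j : gateT :=
  ([:: base + 4 * i; base + 4 * i + 1; base + 4 * i + 2; base + 4 * i + 3; a + i; b + i],
   auto_table j).
Definition auto_col base a b i : seq gateT := [seq auto_gate base a b i j | j <- iota 0 4].
Definition auto_circ l base a b : seq gateT :=
  [seq const_gate c | c <- pstart] ++ flatten [seq auto_col base a b i | i <- iota 0 l].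

Lemma auto_colE vals pre s a b i x y :
  vals = pre ++ s -> size s = 4 -> nth false vals (a + i) = x -> nth false vals (b + i) = y ->
  a + i < size vals -> b + i < size vals ->
  forall base, base + 4 * i = size pre ->
  wires vals (auto_col base a b i) = vals ++ pstep s x y.
Proof.
move=> Ev Ss Hx Hy La Lb base Hb.
have G w j : gate_value (vals ++ w) (auto_gate base a b i j) = nth false (pstep s x y) j.
  have P k : k < 4 -> nth false (vals ++ w) (size pre + k) = nth false s k.
    by rewrite Ev -catA nth_cat_r nth_cat Ss => ->.
  have P0 := P 0 isT; rewrite addn0 in P0.
  have A : nth false (vals ++ w) (a + i) = x by rewrite nth_cat La.
  have B : nth false (vals ++ w) (b + i) = y by rewrite nth_cat Lb.
  rewrite /gate_value /= Hb P0 !P // A B.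
  rewrite mem_filter mem_words /=.
  by case: s Ss {Ev P P0} => [|s0 [|s1 [|s2 [|s3 []]]]] //= _; rewrite andbT.
have R m : wires vals [seq auto_gate base a b i j | j <- iota 0 m] =
    vals ++ [seq nth false (pstep s x y) j | j <- iota 0 m].
  elim: m => [|m IH]; first by rewrite cats0.
  by rewrite -[m.+1]addn1 iotaD !map_cat !cats1 wires_rcons IH G rcons_cat.
by rewrite /auto_col R.
Qed.


Lemma auto_circE l a b vals t t' :
  size t = l -> size t' = l ->
  (forall i, i < l -> nth false vals (a + i) = nth false t i) ->
  (forall i, i < l -> nth false vals (b + i) = nth false t' i) ->
  a + l <= size vals -> b + l <= size vals ->
  exists h, wires vals (auto_circ l (size vals) a b) = vals ++ h ++ pst t t' /\ size h = 4 * l.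
Proof.
move=> St St' Ha Hb La Lb.
have K m : m <= l -> exists h, wires vals ([seq const_gate c | c <- pstart] ++
     flatten [seq auto_col (size vals) a b i | i <- iota 0 m]) =
     vals ++ h ++ pst (take m t) (take m t') /\ size h = 4 * m.
  elim: m => [|m IH] Hm.
    exists [::]; split=> //; rewrite !take0 [flatten _]/= cats0.
    exact: (wires_const vals pstart).
  have [h [E Sh]] := IH (ltnW Hm).
  exists (h ++ pst (take m t) (take m t')); rewrite size_cat size_pst Sh; split; last lia.
  rewrite -[m.+1]addn1 iotaD map_cat flatten_cat catA wires_cat E.
  have -> : flatten [seq auto_col (size vals) a b i | i <- iota (0 + m) 1] =
    auto_col (size vals) a b m by exact: cats0.
  rewrite addn1.
  have Hm' : m < size t by rewrite St.
  have Hm'' : m < size t' by rewrite St'.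
  rewrite (@auto_colE _ (vals ++ h) (pst (take m t) (take m t')) _ _ _ (nth false t m) (nth false t' m));
    rewrite ?size_pst ?size_cat ?size_pst ?Sh //.
  - rewrite (take_nth false Hm') (take_nth false Hm'') -!catA; congr (_ ++ (_ ++ (_ ++ _))).
    by rewrite /pst zip_rcons ?foldl_rcons // !size_takel // ltnW.
  - by rewrite catA.
  - by rewrite nth_cat ifT ?Ha //; lia.
  - by rewrite nth_cat ifT ?Hb //; lia.
  - by lia.
  - by lia.
have [h] := K l (leqnn l); rewrite !take_oversize ?St ?St' // => H.
by exists h.
Qed.

(* The copy of a circuit whose wires start at off and whose inputs are the
   constants pre followed by the n wires from adr onwards. *)
Definition copy_of pre off adr n (g : gate) : gateT :=
  match g with
  | GInput i => if i < size pre then const_gate (nth false pre i)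
                else if i - size pre < n then copy_gate (adr + (i - size pre))
                else const_gate false
  | GConst b => const_gate b
  | GNot i => ([:: off + i], [:: [:: false]])
  | GAnd i j => ([:: off + i; off + j], [:: [:: true; true]])
  | GOr i j => ([:: off + i; off + j], [:: [:: true; true]; [:: true; false]; [:: false; true]])
  end.
Definition circ_copy (q : bitstring * circuit) off adr n : seq gateT :=
  rcons [seq copy_of q.1 off adr n g | g <- q.2]
    (if nilp q.2 then const_gate false else copy_gate (off + (size q.2).-1)).

Lemma circ_copyE q vals adr x :
  adr + size x <= size vals -> (forall i, i < size x -> nth false vals (adr + i) = nth false x i) ->
  exists h, wires vals (circ_copy q (size vals) adr (size x)) =
    rcons (vals ++ h) (circuit_eval q.2 (q.1 ++ x)) /\ size h = size q.2.
Proof.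
move=> La Hx; pose w C := foldl (fun vs g => rcons vs (gate_val (q.1 ++ x) vs g)) [::] C.
have Sw C : size (w C) = size C.
  by elim/last_ind: C => // C g IH; rewrite /w foldl_rcons !size_rcons -/(w C) IH.
have E C : wires vals [seq copy_of q.1 (size vals) adr (size x) g | g <- C] = vals ++ w C.
  elim/last_ind: C => [|C g IH]; first by rewrite cats0.
  rewrite map_rcons wires_rcons IH /w foldl_rcons -/(w C) -rcons_cat; congr rcons.
  case: g => [i|b|i|i j|i j] /=.
  - case: ltnP => Hi; first by rewrite const_gateE nth_cat Hi.
    case: ltnP => Hi2; last by rewrite const_gateE nth_default // size_cat; lia.
    rewrite copy_gateE nth_cat ifT; last by lia.
    by rewrite Hx // nth_cat ltnNge Hi.
  - by rewrite const_gateE.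
  - by rewrite /gate_value /= nth_cat_r inE; case: (nth _ _ _).
  - by rewrite /gate_value /= !nth_cat_r inE; case: (nth _ _ i); case: (nth _ _ j).
  - by rewrite /gate_value /= !nth_cat_r !inE; case: (nth _ _ i); case: (nth _ _ j).
exists (w q.2); rewrite Sw /circ_copy wires_rcons E; split=> //; congr rcons.
rewrite /circuit_eval -/(w q.2); case: q.2 (Sw q.2) => [|g C] S /=; first by rewrite const_gateE.
rewrite copy_gateE nth_cat_r; case: (w _) S => //= b s [<-].
exact: (nth_last false (b :: s)).
Qed.

(** The gates so far, the wires carrying the outputs of the copies made so far, and the index of the
    next wire. *)
Definition list_state := (seq gateT * (seq nat * nat))%type.
Definition list_step adr n (st : list_state) (q : bitstring * circuit) : list_state :=
  (st.1 ++ circ_copy q st.2.2 adr n,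
   (rcons st.2.1 (st.2.2 + size q.2), st.2.2 + size q.2 + 1)).
Definition list_circ (L : seq (bitstring * circuit)) off adr n : list_state :=
  foldl (list_step adr n) ([::], ([::], off)) L.

Lemma list_circE L vals adr x :
  adr + size x <= size vals -> (forall i, i < size x -> nth false vals (adr + i) = nth false x i) ->
  let R := list_circ L (size vals) adr (size x) in
  exists h, [/\ wires vals R.1 = vals ++ h, R.2.2 = size vals + size h, size R.1 = size h,
   [seq nth false (vals ++ h) r | r <- R.2.1] = [seq circuit_eval q.2 (q.1 ++ x) | q <- L] &
   all (fun r => r < size vals + size h) R.2.1].
Proof.
move=> La Hx; elim/last_ind: L => [|L q IH] /=.
  by exists [::]; rewrite cats0 addn0.
move: IH; rewrite /list_circ foldl_rcons -/(list_circ L _ _ _).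
case: (list_circ L _ _ _) => [C [rs off]] /= [h [E Eo Sh Er Ea]].
have [||h' [E' Sh']] := @circ_copyE q (vals ++ h) adr x.
- by rewrite size_cat; lia.
- by move=> i Hi; rewrite nth_cat ifT ?Hx //; lia.
exists (h ++ rcons h' (circuit_eval q.2 (q.1 ++ x))).
rewrite wires_cat E Eo -size_cat E' !size_cat size_rcons Sh' /circ_copy size_rcons size_map Sh; split=> //.
- by rewrite !rcons_cat !catA.
- lia.
- rewrite !map_rcons; congr rcons.
    rewrite -Er; apply/eq_in_map => r /(allP Ea) Hr.
    by rewrite catA [in LHS]nth_cat size_cat Hr.
  by rewrite catA -addnA addnA -size_cat -Sh' nth_cat_r nth_rcons ltnn eqxx.
rewrite all_rcons; apply/andP; split; first lia.
by apply: sub_all Ea => r; lia.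
Qed.

(** Every circuit comes with constant leading inputs, because all the bits f will be answered by
    circuits for one language, whose inputs start with a code of f and n. *)
Definition dl_assignment (D : seq (bitstring * circuit)) : assignment := fun f t p =>
  circuit_eval (nth ([::], [::]) D f).2 ((nth ([::], [::]) D f).1 ++ t ++ p).

(** After the 4l input wires t, p, t', p' come the automata for the times and for the positions,
    with 4l + 4 wires each, the last four being the final state; then the copies of D on the two
    cells. The last gate looks the resulting word up among the forbidden ones. *)
Definition viol_circ (s : sysT) l (D : seq (bitstring * circuit)) : seq gateT :=
  let L := [seq nth ([::], [::]) D f | f <- iota 0 s.1] in
  let b1 := 4 * l in
  let b2 := b1 + 4 * l + 4 in
  let b3 := b2 + 4 * l + 4 in
  let R1 := list_circ L b3 0 (l + l) in
  let R2 := list_circ L R1.2.2 (l + l) (l + l) in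
  rcons (auto_circ l b1 0 (l + l) ++ auto_circ l b2 l (l + l + l) ++ R1.1 ++ R2.1)
   (iota (b1 + 4 * l) 4 ++ iota (b2 + 4 * l) 4 ++ R1.2.1 ++ R2.2.1, s.2).

Lemma map_nth_iota' T (d : T) s1 s2 s3 n : n = size s2 ->
  [seq nth d (s1 ++ s2 ++ s3) i | i <- iota (size s1) n] = s2.
Proof.
move=> ->; apply: (@eq_from_nth _ d); rewrite size_map size_iota // => i Hi.
by rewrite (nth_map 0) ?size_iota // nth_iota // nth_cat_r nth_cat Hi.
Qed.

Lemma viol_circE s l D t p t' p' :
  size t = l -> size p = l -> size t' = l -> size p' = l ->
  last false (wires (t ++ p ++ t' ++ p') (viol_circ s l D)) =
  (pair_word s.1 (dl_assignment D) t p t' p' \in s.2).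
Proof.
move=> St Sp St' Sp'; rewrite /viol_circ.
set L := [seq _ | f <- iota 0 s.1].
set z := t ++ p ++ t' ++ p'.
have Sz : size z = 4 * l by rewrite /z !size_cat St Sp St' Sp'; lia.
have zt i : i < l -> nth false z (0 + i) = nth false t i.
  by move=> Hi; rewrite /z nth_cat St Hi.
have zp i : i < l -> nth false z (l + i) = nth false p i.
  by move=> Hi; rewrite /z -St nth_cat_r nth_cat Sp Hi.
have zt' i : i < l -> nth false z (l + l + i) = nth false t' i.
  by move=> Hi; rewrite /z -{1}St -{1}Sp -addnA nth_cat_r nth_cat_r nth_cat St' Hi.
have zp' i : i < l -> nth false z (l + l + l + i) = nth false p' i.
  by move=> Hi; rewrite /z -{1}St -{1}Sp -{1}St' -!addnA !nth_cat_r.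
have [||||||h1 [E1 S1]] := @auto_circE l 0 (l + l) z t t'; rewrite ?Sz //; try lia.
rewrite Sz in E1; set v1 := z ++ h1 ++ pst t t'.
have Sv1 : size v1 = 4 * l + 4 * l + 4 by rewrite size_cat Sz size_cat size_pst S1; lia.
have v1z i : i < 4 * l -> nth false v1 i = nth false z i.
  by move=> Hi; rewrite /v1 nth_cat Sz Hi.
have [||||||h2 [E2 S2]] := @auto_circE l l (l + l + l) v1 p p'; rewrite ?Sv1 //; try lia.
- by move=> i Hi; rewrite v1z ?zp //; lia.
- by move=> i Hi; rewrite v1z ?zp' //; lia.
rewrite Sv1 in E2; set v2 := v1 ++ h2 ++ pst p p'.
have Sv2 : size v2 = 4 * l + 4 * l + 4 + 4 * l + 4 by rewrite size_cat Sv1 size_cat size_pst S2; lia.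
have v2z i : i < 4 * l -> nth false v2 i = nth false z i.
  by move=> Hi; rewrite /v2 nth_cat Sv1 ifT ?v1z //; lia.
have Stp : size (t ++ p) = l + l by rewrite size_cat St Sp.
have Stp' : size (t' ++ p') = l + l by rewrite size_cat St' Sp'.
have [||h3 [E3 O3 S3 F3 A3]] := @list_circE L v2 0 (t ++ p).
- by rewrite Stp Sv2; lia.
- move=> i; rewrite Stp => Hi; rewrite v2z; last lia.
  by rewrite /z catA nth_cat Stp Hi.
rewrite Stp Sv2 in E3 O3 S3 F3 A3.
have [||h4 [E4 O4 S4 F4 A4]] := @list_circE L (v2 ++ h3) (l + l) (t' ++ p').
- by rewrite Stp' size_cat Sv2; lia.
- move=> i; rewrite Stp' => Hi; rewrite nth_cat Sv2 ifT; last lia.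
  by rewrite v2z ?/z ?catA; [rewrite -catA -Stp nth_cat_r|lia].
rewrite Stp' size_cat Sv2 -O3 in E4 O4 S4 F4 A4.
rewrite wires_rcons last_rcons 3!wires_cat E1 -/v1 E2 -/v2 E3 E4 /gate_value.
apply: (congr1 (fun w => w \in s.2)); cbn [fst].
rewrite !map_cat /pair_word.
have SvT : 4 * l + 4 * l = size (z ++ h1) by rewrite size_cat Sz S1.
have SvP : 4 * l + 4 * l + 4 + 4 * l = size (v1 ++ h2) by rewrite size_cat Sv1 S2.
congr (_ ++ (_ ++ (_ ++ _))).
- have -> : (v2 ++ h3) ++ h4 = (z ++ h1) ++ pst t t' ++ (h2 ++ pst p p' ++ h3 ++ h4).
    by rewrite /v2 /v1 -!catA.
  by rewrite SvT map_nth_iota' ?size_pst.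
- have -> : (v2 ++ h3) ++ h4 = (v1 ++ h2) ++ pst p p' ++ (h3 ++ h4) by rewrite /v2 -!catA.
  by rewrite SvP map_nth_iota' ?size_pst.
- rewrite /letter_bits; transitivity [seq circuit_eval q.2 (q.1 ++ t ++ p) | q <- L].
    rewrite -F3; apply/eq_in_map => r /(allP A3); rewrite -Sv2 -size_cat => Hr.
    by rewrite nth_cat Hr.
  by rewrite /L -map_comp.
- by rewrite F4 /L -map_comp.
Qed.

Lemma viol_circ_wf s l D : uniq s.2 -> all (fun w => size w == 8 + s.1 + s.1) s.2 ->
  all gwf (viol_circ s l D).
Proof.
move=> U W; rewrite /viol_circ; set L := [seq _ | f <- iota 0 s.1].
have C b : gwf (const_gate b) by case: b.
have A base a b : all gwf (auto_circ l base a b).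
  rewrite /auto_circ all_cat /=; apply/allP => g /flatten_mapP[i _] /mapP[j _ ->].
  rewrite /gwf /= filter_uniq ?uniq_words //=; apply/allP => w.
  by rewrite mem_filter mem_words => /andP[_].
have K off adr : all gwf (list_circ L off adr (l + l)).1 /\
    size (list_circ L off adr (l + l)).2.1 = s.1.
  have SL : size L = s.1 by rewrite size_map size_iota.
  rewrite -SL; elim/last_ind: L {SL} => // L q [IH1 IH2].
  rewrite /list_circ foldl_rcons -/(list_circ L _ _ _) /= !size_rcons IH2; split=> //.
  rewrite all_cat IH1 /circ_copy all_rcons /=; apply/andP; split; first by case: ifP.
  rewrite all_map; elim: q.2 => //= g C' ->; rewrite andbT.
  case: g => [i|b|i|i j|i j] //=; by do 2!case: ifP => _ //; exact: C.
have [K1 K2] := K (4 * l + 4 * l + 4 + 4 * l + 4) 0.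
have [K3 K4] := K (list_circ L (4 * l + 4 * l + 4 + 4 * l + 4) 0 (l + l)).2.2 (l + l).
rewrite all_rcons 3!all_cat !A K1 K3 !andbT /gwf; cbn [fst snd]; rewrite U.
by apply: sub_all W => w /eqP ->; rewrite !size_cat K2 K4 !size_iota !addnA.
Qed.

Module SumCheck.
(** * The sum-check protocol *)

Import GRing.Theory.

(* The arithmetisation is evaluated in fields, in polynomial rings, and on lists
   of integers representing polynomials; neg is x |-> 1 - x. *)
Record ops T := Ops { zero : T; one : T; add : T -> T -> T; mul : T -> T -> T; neg : T -> T }.

Section Arithmetisation.
Variables (T : Type) (o : ops T).

Definition prodo (l : seq T) := foldl (mul o) (one o) l.
Definition sumo (l : seq T) := foldl (add o) (zero o) l.

Definition minterm (ys : seq T) (w : bitstring) :=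
  prodo [seq (if nth false w i then nth (zero o) ys i else neg o (nth (zero o) ys i))
        | i <- iota 0 (size w)].
(** The multilinear extension of the indicator function of the table. *)
Definition table_value (ys : seq T) (tb : seq bitstring) := sumo [seq minterm ys w | w <- tb].
(** [take i y] hides the wires from i on, as a gate sees earlier wires only; references beyond them
    read 0, in accordance with [wires]. *)
Definition refs_value (y : seq T) (g : gateT) i :=
  table_value [seq nth (zero o) (take i y) r | r <- g.1] g.2.
Definition gate_check (y : seq T) (g : gateT) i :=
  add o (mul o (nth (zero o) y i) (refs_value y g i))
        (mul o (neg o (nth (zero o) y i)) (neg o (refs_value y g i))).
(** On bits, the indicator of the runs of the circuit whose last wire is true. *)
Definition consistent n0 (C : seq gateT) (y : seq T) :=
  mul o (prodo [seq gate_check y (nth ([::], [::]) C j) (n0 + j) | j <- iota 0 (size C)])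
        (last (zero o) y).
(** On a 0-1 vector y this is the product of the w_i with y_i = 1. The weighted sum is thus a
    multilinear polynomial in w, with the values of [consistent] as coefficients. *)
Definition weight n (w y : seq T) :=
  prodo [seq add o (neg o (nth (zero o) y i)) (mul o (nth (zero o) y i) (nth (zero o) w i))
        | i <- iota 0 n].
Definition summand n0 C (w y : seq T) :=
  mul o (consistent n0 C y) (weight (n0 + size C) w y).
End Arithmetisation.

Section Morphism.
Variables (T U : Type) (o : ops T) (q : ops U) (h : T -> U).
Hypothesis h0 : h (zero o) = zero q.
Hypothesis h1 : h (one o) = one q.
Hypothesis hA : forall a b, h (add o a b) = add q (h a) (h b).
Hypothesis hM : forall a b, h (mul o a b) = mul q (h a) (h b).
Hypothesis hN : forall a, h (neg o a) = neg q (h a).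

Lemma prodo_morph l : h (prodo o l) = prodo q [seq h x | x <- l].
Proof. by rewrite /prodo -h1; elim: l (one o) => //= x l IH a; rewrite IH hM. Qed.
Lemma sumo_morph l : h (sumo o l) = sumo q [seq h x | x <- l].
Proof. by rewrite /sumo -h0; elim: l (zero o) => //= x l IH a; rewrite IH hA. Qed.

Lemma nth_morph l i : h (nth (zero o) l i) = nth (zero q) [seq h x | x <- l] i.
Proof. by rewrite -h0; case: (ltnP i (size l)) => L; [rewrite (nth_map (zero o))|rewrite !nth_default ?size_map]. Qed.

(** Used for three morphisms: evaluation of polynomials at a point, embedding of constants, and
    reduction modulo X^K. *)
Lemma summand_morph n0 C w y :
  h (summand o n0 C w y) = summand q n0 C [seq h x | x <- w] [seq h x | x <- y].
Proof.
rewrite /summand /consistent /weight !hM !prodo_morph -!map_comp; congr (mul q (mul q (prodo q _) _) (prodo q _)).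
- apply: eq_map => j /=; rewrite /gate_check hA !hM !hN nth_morph.
  suff -> : h (refs_value o y (nth ([::], [::]) C j) (n0 + j)) =
    refs_value q [seq h x | x <- y] (nth ([::], [::]) C j) (n0 + j) by [].
  rewrite /refs_value /table_value sumo_morph -map_comp; congr sumo; apply: eq_map => u /=.
  rewrite /minterm prodo_morph -map_comp; congr prodo; apply: eq_map => i /=.
  have E : h (nth (zero o) [seq nth (zero o) (take (n0 + j) y) r | r <- (nth ([::], [::]) C j).1] i) =
     nth (zero q) [seq nth (zero q) (take (n0 + j) [seq h x | x <- y]) r | r <- (nth ([::], [::]) C j).1] i.
    rewrite nth_morph -map_comp; congr nth; apply: eq_map => r /=.
    by rewrite nth_morph map_take.
  by case: ifP => _; rewrite ?hN E.
- by rewrite -h0 last_map.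
- by apply: eq_map => i /=; rewrite hA hM hN !nth_morph.
Qed.
End Morphism.

Local Open Scope ring_scope.

Definition ring_ops (R : comNzRingType) : ops R :=
  Ops 0 1 +%R *%R (fun x => 1 - x).

Section RingOps.
Variable R : comNzRingType.
Local Notation o := (ring_ops R).

Lemma prodoE l : prodo o l = \prod_(x <- l) x.
Proof.
rewrite /prodo; suff H a : foldl *%R a l = a * \prod_(x <- l) x by rewrite H mul1r.
by elim: l a => [|x l IH] a /=; rewrite ?big_nil ?mulr1 // big_cons IH mulrA.
Qed.
Lemma sumoE l : sumo o l = \sum_(x <- l) x.
Proof.
rewrite /sumo; suff H a : foldl +%R a l = a + \sum_(x <- l) x by rewrite H add0r.
by elim: l a => [|x l IH] a /=; rewrite ?big_nil ?addr0 // big_cons IH addrA.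
Qed.

Lemma wires_check n0 (C : seq gateT) (z : bitstring) : (n0 + size C <= size z)%N ->
  (take (n0 + size C) z == wires (take n0 z) C) =
  all (fun j => nth false z (n0 + j) == gate_value (take (n0 + j) z) (nth ([::], [::]) C j))
      (iota 0 (size C)).
Proof.
elim/last_ind: C => [|C g IH] L; first by rewrite addn0 /= eqxx.
rewrite size_rcons addnS in L *; rewrite (take_nth false) // wires_rcons eqseq_rcons IH ?(ltnW L) //.
rewrite -[(size C).+1]addn1 iotaD all_cat /= andbT add0n nth_rcons ltnn eqxx.
have -> : all (fun j => nth false z (n0 + j) == gate_value (take (n0 + j) z) (nth ([::], [::]) (rcons C g) j))
    (iota 0 (size C)) = all (fun j => nth false z (n0 + j) == gate_value (take (n0 + j) z) (nth ([::], [::]) C j))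
    (iota 0 (size C)).
  by apply: eq_in_all => j; rewrite mem_iota add0n => /= Hj; rewrite nth_rcons Hj.
rewrite -(IH (ltnW L)); case: eqP => [<-|] //=.
Qed.

Definition bit (b : bool) : R := b%:R.

Lemma nth_bit (v : bitstring) i : nth 0 [seq bit b | b <- v] i = bit (nth false v i).
Proof. by case: (ltnP i (size v)) => L; [rewrite (nth_map false)|rewrite !nth_default ?size_map]. Qed.

Lemma minterm_bits (v w : bitstring) : size v = size w ->
  minterm o [seq bit b | b <- v] w = bit (v == w).
Proof.
rewrite /minterm prodoE big_map; elim: v w => [|a v IH] [|b w] //=; first by rewrite big_nil.
move=> [E]; rewrite big_cons /= -[X in iota X _](addn0 1) iotaDl big_map.
under eq_bigr => i _ do rewrite add1n /=.
rewrite IH // eqseq_cons; case: a; case: b; rewrite /bit /= ?subrr ?subr0 ?mul0r ?mul1r //.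
Qed.

Lemma table_bits (v : bitstring) (tb : seq bitstring) : uniq tb -> all (fun w => size w == size v) tb ->
  table_value o [seq bit b | b <- v] tb = bit (v \in tb).
Proof.
rewrite /table_value sumoE big_map; elim: tb => [|w tb IH] /=; first by rewrite big_nil.
move=> /andP[nw U] /andP[/eqP S A]; rewrite big_cons IH // minterm_bits // in_cons.
case: eqP => [->|_]; last by rewrite add0r.
by rewrite (negbTE nw) addr0.
Qed.

Lemma consistent_bits n0 C (z : bitstring) : all gwf C -> size z = (n0 + size C)%N ->
  consistent o n0 C [seq bit b | b <- z] =
  bit ((z == wires (take n0 z) C) && last false z).
Proof.
move=> W S; rewrite /consistent prodoE big_map.
have -> : last (zero o) [seq bit b | b <- z] = bit (last false z).
  by rewrite -(last_map bit z false) /bit.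
have G j : (j < size C)%N -> gate_check o [seq bit b | b <- z] (nth ([::], [::]) C j) (n0 + j) =
    bit (nth false z (n0 + j) == gate_value (take (n0 + j) z) (nth ([::], [::]) C j)).
  move=> Hj; rewrite /gate_check /refs_value nth_bit -map_take.
  have -> : [seq nth (zero o) [seq bit b | b <- take (n0 + j) z] r | r <- (nth ([::], [::]) C j).1] =
    [seq bit b | b <- [seq nth false (take (n0 + j) z) r | r <- (nth ([::], [::]) C j).1]].
    by rewrite -map_comp; apply: eq_map => r; rewrite nth_bit.
  have /andP[U A] := allP W _ (mem_nth ([::], [::]) Hj).
  rewrite table_bits ?size_map // /gate_value.
  by case: (nth _ _ _); case: (_ \in _); rewrite /bit /= ?subrr ?subr0 ?mul0r ?mul1r ?mulr0 ?mulr1 ?addr0 ?add0r.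
suff -> : \prod_(j <- iota 0 (size C)) gate_check o [seq bit b | b <- z] (nth ([::], [::]) C j) (n0 + j) =
  bit (z == wires (take n0 z) C).
  by case: (_ == _); rewrite /bit /= ?mul1r ?mul0r.
have L : (n0 + size C <= size z)%N by rewrite S.
have := wires_check L; rewrite -{1}S take_size => ->.
transitivity (\prod_(j <- iota 0 (size C)) bit (nth false z (n0 + j) ==
   gate_value (take (n0 + j) z) (nth ([::], [::]) C j))).
  by apply: eq_big_seq => j; rewrite mem_iota add0n => /G.
elim: (iota 0 (size C)) => [|j l IH] /=; first by rewrite big_nil.
by rewrite big_cons IH; case: (_ == _); rewrite /bit /= ?mul1r ?mul0r.
Qed.
End RingOps.

(** * Counting bad weights and bad challenges *)

Section Counting.
Variables (F : fieldType) (b : nat) (cval : bitstring -> F).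
Hypothesis cval_inj : {in words b &, injective cval}.

Lemma words_cat m n : words (m + n) = flatten [seq [seq u ++ w | w <- words n] | u <- words m].
Proof.
elim: m => [|m IH]; first by rewrite /= cats0 map_id.
rewrite addSn /= IH map_cat flatten_cat !map_flatten -!map_comp.
congr (flatten _ ++ flatten _); apply: eq_map => u /=; by rewrite -map_comp.
Qed.

Lemma count_words_cat (P : pred bitstring) m n :
  count P (words (m + n)) = (\sum_(u <- words m) count (fun w => P (u ++ w)) (words n))%N.
Proof.
rewrite words_cat; elim: (words m) => [|u l IH] /=; first by rewrite big_nil.
by rewrite big_cons count_cat IH count_map.
Qed.

Fixpoint chunks n (w : bitstring) : seq F :=
  if n is n.+1 then cval (take b w) :: chunks n (drop b w) else [::].

Lemma size_chunks n w : size (chunks n w) = n.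
Proof. by elim: n w => //= n IH w; rewrite IH. Qed.

Lemma chunks_cat n u w : u \in words b -> chunks n.+1 (u ++ w) = cval u :: chunks n w.
Proof. by rewrite mem_words => /eqP S; rewrite /= take_size_cat // drop_size_cat. Qed.

(* Pr[P] <= Pr[bad] + max Pr[P | not bad], with the denominators cleared. *)
Lemma count_chunks (P : seq F -> bool) n d e (bad : pred F) :
  (count (fun u => bad (cval u)) (words b) <= d)%N ->
  (forall x, ~~ bad x -> (count (fun w => P (x :: chunks n w)) (words (n * b)) * 2 ^ b <= e * 2 ^ (n * b))%N) ->
  (count (fun w => P (chunks n.+1 w)) (words (n.+1 * b)) * 2 ^ b <= (e + d) * 2 ^ (n.+1 * b))%N.
Proof.
move=> Hd He; rewrite mulSn count_words_cat big_distrl /=.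
apply: (@leq_trans (\sum_(u <- words b) (e * 2 ^ (n * b) + bad (cval u) * 2 ^ (b + n * b)))%N).
  rewrite big_seq [X in (_ <= X)%N]big_seq; apply: leq_sum => u Hu.
  have -> : count (fun w => P (chunks n.+1 (u ++ w))) (words (n * b)) =
     count (fun w => P (cval u :: chunks n w)) (words (n * b)).
    by apply: eq_count => w; rewrite chunks_cat.
  case: (boolP (bad (cval u))) => [_|/He H]; last by rewrite mul0n addn0.
  rewrite mul1n; apply: leq_trans (leq_addl _ _).
  by rewrite expnD mulnC leq_mul2l -(size_words (n * b)) count_size orbT.
rewrite big_split /= big_const_seq count_predT iter_addn_0 size_words -big_distrl /= expnD.
have -> : (\sum_(u <- words b) bad (cval u) = count (fun u => bad (cval u)) (words b))%N.
  by elim: (words b) => [|u l IH] /=; rewrite ?big_nil // big_cons IH.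
by rewrite mulnDl -mulnA [(2 ^ (n * b) * _)%N]mulnC leq_add2l leq_mul2r Hd orbT.
Qed.

Lemma count_roots (q : {poly F}) d : q != 0 -> (size q <= d.+1)%N ->
  (count (fun u => root q (cval u)) (words b) <= d)%N.
Proof.
move=> q0 Sq; rewrite -size_filter -(size_map cval) -ltnS.
apply: leq_trans Sq; apply: max_poly_roots => //.
  by apply/allP => x /mapP[u]; rewrite mem_filter => /andP[Hu _] ->.
rewrite map_inj_in_uniq ?filter_uniq ?uniq_words // => u v.
by rewrite !mem_filter => /andP[_ Hu] /andP[_ Hv]; apply: cval_inj.
Qed.

Local Notation o := (ring_ops F).

Definition weighted n (phi : bitstring -> F) (w : seq F) : F :=
  \sum_(z <- words n) phi z * weight o n w [seq bit F b | b <- z].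

Lemma weight_cons n a w x y :
  weight o n.+1 (a :: w) (x :: y) = (1 - x + x * a) * weight o n w y.
Proof.
rewrite /weight !prodoE !big_map /= big_cons -[X in iota X _](addn0 1) iotaDl big_map.
by congr (_ * _); apply: eq_bigr.
Qed.

(** The Schwartz-Zippel bound for a multilinear polynomial with coefficients phi. Fixing the first
    weight to x replaces phi by [phi (false :: z) + x * phi (true :: z)], and at the tail of z0 this
    vanishes for at most one x. *)
Lemma weighted_count n phi z0 : z0 \in words n -> phi z0 != 0 ->
  (count (fun w => weighted n phi (chunks n w) == 0%R) (words (n * b)) * 2 ^ b <= n * 2 ^ (n * b))%N.
Proof.
elim: n phi z0 => [|n IH] phi z0.
  rewrite inE => /eqP -> H; rewrite mul0n /= /weighted /= big_seq1 /weight /prodo /=.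
  by rewrite mulr1 (negbTE H).
have rec x w : weighted n.+1 phi (x :: w) =
    weighted n (fun z => phi (false :: z) + x * phi (true :: z)) w.
  rewrite /weighted /= big_cat !big_map /= -big_split /=; apply: eq_bigr => z _.
  by rewrite !weight_cons /bit /= subr0 mul0r addr0 mul1r subrr add0r mul1r mulrDl mulrA [x * _]mulrC -!mulrA.
rewrite mem_words; case: z0 => [|c z0] //; rewrite eqSS -mem_words => Hz H.
rewrite -[X in (_ <= X * _)%N]addn1.
apply: (@count_chunks (fun w => weighted n.+1 phi w == 0%R) n 1 n
   (fun x => phi (false :: z0) + x * phi (true :: z0) == 0%R)); last first.
  move=> x Hx; under eq_count => w do rewrite rec.
  exact: (IH (fun z => phi (false :: z) + x * phi (true :: z)) z0).
pose q : {poly F} := phi (true :: z0) *: 'X + (phi (false :: z0))%:P.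
have E x : root q x = (phi (false :: z0) + x * phi (true :: z0) == 0).
  by rewrite rootE /q hornerD hornerZ hornerX hornerC addrC mulrC.
under eq_count => u do rewrite -E.
apply: count_roots; last by rewrite /q -mul_polyC -cons_poly_def size_cons_poly; case: ifP => // _; rewrite ltnS size_polyC leq_b1.
apply/eqP => Eq; move: (congr1 (fun r : {poly F} => r`_0) Eq) (congr1 (fun r : {poly F} => r`_1) Eq).
rewrite !coefD !coefZ !coefX !coefC /= mulr0 add0r mulr1 addr0 => F0 F1.
by case: c H; rewrite ?F0 ?F1 eqxx.
Qed.

Variables (f : seq F -> F) (pf : seq {poly F} -> {poly F}) (d : nat).
Hypothesis pf_horner : forall x ys, (pf ys).[x] = f [seq q.[x] | q <- ys].
Hypothesis pf_size : forall ys, all (fun q : {poly F} => (size q <= 2)%N) ys -> (size (pf ys) <= d.+1)%N.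

Definition partial_sum k pre := \sum_(z <- words k) f (pre ++ [seq bit F b | b <- z]).
Definition round_poly k pre : {poly F} :=
  \sum_(z <- words k) pf ([seq c%:P | c <- pre] ++ 'X :: [seq (bit F b)%:P | b <- z]).

Lemma round_poly_horner k pre x : (round_poly k pre).[x] = partial_sum k (rcons pre x).
Proof.
rewrite /round_poly horner_sum; apply: eq_bigr => z _; rewrite pf_horner; congr f.
rewrite map_cat /= -!map_comp hornerX cat_rcons; congr (_ ++ _ :: _).
  by rewrite -[RHS]map_id; apply: eq_map => c /=; rewrite hornerC.
by apply: eq_map => c /=; rewrite hornerC.
Qed.

Lemma round_poly_size k pre : (size (round_poly k pre) <= d.+1)%N.
Proof.
apply: leq_trans (size_sum _ _ _) _; apply/bigmax_leqP_seq => z _ _; apply: pf_size.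
rewrite all_cat /= size_polyX !all_map /=; apply/andP; split; first last.
  by apply/allP => c _ /=; rewrite (leq_trans (size_polyC_leq1 _)).
by apply/allP => c _ /=; rewrite (leq_trans (size_polyC_leq1 _)).
Qed.

Lemma partial_sumS k pre :
  partial_sum k.+1 pre = (round_poly k pre).[0] + (round_poly k pre).[1].
Proof.
rewrite !round_poly_horner /partial_sum /= big_cat !big_map /=.
by congr (_ + _); apply: eq_bigr => z _; rewrite cat_rcons.
Qed.

Variable strat : seq F -> {poly F}.

Fixpoint verify c pre rho :=
  if rho is r :: rho then
    ((strat pre).[0] + (strat pre).[1] == c) && verify (strat pre).[r] (rcons pre r) rho
  else c == f pre.

Lemma verify_complete n pre rho :
  (forall pre', (size pre' < n)%N -> strat pre' = round_poly (n - size pre').-1 pre') ->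
  (size pre + size rho)%N = n -> verify (partial_sum (size rho) pre) pre rho.
Proof.
move=> H; elim: rho pre => [|r rho IH] pre /= S.
  by rewrite /partial_sum /= big_seq1 cats0.
have E : strat pre = round_poly (size rho) pre.
  rewrite H; last by rewrite -S; lia.
  by rewrite -S addKn.
rewrite partial_sumS E eqxx /= round_poly_horner; apply: IH.
by rewrite size_rcons -S addSnnS.
Qed.

(** If the claim is false and the check of the round succeeds, the announced polynomial is not the
    honest one. The next claim is then true only when the challenge is a root of their difference,
    which has at most d roots. *)
Lemma verify_sound n c pre : (forall pre, (size (strat pre) <= d.+1)%N) ->
  c != partial_sum n pre ->
  (count (fun w => verify c pre (chunks n w)) (words (n * b)) * 2 ^ b <= n * d * 2 ^ (n * b))%N.
Proof.
move=> Hs; elim: n c pre => [|n IH] c pre.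
  rewrite /partial_sum /= big_seq1 cats0 => /negbTE ->.
  by rewrite !mul0n.
rewrite partial_sumS => Hc; rewrite [(n.+1 * d)%N]mulSn [(d + _)%N]addnC.
case E : ((strat pre).[0] + (strat pre).[1] == c); last first.
  by rewrite (eq_count (a2 := pred0)) ?count_pred0 // => w /=; rewrite E.
apply: (@count_chunks (fun rho => verify c pre rho) n d (n * d)
   (fun x => root (strat pre - round_poly n pre) x)).
  apply: count_roots.
    by apply: contraNneq Hc => /eqP; rewrite subr_eq0 => /eqP <-; rewrite (eqP E).
  by rewrite (leq_trans (size_polyD _ _)) // size_polyN geq_max Hs round_poly_size.
move=> x; rewrite rootE hornerD hornerN subr_eq0 round_poly_horner => Hx.
have -> : count (fun w => verify c pre (x :: chunks n w)) (words (n * b)) =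
   count (fun w => verify (strat pre).[x] (rcons pre x) (chunks n w)) (words (n * b)).
  by apply: eq_count => w /=; rewrite E.
exact: IH.
Qed.
End Counting.


(** * The protocol for the unsatisfiability of a circuit *)

Section Protocol.
Variables (F : fieldType) (b : nat) (cval : bitstring -> F).
Hypothesis cval_inj : {in words b &, injective cval}.
Variables (n0 : nat) (C : seq gateT).
Hypothesis W : all gwf C.
Local Notation o := (ring_ops F).
Local Notation N := (n0 + size C)%N.

(** For arguments of degree at most one, a gate contributes its number of inputs plus one, the
    output wire contributes one, and so does each factor of the weight. *)
Definition degree_bound := ((sumn [seq (size g.1).+1 | g <- C]).+1 + N)%N.

Definition summand_poly (w : seq F) (ys : seq {poly F}) : {poly F} :=
  summand (ring_ops {poly F}) n0 C [seq c%:P | c <- w] ys.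

Lemma summand_poly_horner w x ys :
  (summand_poly w ys).[x] = summand o n0 C w [seq q.[x] | q <- ys].
Proof.
rewrite /summand_poly (@summand_morph _ _ (ring_ops {poly F}) o (fun q => q.[x])) /=.
- by rewrite -map_comp map_id_in // => c _ /=; rewrite hornerC.
- exact: horner0.
- exact: hornerC.
- by move=> a a'; rewrite hornerD.
- by move=> a a'; rewrite hornerM.
- by move=> a; rewrite hornerD hornerN hornerC.
Qed.

Lemma size_prod_bound (I : eqType) (r : seq I) (G : I -> {poly F}) k :
  {in r, forall i, (size (G i) <= (k i).+1)%N} ->
  (size (\prod_(i <- r) G i)%R <= (sumn [seq k i | i <- r]).+1)%N.
Proof.
elim: r => [|i r IH] H; first by rewrite big_nil size_poly1.
rewrite big_cons /=; apply: leq_trans (size_polyMleq _ _) _.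
have H1 := H i (mem_head _ _); have H2 := IH (fun j Hj => H j (mem_behead (s := i :: r) Hj)).
by have := leq_add H1 H2; rewrite addSn addnS; case: (addn (size _) (size _)) => // n; rewrite ltnS.
Qed.

Lemma size_mul_bound (p q : {poly F}) k l :
  (size p <= k.+1)%N -> (size q <= l.+1)%N -> (size (p * q)%R <= (k + l).+1)%N.
Proof. by move=> H1 H2; apply: leq_trans (size_polyMleq _ _) _; lia. Qed.

Lemma size_add_bound (p q : {poly F}) k :
  (size p <= k.+1)%N -> (size q <= k.+1)%N -> (size (p + q)%R <= k.+1)%N.
Proof. by move=> H1 H2; apply: leq_trans (size_polyD _ _) _; rewrite geq_max H1. Qed.

Lemma size_neg_bound (p : {poly F}) k :
  (size p <= k.+1)%N -> (size (1 - p)%R <= k.+1)%N.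
Proof. by move=> H; apply: size_add_bound; rewrite ?size_poly1 ?size_polyN. Qed.

Lemma sumn_const (s : seq nat) k : all (fun x => x == k) s -> sumn s = (size s * k)%N.
Proof. by elim: s => //= x s IH /andP[/eqP -> /IH ->]; rewrite mulSn. Qed.

Lemma summand_poly_size w ys : all (fun q : {poly F} => (size q <= 2)%N) ys ->
  (size (summand_poly w ys) <= degree_bound.+1)%N.
Proof.
move=> A.
have Y i (l : seq {poly F}) : {subset l <= ys} -> (size (nth 0%R l i) <= 2)%N.
  move=> S; case: (ltnP i (size l)) => L; last by rewrite nth_default ?size_poly0.
  exact/(allP A)/S/mem_nth.
rewrite /summand_poly /summand /consistent /weight !prodoE !big_map /degree_bound.
apply: size_mul_bound; first rewrite -addn1; first apply: size_mul_bound.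
- have <- : [seq (size (nth ([::], [::]) C j).1).+1 | j <- iota 0 (size C)] = [seq (size g.1).+1 | g <- C].
    by rewrite -[in RHS](mkseq_nth ([::], [::]) C) /mkseq -map_comp.
  apply: size_prod_bound => j; rewrite mem_iota add0n => /= Hj; rewrite /gate_check.
  set g := nth ([::], [::]) C j; have /andP[U G] : gwf g by apply: (allP W); rewrite mem_nth.
  have R : (size (refs_value (ring_ops {poly F}) ys g (n0 + j)) <= (size g.1).+1)%N.
    rewrite /refs_value /table_value sumoE big_map.
    apply: leq_trans (size_sum _ _ _) _; apply/bigmax_leqP_seq => z Hz _.
    rewrite /minterm prodoE big_map.
    have E : size z = size g.1 by apply/eqP; have := allP G _ Hz.
    apply: (@leq_trans (sumn [seq 1 | i <- iota 0 (size z)]).+1%N).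
      apply: size_prod_bound => i _.
      have B : (size (nth (zero (ring_ops {poly F})) [seq nth (zero (ring_ops {poly F})) (take (n0 + j) ys) r | r <- g.1] i) <= 2)%N.
        case: (ltnP i (size g.1)) => L; last by rewrite nth_default ?size_map // size_poly0.
        by rewrite (nth_map 0%N) //; apply: Y => u; apply: mem_take.
      by case: ifP => _; [|apply: size_neg_bound].
    by rewrite ltnS (@sumn_const _ 1) ?size_map ?size_iota ?muln1 ?E // all_map; apply/allP.
  have Yi := Y (n0 + j)%N ys (fun _ => id).
  rewrite /=; apply: size_add_bound; apply: (@size_mul_bound _ _ 1 (size g.1)) => //.
    exact: (@size_neg_bound _ 1).
  exact: size_neg_bound.
- case/lastP: (ys) A => [|l a] A /=; first by rewrite size_poly0.
  by move: A; rewrite all_rcons last_rcons => /andP[].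
apply: (@leq_trans (sumn [seq 1 | i <- iota 0 N]).+1%N).
  apply: size_prod_bound => i _ /=; apply: size_add_bound.
    by apply: (@size_neg_bound _ 1); apply: Y.
  rewrite -[1%N]addn0; apply: size_mul_bound; first exact: Y.
  case: (ltnP i (size w)) => L; last by rewrite nth_default ?size_map // size_poly0.
  by rewrite (nth_map 0) // size_polyC_leq1.
by rewrite ltnS (@sumn_const _ 1) ?size_map ?size_iota ?muln1 // all_map; apply/allP.
Qed.

Variable strat : seq F -> seq F -> {poly F}.

Definition accepts (u : bitstring) :=
  verify (summand o n0 C (chunks b cval N u)) (strat (chunks b cval N u)) 0 [::]
         (chunks b cval N (drop (N * b) u)).

Lemma chunks_cat_take n u v : size u = (n * b)%N -> chunks b cval n (u ++ v) = chunks b cval n u.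
Proof.
elim: n u => //= n IH u; rewrite mulSn => S.
have L : (b <= size u)%N by rewrite S leq_addr.
congr (cval _ :: _).
  rewrite take_cat; case: ltngtP L => // ->; by rewrite subnn take0 cats0 take_size.
rewrite drop_cat; case: ltngtP L => // [L _|E _].
  by rewrite IH // size_drop S addKn.
have Z : size (@nil bool) = (n * b)%N by have := S; rewrite -E /= => /eqP; rewrite -{1}[b]addn0 eqn_add2l => /eqP.
have D : drop b u = [::] by rewrite drop_oversize // E.
by rewrite -E subnn drop0 D -(IH [::] Z).
Qed.

Lemma weightedE w :
  weighted N (fun z => consistent o n0 C [seq bit F b | b <- z]) w = partial_sum (summand o n0 C w) N [::].
Proof. by []. Qed.

(** With probability at most N / 2^b the weights cancel the violations. Otherwise the claim 0 is
    false and survives the N rounds with probability at most N * degree_bound / 2^b. The hypothesis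
    on b makes the total at most 1/2. *)
Theorem accepts_sound x : size x = n0 -> last false (wires x C) ->
  (forall w pre, (size (strat w pre) <= degree_bound.+1)%N) ->
  (2 * N * degree_bound.+1 <= 2 ^ b)%N ->
  (count accepts (words (N * b + N * b)) * 2 <= 2 ^ (N * b + N * b))%N.
Proof.
move=> Sx Hx Hs Hb.
have szw : size (wires x C) = N by rewrite size_wires Sx.
have tw : take n0 (wires x C) = x by have [v [-> _]] := prefix_wires x C; rewrite take_size_cat.
pose phi z := consistent o n0 C [seq bit F b | b <- z].
have C1 : (count (fun u => weighted N phi (chunks b cval N u) == 0%R) (words (N * b)) * 2 ^ b <= N * 2 ^ (N * b))%N.
  apply: (@weighted_count _ _ _ cval_inj _ phi (wires x C)); first by rewrite mem_words szw.
  by rewrite /phi consistent_bits // tw eqxx Hx /bit oner_eq0.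
suff : (count accepts (words (N * b + N * b)) * 2 ^ b <= N * degree_bound.+1 * 2 ^ (N * b + N * b))%N.
  move=> H; have P : (0 < 2 ^ b)%N by rewrite expn_gt0.
  rewrite -(leq_pmul2r P) mulnAC; apply: (@leq_trans (N * degree_bound.+1 * 2 ^ (N * b + N * b) * 2)).
    by rewrite leq_mul2r H orbT.
  by rewrite [X in (X <= _)%N]mulnC !mulnA [X in (_ <= X)%N]mulnC leq_mul2r Hb orbT.
rewrite count_words_cat big_distrl /=.
apply: (@leq_trans (\sum_(u <- words (N * b)) (N * degree_bound * 2 ^ (N * b) +
   (weighted N phi (chunks b cval N u) == 0%R) * 2 ^ (b + N * b)))%N).
  rewrite big_seq [X in (_ <= X)%N]big_seq; apply: leq_sum => u; rewrite mem_words => /eqP Su.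
  have -> : count (fun v => accepts (u ++ v)) (words (N * b)) =
     count (fun v => verify (summand o n0 C (chunks b cval N u)) (strat (chunks b cval N u)) 0 [::] (chunks b cval N v)) (words (N * b)).
    by apply: eq_count => v; rewrite /accepts chunks_cat_take // drop_size_cat.
  case: eqP => [_|/eqP H].
    rewrite mul1n; apply: leq_trans (leq_addl _ _).
    by rewrite expnD mulnC leq_mul2l -(size_words (N * b)) count_size orbT.
  rewrite mul0n addn0.
  apply: (@verify_sound F b cval cval_inj (summand o n0 C (chunks b cval N u)) (summand_poly (chunks b cval N u)) degree_bound) => //.
  - by move=> y ys; apply: summand_poly_horner.
  - exact: summand_poly_size.
  - by rewrite -weightedE eq_sym.
rewrite big_split /= big_const_seq count_predT iter_addn_0 size_words -big_distrl /=.
have -> : (\sum_(u <- words (N * b)) (weighted N phi (chunks b cval N u) == 0%R) =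
   count (fun u => weighted N phi (chunks b cval N u) == 0%R) (words (N * b)))%N.
  by elim: (words (N * b)) => [|u l IH] /=; rewrite ?big_nil // big_cons IH.
rewrite [(N * degree_bound.+1)%N]mulnS [X in (_ <= X)%N]mulnDl addnC leq_add //; last by rewrite expnD mulnA.
by rewrite !expnD [X in (X <= _)%N]mulnA [X in (_ <= X)%N]mulnA leq_mul2r C1 orbT.
Qed.

Theorem accepts_complete u :
  (forall x, size x = n0 -> ~~ last false (wires x C)) ->
  (forall w pre, size w = N -> (size pre < N)%N ->
     strat w pre = round_poly (summand_poly w) (N - size pre).-1 pre) ->
  accepts u.
Proof.
move=> Hx Hs; set w := chunks b cval N u.
have E0 : partial_sum (summand o n0 C w) N [::] = 0.
  rewrite -weightedE /weighted big1_seq // => z /andP[_]; rewrite mem_words => /eqP Sz.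
  rewrite consistent_bits //; case: eqP => [E|]; last by rewrite /bit mul0r.
  by rewrite E (negbTE (Hx _ _)) ?/bit ?mul0r // size_takel // Sz leq_addr.
rewrite /accepts -/w -E0.
have := @verify_complete F (summand o n0 C w) (summand_poly w) (@summand_poly_horner w) (strat w) N [::] (chunks b cval N (drop (N * b) u)).
rewrite size_chunks; apply => // pre Hp.
by rewrite Hs // size_chunks.
Qed.
End Protocol.


(* Polynomials over F_p modulo X^K, as lists of K residues; for K = 1 this is F_p. *)
Definition trunc_ops p K : ops (seq nat) := Ops
  (nseq K 0%N)
  [seq nat_of_bool (i == 0%N) | i <- iota 0 K]
  (fun a b => [seq (nth 0 a i + nth 0 b i) %% p | i <- iota 0 K]%N)
  (fun a b => [seq sumn [seq nth 0 a i * nth 0 b (k - i) | i <- iota 0 k.+1] %% p | k <- iota 0 K]%N)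
  (fun a => [seq ((i == 0) + (p - nth 0 a i)) %% p | i <- iota 0 K]%N).

Definition residues_eval p (q : seq nat) r := foldl (fun acc a => (a + r * acc) %% p)%N 0%N (rev q).

(** * The verifier and the honest prover on residues *)

Section Truncation.
Variable p : nat.
Hypothesis pp : prime p.
Local Notation Fp := 'F_p.

Definition resid (x : Fp) : nat := x.
Arguments resid : simpl never.
Arguments summand : simpl never.

Lemma resid_nat n : resid n%:R = (n %% p)%N.
Proof. exact: val_Fp_nat. Qed.
Lemma residK x : (resid x)%:R = x :> Fp.
Proof. exact: natr_Zp. Qed.
Lemma resid_small n : (n < p)%N -> resid n%:R = n.
Proof. by move=> L; rewrite resid_nat modn_small. Qed.
Lemma resid_lt x : (resid x < p)%N.
Proof. by rewrite -[x]residK resid_nat ltn_mod prime_gt0. Qed.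
Lemma resid0 : resid 0 = 0%N.
Proof. by have := resid_nat 0; rewrite mod0n. Qed.
Lemma resid1 : resid 1 = 1%N.
Proof. by have := resid_nat 1; rewrite modn_small ?prime_gt1. Qed.
Lemma residD x y : resid (x + y) = ((resid x + resid y) %% p)%N.
Proof. by rewrite -{1}[x]residK -{1}[y]residK -natrD resid_nat. Qed.
Lemma residM x y : resid (x * y) = ((resid x * resid y) %% p)%N.
Proof. by rewrite -{1}[x]residK -{1}[y]residK -natrM resid_nat. Qed.
Lemma residN x : resid (- x) = ((p - resid x) %% p)%N.
Proof.
rewrite -resid_nat natrB ?residK; last exact: ltnW (resid_lt x).
have -> : p%:R = 0 :> Fp by rewrite -[LHS]residK resid_nat modnn.
by rewrite sub0r.
Qed.
Lemma resid_inj : injective resid.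
Proof. by move=> x y E; rewrite -[x]residK E residK. Qed.

Lemma resid_sum (l : seq nat) (f : nat -> Fp) :
  resid (\sum_(i <- l) f i) = (sumn [seq resid (f i) | i <- l] %% p)%N.
Proof.
elim: l => [|i l IH]; first by rewrite big_nil resid0 mod0n.
by rewrite big_cons residD IH /= modnDmr.
Qed.

Lemma sumn_mod (l : seq nat) (f : nat -> nat) :
  (sumn [seq f i %% p | i <- l] = sumn [seq f i | i <- l] %[mod p])%N.
Proof. by elim: l => //= i l IH; rewrite -modnDmr IH modnDmr modnDml. Qed.

Definition trunc K (q : {poly Fp}) : seq nat := [seq resid q`_i | i <- iota 0 K].

Lemma size_trunc K q : size (trunc K q) = K.
Proof. by rewrite size_map size_iota. Qed.

Lemma nth_trunc K q i : (i < K)%N -> nth 0%N (trunc K q) i = resid q`_i.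
Proof. by move=> L; rewrite (nth_map 0%N) ?size_iota // nth_iota. Qed.

Lemma eq_trunc K (g h : nat -> nat) : (forall i, (i < K)%N -> g i = h i) ->
  [seq g i | i <- iota 0 K] = [seq h i | i <- iota 0 K].
Proof. by move=> E; apply/eq_in_map => i; rewrite mem_iota add0n => /E. Qed.

Lemma trunc_morph K n0 C (w y : seq {poly Fp}) :
  trunc K (summand (ring_ops {poly Fp}) n0 C w y) =
  summand (trunc_ops p K) n0 C [seq trunc K q | q <- w] [seq trunc K q | q <- y].
Proof.
apply: summand_morph.
- apply: (@eq_from_nth _ 0%N); rewrite size_trunc ?size_nseq // => i L.
  by rewrite nth_trunc // coef0 resid0 nth_nseq L.
- by apply: eq_trunc => i _; rewrite coef1; case: (i == 0%N); rewrite ?resid0 ?resid1.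
- by move=> a b; apply: eq_trunc => i L; rewrite coefD residD !nth_trunc.
- move=> a b; apply: eq_trunc => i L; rewrite coefM.
  rewrite -(big_mkord xpredT (fun j => a`_j * b`_(i - j))) /index_iota subn0 resid_sum -[RHS]sumn_mod.
  congr (modn (sumn _) p); apply/eq_in_map => j; rewrite mem_iota add0n => /andP[_ Lj].
  have [L1 L2] : (j < K)%N /\ (i - j < K)%N by lia.
  by rewrite residM !nth_trunc.
- move=> a; apply: eq_trunc => i L; rewrite coefB coef1 residD residN nth_trunc // modnDmr.
  by case: (i == 0%N); rewrite ?resid0 ?resid1.
Qed.

Lemma trunc_polyC K c : (0 < K)%N -> trunc K c%:P = resid c :: nseq K.-1 0%N.
Proof.
move=> K0; apply: (@eq_from_nth _ 0%N); first by rewrite size_trunc /= size_nseq prednK.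
rewrite size_trunc => -[|i] L; rewrite nth_trunc // coefC //= nth_nseq ?resid0.
by case: ifP.
Qed.

Lemma trunc_X K : (1 < K)%N -> trunc K 'X = [:: 0, 1 & nseq K.-2 0]%N.
Proof.
move=> K0; apply: (@eq_from_nth _ 0%N); first by rewrite size_trunc /= size_nseq; lia.
rewrite size_trunc => -[|[|i]] L; rewrite nth_trunc // coefX /= ?resid0 ?resid1 // nth_nseq.
by case: ifP.
Qed.

Lemma trunc_sum K (l : seq bitstring) (f : bitstring -> {poly Fp}) :
  trunc K (\sum_(z <- l) f z) = sumo (trunc_ops p K) [seq trunc K (f z) | z <- l].
Proof.
have -> : \sum_(z <- l) f z = sumo (ring_ops {poly Fp}) [seq f z | z <- l] by rewrite sumoE big_map.
rewrite (@sumo_morph _ _ (ring_ops {poly Fp}) (trunc_ops p K) (trunc K)) -?map_comp //=.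
- apply: (@eq_from_nth _ 0%N); rewrite size_trunc ?size_nseq // => i L.
  by rewrite nth_trunc // coef0 resid0 nth_nseq L.
- by move=> a b; apply: eq_trunc => i L; rewrite coefD residD !nth_trunc.
Qed.

Definition poly_of (q : seq nat) : {poly Fp} := Poly [seq a%:R | a <- q].

Lemma poly_ofK K (q : {poly Fp}) : (size q <= K)%N -> poly_of (trunc K q) = q.
Proof.
move=> L; apply/polyP => i; rewrite coef_Poly -map_comp.
case: (ltnP i K) => H; last by rewrite !nth_default ?size_map ?size_iota // (leq_trans L H).
by rewrite (nth_map 0%N) ?size_iota // nth_iota // /= residK.
Qed.

Lemma residues_evalE q r : residues_eval p q (resid r) = resid (poly_of q).[r].
Proof.
rewrite /residues_eval foldl_rev /poly_of horner_Poly; elim: q => [|a q IH] /=; first by rewrite -resid0.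
by rewrite IH residD residM resid_nat modnDml modnDmr mulnC addnC.
Qed.

(* The verifier on residues: the accumulator holds the current claim, the prefix
   of the point, and whether all checks have succeeded so far. *)
Definition residue_step (strat : seq nat -> seq nat) (st : nat * seq nat * bool) r :=
  let q := strat st.1.2 in
  (residues_eval p q r, rcons st.1.2 r,
   st.2 && ((residues_eval p q 0 + residues_eval p q 1) %% p == st.1.1)%N).

Definition residue_verify n0 C (strat : seq nat -> seq nat) (w rho : seq nat) :=
  let st := foldl (residue_step strat) (0%N, [::], true) rho in
  st.2 && ([:: st.1.1] == summand (trunc_ops p 1) n0 C [seq [:: c] | c <- w] [seq [:: c] | c <- st.1.2]).

Lemma residue_verifyE n0 C strat (w rho : seq Fp) :
  residue_verify n0 C strat [seq resid c | c <- w] [seq resid c | c <- rho] =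
  verify (summand (ring_ops Fp) n0 C w) (fun pre => poly_of (strat [seq resid c | c <- pre])) 0 [::] rho.
Proof.
rewrite /residue_verify -{1}resid0 -[X in (_, X, true)]/[seq resid c | c <- [::]].
have fin c pre : ([:: resid c] == summand (trunc_ops p 1) n0 C [seq [:: c] | c <- [seq resid c | c <- w]]
    [seq [:: c] | c <- [seq resid c | c <- pre]]) = (c == summand (ring_ops Fp) n0 C w pre).
  have -> : summand (trunc_ops p 1) n0 C [seq [:: c] | c <- [seq resid c | c <- w]]
      [seq [:: c] | c <- [seq resid c | c <- pre]] = trunc 1 (summand_poly n0 C w [seq c%:P | c <- pre]).
    by rewrite trunc_morph -!map_comp; congr summand; apply: eq_map => c' /=; rewrite trunc_polyC.
  have -> : summand_poly n0 C w [seq c%:P | c <- pre] = (summand (ring_ops Fp) n0 C w pre)%:P.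
    rewrite /summand_poly (@summand_morph _ _ (ring_ops Fp) (ring_ops {poly Fp}) polyC) //=.
    - by move=> a b; rewrite polyCD.
    - by move=> a b; rewrite polyCM.
    - by move=> a; rewrite polyCB.
  move: (summand _ _ _ _ _) => v.
  rewrite trunc_polyC //= eqseq_cons eqxx andbT; apply/eqP/eqP => [/resid_inj //|-> //].
have : forall ok (c : Fp) pre, let st := foldl (residue_step strat) (resid c, [seq resid c | c <- pre], ok) [seq resid c | c <- rho] in
  st.2 && ([:: st.1.1] == summand (trunc_ops p 1) n0 C [seq [:: c] | c <- [seq resid c | c <- w]] [seq [:: c] | c <- st.1.2])
  = ok && verify (summand (ring_ops Fp) n0 C w) (fun pre => poly_of (strat [seq resid c | c <- pre])) c pre rho.
  elim: rho => [|r rho IH] ok c pre /=; first by rewrite fin.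
  have E0 q : residues_eval p q 0 = resid (poly_of q).[0] by rewrite -residues_evalE resid0.
  have E1 q : residues_eval p q 1 = resid (poly_of q).[1] by rewrite -residues_evalE resid1.
  rewrite /residue_step [(_, _, ok).1.1]/= [(_, _, ok).1.2]/= [(_, _, ok).2]/=.
  rewrite residues_evalE -map_rcons E0 E1 -residD IH -andbA; congr (_ && (_ && _)).
by move=> H; rewrite (H true 0 [::]).
Qed.

Definition const_residues K c : seq nat := c :: nseq K.-1 0%N.
Definition var_residues K : seq nat := [:: 0, 1 & nseq K.-2 0]%N.

Definition round_residues K n0 C (w pre : seq nat) k : seq nat :=
  sumo (trunc_ops p K) [seq summand (trunc_ops p K) n0 C [seq const_residues K c | c <- w]
    ([seq const_residues K c | c <- pre] ++
     var_residues K :: [seq const_residues K (nat_of_bool b) | b <- z]) | z <- words k].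

(** The computation is modulo X^K; when K exceeds the degree of the message nothing is lost, by
    [poly_ofK]. *)
Lemma round_residuesE K n0 C w pre k : (1 < K)%N ->
  round_residues K n0 C [seq resid c | c <- w] [seq resid c | c <- pre] k =
  trunc K (round_poly (summand_poly n0 C w) k pre).
Proof.
move=> K1; rewrite /round_poly trunc_sum /round_residues.
have E (l : seq Fp) : [seq const_residues K c | c <- [seq resid c | c <- l]] =
    [seq trunc K q | q <- [seq c%:P | c <- l]].
  by rewrite -!map_comp; apply: eq_map => c; rewrite /comp trunc_polyC // ltnW.
have E2 (z : bitstring) : [seq const_residues K (nat_of_bool b) | b <- z] =
    [seq trunc K q | q <- [seq (bit Fp b)%:P | b <- z]].
  rewrite -!map_comp; apply: eq_map => c; rewrite /comp trunc_polyC // ?(ltnW K1) //.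
  by case: c; rewrite /bit ?resid0 ?resid1.
have EX : var_residues K = trunc K 'X by rewrite trunc_X.
congr sumo; apply: eq_map => z.
by rewrite !E E2 EX -map_cons -map_cat -trunc_morph.
Qed.
End Truncation.
End SumCheck.
Import SumCheck.

(** * Feasibility of the protocol *)

Section FpBasics.
Context {X : Type} {eX : encT X}.

Lemma fp_sumn (l : X -> seq nat) : fp l -> fp (fun x => sumn (l x)).
Proof.
move=> Hl; apply: (@fp_ext _ _ _ _ (fun x => size (flatten [seq nseq k 0 | k <- l x]))); first by fpa.
by move=> x; rewrite size_flatten /shape -map_comp map_id_in // => k _; rewrite /= size_nseq.
Qed.

Lemma fp_nat_of_bool (b : X -> bool) : fp b -> fp (fun x => nat_of_bool (b x)).
Proof.
move=> Hb; apply: (@fp_ext _ _ _ _ (fun x => if b x then 1 else 0)); first by fpa.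
by move=> x; case: (b x).
Qed.

Lemma fp_minn (a b : X -> nat) : fp a -> fp b -> fp (fun x => minn (a x) (b x)).
Proof. by move=> Ha Hb; rewrite /minn; apply: fp_if; fpa. Qed.
End FpBasics.

(** Binary to unary conversion; the cap keeps it polynomial in m on all inputs. *)
Definition cval_cap m (w : bitstring) := foldl (fun v (b : bool) => minn (2 * v + b) m) 0 w.

Lemma cval_capE m w : 2 ^ size w <= m.+1 -> cval_cap m w = bval w.
Proof.
elim/last_ind: w => // w b IH; rewrite size_rcons expnS /cval_cap bval_rcons -cats1 foldl_cat /= => H.
have := bval_lt (rcons w b); rewrite bval_rcons size_rcons expnS => H2.
rewrite -/(cval_cap m w) IH; last by lia.
by rewrite /minn; case: ifP => // /negbT; lia.
Qed.

Lemma fp_cval_cap X {eX : encT X} (m : X -> nat) (w : X -> seq bool) :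
  fp m -> fp w -> fp (fun x => cval_cap (m x) (w x)).
Proof.
move=> Hm Hw; have [g [Pg _ Lg]] := fp_size Hm.
apply: (@fp_foldl _ _ _ _ _ _ (fun x v (b : bool) => minn (2 * v + b) (m x)) _ _ g) => //.
- by apply: fp_minn; fpa; apply: fp_nat_of_bool; fpa.
- by fpa.
move=> x i _; apply: leq_trans (Lg x); rewrite !esz_nat.
elim/last_ind: (take _ _) => // u b _; rewrite -cats1 foldl_cat /=; exact: geq_minr.
Qed.

Ltac fp_protocol := fail.
Ltac fp_user ::= lazymatch goal with
  | |- fp (fun x => Str (pfst (@?f x))) => apply: fp_pfst
  | |- fp (fun x => Str (psnd (@?f x))) => apply: fp_psnd
  | |- fp (fun x => expn (@?f x) ?c) => apply: fp_pow
  | |- fp (fun x => dec (unstr (@?f x))) => apply: fp_dec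
  | |- fp (fun x => pair_code (@?f x) (@?g x)) => apply: fp_pair_code
  | |- fp (fun x => atom (@?f x) (@?g x) (@?h x)) => apply: fp_atom
  | |- fp (fun x => pst (@?f x) (@?g x)) => apply: fp_pst
  | |- fp (fun x => bits (@?f x) (@?g x)) => apply: fp_bits
  | |- fp (fun x => sumn (@?f x)) => apply: fp_sumn
  | |- fp (fun x => nat_of_bool (@?f x)) => apply: fp_nat_of_bool
  | |- fp (fun x => minn (@?f x) (@?g x)) => apply: fp_minn
  | |- fp (fun x => cval_cap (@?f x) (@?g x)) => apply: fp_cval_cap
  | |- _ => fp_protocol
  end.

Section FpOps.
Context {X : Type} {eX : encT X} (p K : X -> nat).
Hypotheses (Hp : fp p) (HK : fp K).
Local Notation T x := (trunc_ops (p x).+1 (K x)).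

Lemma fp_tzero : fp (fun x => zero (T x)).
Proof. by cbv [zero trunc_ops]; fpa. Qed.
Lemma fp_tone : fp (fun x => one (T x)).
Proof. by cbv [one trunc_ops]; fpa. Qed.
Lemma fp_tadd (a b : X -> seq nat) : fp a -> fp b -> fp (fun x => add (T x) (a x) (b x)).
Proof. by move=> Ha Hb; cbv [add trunc_ops]; fpa. Qed.
Lemma fp_tmul (a b : X -> seq nat) : fp a -> fp b -> fp (fun x => mul (T x) (a x) (b x)).
Proof. by move=> Ha Hb; cbv [mul trunc_ops]; fpa. Qed.
Lemma fp_tneg (a : X -> seq nat) : fp a -> fp (fun x => neg (T x) (a x)).
Proof. by move=> Ha; cbv [neg trunc_ops]; fpa. Qed.

Lemma esz_residues m k (l : seq nat) : size l = k -> all (fun a => a <= m) l ->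
  esz l <= k * (2 * m + 1).
Proof.
move=> <- A; apply: esz_leq => i L d; rewrite esz_nat.
exact: (allP A) (mem_nth _ _).
Qed.
End FpOps.

(** Folds stay small because each operation returns exactly K residues. The modulus is always
    written as a successor, since reduction modulo 0 would bound nothing. *)
Lemma fp_foldop X {eX : encT X} (p K : X -> nat) (op : X -> seq nat -> seq nat -> seq nat)
    (e : X -> seq nat) (l : X -> seq (seq nat)) :
  fp p -> fp K -> fp l -> fp e -> fp (fun q : X * (seq nat * seq nat) => op q.1 q.2.1 q.2.2) ->
  (forall x, size (e x) = K x /\ all (fun a => a <= (p x).+1) (e x)) ->
  (forall x a b, size (op x a b) = K x /\ all (fun a => a <= (p x).+1) (op x a b)) ->
  fp (fun x => foldl (op x) (e x) (l x)).
Proof.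
move=> Hp HK Hl He Ho Be Bo.
have [g [Pg _ Lg]] := fp_size Hp; have [h [Ph _ Lh]] := fp_size HK.
apply: (@fp_foldl _ _ _ _ _ _ op e l (fun k => h k * (2 * (g k).+1 + 1))) => //.
  by have := polyb_add Pg (polyb_const 1) => P1; apply: polyb_mul => //; apply: polyb_add; [|exact: polyb_const];
     apply: polyb_mul; [exact: polyb_const|]; apply: polyb_leq P1 _ => n; rewrite addn1.
move=> x i _; have := Lg x; have := Lh x; rewrite !esz_nat => L1 L2.
have [S A] : size (foldl (op x) (e x) (take i (l x))) = K x /\
    all (fun a => a <= (p x).+1) (foldl (op x) (e x) (take i (l x))).
  by elim/last_ind: (take _ _) => [|u b _]; rewrite -?cats1 ?foldl_cat /=.
apply: leq_trans (esz_residues S A) _; apply: leq_mul => //; lia.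
Qed.

Section FpOps2.
Context {X : Type} {eX : encT X} (p K : X -> nat).
Hypotheses (Hp : fp p) (HK : fp K).
Local Notation T x := (trunc_ops (p x).+1 (K x)).

Lemma fp_prodo (l : X -> seq (seq nat)) : fp l -> fp (fun x => prodo (T x) (l x)).
Proof.
move=> Hl; apply: (@fp_foldop _ _ p K (fun x => mul (T x)) (fun x => one (T x))) => //.
- exact: fp_tone.
- by apply: fp_tmul; fpa.
- move=> x; cbv [one trunc_ops]; rewrite size_map size_iota all_map; split=> //.
  by apply/allP => i _ /=; case: eqP.
- move=> x a b; cbv [mul trunc_ops]; rewrite size_map size_iota all_map; split=> //.
  by apply/allP => i _; rewrite [X in is_true X]/= ltnW // ltn_mod.
Qed.

Lemma fp_sumo (l : X -> seq (seq nat)) : fp l -> fp (fun x => sumo (T x) (l x)).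
Proof.
move=> Hl; apply: (@fp_foldop _ _ p K (fun x => add (T x)) (fun x => zero (T x))) => //.
- exact: fp_tzero.
- by apply: fp_tadd; fpa.
- move=> x; cbv [zero trunc_ops]; rewrite size_nseq; split=> //.
  by apply/allP => i /nseqP[-> _].
- move=> x a b; cbv [add trunc_ops]; rewrite size_map size_iota all_map; split=> //.
  by apply/allP => i _; rewrite [X in is_true X]/= ltnW // ltn_mod.
Qed.
End FpOps2.

Ltac fp_protocol ::= lazymatch goal with
  | |- fp (fun x => zero (trunc_ops (S (@?p x)) (@?K x))) => apply: fp_tzero
  | |- fp (fun x => one (trunc_ops (S (@?p x)) (@?K x))) => apply: fp_tone
  | |- fp (fun x => add (trunc_ops (S (@?p x)) (@?K x)) _ _) => apply: fp_tadd
  | |- fp (fun x => mul (trunc_ops (S (@?p x)) (@?K x)) _ _) => apply: fp_tmul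
  | |- fp (fun x => neg (trunc_ops (S (@?p x)) (@?K x)) _) => apply: fp_tneg
  | |- fp (fun x => prodo (trunc_ops (S (@?p x)) (@?K x)) _) => apply: fp_prodo
  | |- fp (fun x => sumo (trunc_ops (S (@?p x)) (@?K x)) _) => apply: fp_sumo
  end.

Section FpSummand.
Context {X : Type} {eX : encT X} (p K : X -> nat).
Hypotheses (Hp : fp p) (HK : fp K).
Local Notation T x := (trunc_ops (p x).+1 (K x)).

Lemma fp_minterm (ys : X -> seq (seq nat)) (w : X -> seq bool) : fp ys -> fp w ->
  fp (fun x => minterm (T x) (ys x) (w x)).
Proof. by move=> Hy Hw; rewrite /minterm; fpa. Qed.
End FpSummand.

Section FpSummand2.
Context {X : Type} {eX : encT X} (p K : X -> nat).
Hypotheses (Hp : fp p) (HK : fp K).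
Local Notation T x := (trunc_ops (p x).+1 (K x)).

Lemma fp_refs_value (y : X -> seq (seq nat)) (g : X -> gateT) (i : X -> nat) : fp y -> fp g -> fp i ->
  fp (fun x => refs_value (T x) (y x) (g x) (i x)).
Proof.
move=> Hy Hg Hi; rewrite /refs_value /table_value; apply: fp_sumo => //.
apply: fp_map; last by fpa.
by apply: (fp_minterm (p := fun q : X * seq bool => p q.1) (K := fun q : X * seq bool => K q.1)); fpa.
Qed.
End FpSummand2.

Section FpSummand3.
Context {X : Type} {eX : encT X} (p K : X -> nat).
Hypotheses (Hp : fp p) (HK : fp K).
Local Notation T x := (trunc_ops (p x).+1 (K x)).

Lemma fp_gate_check (y : X -> seq (seq nat)) (g : X -> gateT) (i : X -> nat) : fp y -> fp g -> fp i ->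
  fp (fun x => gate_check (T x) (y x) (g x) (i x)).
Proof.
move=> Hy Hg Hi; have R := fp_refs_value Hp HK Hy Hg Hi; rewrite /gate_check.
apply: fp_tadd => //; apply: fp_tmul => //; first by fpa.
  by fpa.
by apply: fp_tneg.
Qed.
End FpSummand3.

Lemma fp_summand X {eX : encT X} (p K n0 : X -> nat) (C : X -> seq gateT) (w y : X -> seq (seq nat)) :
  fp p -> fp K -> fp n0 -> fp C -> fp w -> fp y ->
  fp (fun x => summand (trunc_ops (p x).+1 (K x)) (n0 x) (C x) (w x) (y x)).
Proof.
move=> Hp HK Hn HC Hw Hy; rewrite /summand /consistent /weight.
apply: fp_tmul => //; last by fpa.
apply: fp_tmul => //; last by fpa.
apply: fp_prodo => //; apply: fp_map; last by fpa.
by apply: (fp_gate_check (p := fun q : X * nat => p q.1) (K := fun q : X * nat => K q.1)); fpa.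
Qed.

(** A tag and two arguments: an encodable copy of [gate]. *)
Definition rawgate := (nat * (nat * nat))%type.

Definition gate_of (t : rawgate) : gate :=
  if t.1 == 0 then GInput t.2.1 else if t.1 == 1 then GConst (0 < t.2.1) else
  if t.1 == 2 then GNot t.2.1 else if t.1 == 3 then GAnd t.2.1 t.2.2 else GOr t.2.1 t.2.2.
Definition raw_of (g : gate) : rawgate :=
  match g with
  | GInput i => (0, (i, 0)) | GConst b => (1, (nat_of_bool b, 0)) | GNot i => (2, (i, 0))
  | GAnd i j => (3, (i, j)) | GOr i j => (4, (i, j))
  end.
Definition circ_of (C : seq rawgate) : circuit := [seq gate_of t | t <- C].
Definition raw_circ (C : circuit) := [seq raw_of g | g <- C].

Lemma raw_circK : cancel raw_circ circ_of.
Proof. by elim=> //= g C; rewrite /circ_of /raw_circ => ->; case: g => [i|[]|i|i j|i j]. Qed.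

Definition raw_val (x vals : seq bool) (t : rawgate) : bool :=
  if t.1 == 0 then nth false x t.2.1 else if t.1 == 1 then 0 < t.2.1 else
  if t.1 == 2 then ~~ nth false vals t.2.1 else
  if t.1 == 3 then nth false vals t.2.1 && nth false vals t.2.2 else
  nth false vals t.2.1 || nth false vals t.2.2.

Lemma raw_valE x vals t : gate_val x vals (gate_of t) = raw_val x vals t.
Proof. by rewrite /raw_val /gate_of; do 4!case: ifP => // _. Qed.

Lemma fp_circuit_eval X {eX : encT X} (C : X -> seq rawgate) (v : X -> seq bool) :
  fp C -> fp v -> fp (fun x => circuit_eval (circ_of (C x)) (v x)).
Proof.
move=> HC Hv; have [g [Pg _ Lg]] := fp_size HC.
have E x : circuit_eval (circ_of (C x)) (v x) =
    last false (foldl (fun vals t => rcons vals (raw_val (v x) vals t)) [::] (C x)).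
  rewrite /circuit_eval /circ_of; congr last; elim: (C x) [::] => //= t l IH vals.
  by rewrite raw_valE IH.
apply: (@fp_ext _ _ _ _ (fun x => last false (foldl (fun vals t => rcons vals (raw_val (v x) vals t)) [::] (C x)))) => //.
apply: fp_last; first by fpa.
apply: (@fp_foldl _ _ _ _ _ _ (fun x vals t => rcons vals (raw_val (v x) vals t)) _ _ (fun k => 3 * g k)) => //.
- by rewrite /raw_val; fpa.
- by fpa.
- by polyb.
move=> x i Hi; apply: leq_trans (@esz_leq _ _ _ 1 _) _ => //.
have -> : size (foldl (fun vals t => rcons vals (raw_val (v x) vals t)) [::] (take i (C x))) = size (take i (C x)).
  by elim/last_ind: (take _ _) => // u t IH; rewrite -cats1 foldl_cat /= size_rcons IH size_cat addn1.
by rewrite mulnC leq_mul2l /= (leq_trans _ (Lg x)) // (leq_trans _ (size_esz _)) // size_take_min geq_minr.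
Qed.

Definition raw_list := seq (bitstring * seq rawgate).
Definition circ_list (D : raw_list) : seq (bitstring * circuit) := [seq (q.1, circ_of q.2) | q <- D].

Lemma nth_circ_list D f : nth ([::], [::]) (circ_list D) f =
  ((nth ([::], [::]) D f).1, circ_of (nth ([::], [::]) D f).2).
Proof.
case: (ltnP f (size D)) => L; first by rewrite (nth_map ([::], [::])).
by rewrite !nth_default ?size_map.
Qed.

Definition raw_copy_of (pre : seq bool) off adr n (t : rawgate) : gateT :=
  if t.1 == 0 then
    (if t.2.1 < size pre then ([::], if nth false pre t.2.1 then [:: [::]] else [::])
     else if t.2.1 - size pre < n then ([:: adr + (t.2.1 - size pre)], [:: [:: true]])
     else ([::], [::]))
  else if t.1 == 1 then ([::], if 0 < t.2.1 then [:: [::]] else [::])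
  else if t.1 == 2 then ([:: off + t.2.1], [:: [:: false]])
  else if t.1 == 3 then ([:: off + t.2.1; off + t.2.2], [:: [:: true; true]])
  else ([:: off + t.2.1; off + t.2.2], [:: [:: true; true]; [:: true; false]; [:: false; true]]).

Lemma raw_copy_ofE pre off adr n t : copy_of pre off adr n (gate_of t) = raw_copy_of pre off adr n t.
Proof. by rewrite /raw_copy_of /gate_of; do 4!case: ifP => // _. Qed.

Lemma circ_copyE' q off adr n : circ_copy (q.1, circ_of q.2) off adr n =
  rcons [seq raw_copy_of q.1 off adr n t | t <- q.2]
    (if nilp q.2 then ([::], [::]) else ([:: off + (size q.2).-1], [:: [:: true]])).
Proof.
rewrite /circ_copy /circ_of /= size_map -map_comp /nilp size_map; congr rcons.
by apply: eq_map => t; rewrite /= raw_copy_ofE.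
Qed.

Definition offset (L : raw_list) off i := off + sumn [seq (size q.2).+1 | q <- take i L].

(** With the offset of each copy written as a sum of earlier sizes, the circuit becomes a [map], for
    which no bound on intermediate results has to be supplied. *)
Lemma list_circ_flat (L : raw_list) off adr n : list_circ (circ_list L) off adr n =
  (flatten [seq circ_copy ((nth ([::], [::]) L i).1, circ_of (nth ([::], [::]) L i).2) (offset L off i) adr n
           | i <- iota 0 (size L)],
   ([seq offset L off i + size (nth ([::], [::]) L i).2 | i <- iota 0 (size L)], offset L off (size L))).
Proof.
elim/last_ind: L => [|L q IH]; first by rewrite /offset /= addn0.
rewrite /list_circ /circ_list map_rcons -cats1 foldl_cat -/(circ_list L) -/(list_circ _ _ _ _) IH /=.
have O i : i <= size L -> offset (rcons L q) off i = offset L off i.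
  by move=> Hi; rewrite /offset -cats1 takel_cat.
rewrite size_rcons -[(size L).+1]addn1 iotaD !map_cat flatten_cat /= add0n cats0 cats1.
rewrite /list_step /= !nth_rcons ltnn eqxx O // size_map; congr (_ ++ _, (rcons _ _, _)).
- congr flatten; apply/eq_in_map => i; rewrite mem_iota => /= Hi.
  by rewrite nth_rcons Hi O // ltnW.
- apply/eq_in_map => i; rewrite mem_iota => /= Hi; by rewrite nth_rcons Hi O // ltnW.
- by rewrite /offset take_size -cats1 take_oversize ?size_cat // map_cat sumn_cat /= addn0 -addnA addn1 addnA.
Qed.

Section FpViolCirc.
Context {X : Type} {eX : encT X}.

Lemma fp_offset (L : X -> raw_list) (off i : X -> nat) : fp L -> fp off -> fp i ->
  fp (fun x => offset (L x) (off x) (i x)).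
Proof. by move=> HL Ho Hi; rewrite /offset; fpa. Qed.

Lemma fp_auto_col (base a b i : X -> nat) : fp base -> fp a -> fp b -> fp i ->
  fp (fun x => auto_col (base x) (a x) (b x) (i x)).
Proof. by move=> H1 H2 H3 H4; rewrite /auto_col /= /auto_gate; fpa. Qed.
End FpViolCirc.

Lemma fp_auto_circ X {eX : encT X} (l base a b : X -> nat) : fp l -> fp base -> fp a -> fp b ->
  fp (fun x => auto_circ (l x) (base x) (a x) (b x)).
Proof.
move=> H1 H2 H3 H4; rewrite /auto_circ; apply: fp_cat; first exact: fp_const.
apply: fp_flatten; apply: fp_map; last by fpa.
by apply: fp_auto_col; fpa.
Qed.

Lemma fp_circ_copy X {eX : encT X} (q : X -> seq bool * seq rawgate) (off adr n : X -> nat) :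
  fp q -> fp off -> fp adr -> fp n ->
  fp (fun x => circ_copy ((q x).1, circ_of (q x).2) (off x) (adr x) (n x)).
Proof.
move=> Hq Ho Ha Hn; apply: fp_ext; last by move=> x; rewrite circ_copyE'.
by rewrite /raw_copy_of; fpa.
Qed.

Section FpListCirc.
Context {X : Type} {eX : encT X} (L : X -> raw_list) (off adr n : X -> nat).
Hypotheses (HL : fp L) (Ho : fp off) (Ha : fp adr) (Hn : fp n).

Lemma fp_list_circ : fp (fun x => list_circ (circ_list (L x)) (off x) (adr x) (n x)).
Proof.
apply: fp_ext; last by move=> x; rewrite list_circ_flat.
apply: fp_pair; last first.
  apply: fp_pair; last by apply: fp_offset; fpa.
  by apply: fp_map; [apply: fp_add; [apply: fp_offset|]|]; fpa.
apply: fp_flatten; apply: fp_map; last by fpa.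
by apply: (fp_circ_copy (q := fun y : X * nat => nth ([::], [::]) (L y.1) y.2)); [| apply: fp_offset | |]; fpa.
Qed.
End FpListCirc.

Lemma fp_viol_circ X {eX : encT X} (s : X -> sysT) (l : X -> nat) (D : X -> raw_list) :
  fp s -> fp l -> fp D -> fp (fun x => viol_circ (s x) (l x) (circ_list (D x))).
Proof.
move=> Hs Hl HD.
pose L x : raw_list := [seq nth ([::], [::]) (D x) f | f <- iota 0 (s x).1].
have HL : fp L by rewrite /L; fpa.
have EL x : [seq nth ([::], [::]) (circ_list (D x)) f | f <- iota 0 (s x).1] = circ_list (L x).
  by rewrite /circ_list /L -map_comp; apply: eq_map => f; rewrite /= -/(circ_list _) nth_circ_list.
rewrite /viol_circ; apply: fp_ext; last by move=> x; rewrite EL.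
set R1 := fun x => list_circ (circ_list (L x)) (4 * l x + 4 * l x + 4 + 4 * l x + 4) 0 (l x + l x).
have H1 : fp R1 by rewrite /R1; apply: fp_list_circ; fpa.
set R2 := fun x => list_circ (circ_list (L x)) (R1 x).2.2 (l x + l x) (l x + l x).
have H2 : fp R2 by rewrite /R2; apply: fp_list_circ; fpa.
have A1 : fp (fun x => auto_circ (l x) (4 * l x) 0 (l x + l x)) by apply: fp_auto_circ; fpa.
have A2 : fp (fun x => auto_circ (l x) (4 * l x + 4 * l x + 4) (l x) (l x + l x + l x)) by apply: fp_auto_circ; fpa.
apply: (@fp_ext _ _ _ _ (fun x => rcons (auto_circ (l x) (4 * l x) 0 (l x + l x) ++
   auto_circ (l x) (4 * l x + 4 * l x + 4) (l x) (l x + l x + l x) ++ (R1 x).1 ++ (R2 x).1)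
   (iota (4 * l x + 4 * l x) 4 ++ iota (4 * l x + 4 * l x + 4 + 4 * l x) 4 ++ (R1 x).2.1 ++ (R2 x).2.1, (s x).2))) => //.
apply: fp_rcons; last by fpa.
by apply: fp_cat => //; apply: fp_cat => //; fpa.
Qed.

(** * Acceptance of a block *)

(* (((s, l), (D, D')), (b, p - 1)): a system, its size, circuits for an
   assignment, circuits for the prover (indexed by the input length), the number
   of bits of a challenge, and the modulus. *)
Definition headerT := (((sysT * nat) * (raw_list * seq (seq rawgate))) * (nat * nat))%type.

Definition hd_sys (h : headerT) : sysT := h.1.1.1.
Definition hd_len (h : headerT) : nat := h.1.1.2.
Definition hd_asg (h : headerT) : raw_list := h.1.2.1.
Definition hd_prv (h : headerT) : seq (seq rawgate) := h.1.2.2.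
Definition hd_bits (h : headerT) : nat := h.2.1.
Definition hd_mod (h : headerT) : nat := h.2.2.

Definition hd_circ (h : headerT) : seq gateT := viol_circ (hd_sys h) (hd_len h) (circ_list (hd_asg h)).
Definition hd_vars h := 4 * hd_len h + size (hd_circ h).
Definition hd_deg h := (degree_bound (4 * hd_len h) (hd_circ h)).+1.
Definition block_size h := hd_vars h * hd_bits h + hd_vars h * hd_bits h.

Definition queryT := ((nat * (seq gateT * nat)) * ((seq nat * seq nat) * (nat * nat)))%type.

(** Asking only whether coefficient e of the honest message is the residue c turns the prover into a
    language, to which circuits for E apply. *)
Definition query_value (q : queryT) : bool :=
  let: ((n0, (C, m)), ((w, pre), (e, c))) := q in
  nth 0 (round_residues m.+1 (degree_bound n0 C).+1 n0 C w pre (n0 + size C - size pre).-1) e == c.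

Definition prover_query (n0 : nat) (C : seq gateT) (m : nat) (w pre : seq nat) (e c : nat) : bitstring :=
  enc (((n0, (C, m)), ((w, pre), (e, c))) : queryT).

Definition lookup (D : seq (seq rawgate)) (y : bitstring) :=
  circuit_eval (circ_of (nth [::] D (size y))) y.

(** The residue is found by trying all of them, the modulus being in unary. If every answer is
    negative, [find] returns the modulus itself; soundness does not suffer, as it allows any
    strategy of bounded degree. *)
Definition coefs h (C : seq gateT) d (w pre : seq nat) : seq nat :=
  [seq find (fun c => lookup (hd_prv h) (prover_query (4 * hd_len h) C (hd_mod h) w pre e c))
            (iota 0 (hd_mod h).+1) | e <- iota 0 d].

Definition nchunks m b n (y : bitstring) : seq nat :=
  [seq cval_cap m (take b (drop (i * b) y)) | i <- iota 0 n].

Definition accept_with h (C : seq gateT) d (N : nat) (y : bitstring) :=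
  residue_verify (hd_mod h).+1 (4 * hd_len h) C
    (coefs h C d (nchunks (hd_mod h) (hd_bits h) N y)) (nchunks (hd_mod h) (hd_bits h) N y)
    (nchunks (hd_mod h) (hd_bits h) N (drop (N * hd_bits h) y)).

Definition accept h y := accept_with h (hd_circ h) (hd_deg h) (hd_vars h) y.

Section Accept.
Variable h : headerT.
Local Notation p := (hd_mod h).+1.
Local Notation b := (hd_bits h).
Local Notation C := (hd_circ h).
Local Notation N := (hd_vars h).
Local Notation n0 := (4 * hd_len h).
Hypothesis pp : prime p.
Hypothesis pb : 2 ^ b <= p.
Hypothesis Us : uniq (hd_sys h).2.
Hypothesis Ws : all (fun w => size w == 8 + (hd_sys h).1 + (hd_sys h).1) (hd_sys h).2.

Definition cval (w : bitstring) : 'F_p := (bval w)%:R%R.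

Lemma cval_resid w : size w <= b -> resid (cval w) = cval_cap (hd_mod h) w.
Proof.
move=> L; have B : 2 ^ size w <= p by apply: leq_trans pb; rewrite leq_exp2l.
by rewrite cval_capE // resid_small // (leq_trans (bval_lt w)).
Qed.

Lemma cval_inj : {in words b &, injective cval}.
Proof.
move=> u v; rewrite !mem_words => /eqP Su /eqP Sv /(congr1 (@resid p)).
rewrite !cval_resid ?Su ?Sv // !cval_capE ?Su ?Sv // => E.
by rewrite -[u]bits_bval -[v]bits_bval E Su Sv.
Qed.

Lemma nchunksE n y : nchunks (hd_mod h) b n y = [seq resid c | c <- chunks b cval n y].
Proof.
elim: n y => // n IH y /=; rewrite cval_resid ?size_take_min ?geq_minl // -IH /nchunks.
rewrite -[n.+1]add1n iotaD /= mul0n drop0; congr (_ :: _).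
rewrite add0n (iotaDl 1 0) -map_comp; apply: eq_map => i /=.
by rewrite drop_drop mulnDl mul1n addnC.
Qed.

Definition strategy (w pre : seq 'F_p) : {poly 'F_p} :=
  poly_of p (coefs h C (hd_deg h) [seq resid c | c <- w] [seq resid c | c <- pre]).

Lemma acceptE y : accept h y = accepts b cval n0 C strategy y.
Proof. by rewrite /accept /accept_with !nchunksE residue_verifyE. Qed.

Lemma hd_circ_wf : all gwf C.
Proof. exact: viol_circ_wf. Qed.

Lemma accept_sound x : size x = n0 -> last false (wires x C) ->
  2 * N * hd_deg h <= 2 ^ b ->
  count (accept h) (words (block_size h)) * 2 <= 2 ^ block_size h.
Proof.
move=> Sx Hx Hb; rewrite (eq_count acceptE).
apply: (@accepts_sound _ _ _ cval_inj _ _ hd_circ_wf strategy x) => //.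
move=> w pre; rewrite /strategy /poly_of; apply: leq_trans (size_Poly _) _.
by rewrite !size_map size_iota.
Qed.

Lemma accept_complete y :
  (forall x, size x = n0 -> ~~ last false (wires x C)) ->
  (forall w pre e c, size w = N -> all (fun a => a < p) w -> size pre < N -> all (fun a => a < p) pre ->
     e < hd_deg h -> c < p ->
     lookup (hd_prv h) (prover_query n0 C (hd_mod h) w pre e c) =
     query_value ((n0, (C, hd_mod h)), ((w, pre), (e, c)))) ->
  accept h y.
Proof.
move=> Hx Hq; rewrite acceptE; apply: accepts_complete => //; first exact: hd_circ_wf.
move=> w pre Sw Sp.
have d1 : 1 < hd_deg h by rewrite /hd_deg /degree_bound.
set R := round_poly _ _ _.
have SR : size R <= hd_deg h.
  apply: leq_trans (@round_poly_size _ (summand_poly n0 C w) (degree_bound n0 C) _ _ _) _ => //.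
  by move=> ys; apply: summand_poly_size; exact: hd_circ_wf.
rewrite -[RHS](poly_ofK SR); congr poly_of; apply/eq_in_map => e; rewrite mem_iota add0n => /andP[_ He].
have lt (l : seq 'F_p) : all (fun a => a < p) [seq resid c | c <- l].
  by rewrite all_map; apply/allP => c _; apply: resid_lt.
have K c : c < p -> lookup (hd_prv h) (prover_query n0 C (hd_mod h) [seq resid c0 | c0 <- w] [seq resid c0 | c0 <- pre] e c)
   = (resid (R`_e)%R == c).
  move=> Hc; rewrite Hq ?size_map // /query_value size_map round_residuesE //.
  by rewrite nth_trunc.
have Lr := resid_lt pp (R`_e)%R.
set k := resid _ in Lr K *.
have F : find (fun c => c == k) (iota 0 p) = k by rewrite -/(index k (iota 0 p)) -{1}[k]add0n -{1}(nth_iota 0 0 Lr) index_uniq ?iota_uniq ?size_iota.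
rewrite -[RHS]F; apply: eq_in_find => c; rewrite mem_iota add0n => /andP[_ Hc].
by rewrite K // eq_sym.
Qed.

End Accept.

Lemma hd_circ_sat h : (exists2 x, size x = 4 * hd_len h & last false (wires x (hd_circ h))) <->
  ~ holds (hd_sys h) (hd_len h) (dl_assignment (circ_list (hd_asg h))).
Proof.
set l := hd_len h; split=> [[x Sx Hx] H|].
  pose g i := take l (drop (i * l) x).
  have Sg i : i < 4 -> size (g i) = l.
    by move=> L; rewrite size_takel // size_drop Sx; case: i L => [|[|[|[|]]]]; rewrite // ?mul0n /l; lia.
  have E : x = g 0 ++ g 1 ++ g 2 ++ g 3.
    have D i : drop (i * l) x = g i ++ drop (i.+1 * l) x by rewrite mulSn -drop_drop cat_take_drop.
    have := D 0; rewrite mul0n drop0 (D 1) (D 2) (D 3) => {1}->.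
    by rewrite [drop (4 * l) x]drop_oversize ?cats0 // Sx.
  have := H (g 0) (g 1) (g 2) (g 3); rewrite -(@viol_circE _ l) ?Sg // -E => N.
  by have := N erefl erefl erefl erefl; rewrite -/(hd_circ h) Hx.
move=> H; apply: contrapT => N; apply: H => t q t' q' St Sq St' Sq'.
rewrite -(@viol_circE _ l) //; apply/negP => V; apply: N; exists (t ++ q ++ t' ++ q') => //.
by rewrite !size_cat St Sq St' Sq' /l; lia.
Qed.

Section FpAccept.
Context {X : Type} {eX : encT X} (h : X -> headerT).
Hypothesis Hh : fp h.

Lemma fp_hd_circ : fp (fun x => hd_circ (h x)).
Proof. by rewrite /hd_circ /hd_sys /hd_len /hd_asg; apply: fp_viol_circ; fpa. Qed.

Lemma fp_hd_vars : fp (fun x => hd_vars (h x)).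
Proof. by have H := fp_hd_circ; rewrite /hd_vars /hd_len; fpa. Qed.

Lemma fp_hd_deg : fp (fun x => hd_deg (h x)).
Proof. by have H := fp_hd_circ; rewrite /hd_deg /degree_bound /hd_len; fpa. Qed.

Lemma fp_block_size : fp (fun x => block_size (h x)).
Proof. by have H := fp_hd_vars; rewrite /block_size /hd_bits; fpa. Qed.
End FpAccept.

Lemma fp_lookup X {eX : encT X} (D : X -> seq (seq rawgate)) (y : X -> seq bool) :
  fp D -> fp y -> fp (fun x => lookup (D x) (y x)).
Proof. by move=> HD Hy; rewrite /lookup; apply: fp_circuit_eval; fpa. Qed.

(* Queries are raw strings, which enc does not encode as lists of bits. *)
Lemma fp_raw_lookup X {eX : encT X} (D : X -> seq (seq rawgate)) (y : X -> str) :
  fp D -> fp y -> fp (fun x => lookup (D x) (unstr (y x))).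
Proof. by move=> HD Hy; apply: fp_lookup; fpa. Qed.

Lemma fp_coefs X {eX : encT X} (h : X -> headerT) (C : X -> seq gateT) (d : X -> nat) (w pre : X -> seq nat) :
  fp h -> fp C -> fp d -> fp w -> fp pre -> fp (fun x => coefs (h x) (C x) (d x) (w x) (pre x)).
Proof.
move=> Hh HC Hd Hw Hp; rewrite /coefs /hd_len /hd_mod /hd_prv; apply: fp_map; last by fpa.
apply: fp_find; last by fpa.
rewrite /prover_query; apply: (fp_raw_lookup
  (y := fun q : X * nat * nat => Str (enc (((4 * (h q.1.1).1.1.2, (C q.1.1, (h q.1.1).2.2)), ((w q.1.1, pre q.1.1), (q.1.2, q.2))) : queryT)))).
  by fpa.
by fpa.
Qed.

Lemma fp_nchunks X {eX : encT X} (m b n : X -> nat) (y : X -> seq bool) :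
  fp m -> fp b -> fp n -> fp y -> fp (fun x => nchunks (m x) (b x) (n x) (y x)).
Proof. by move=> *; rewrite /nchunks; fpa. Qed.

Lemma fp_residues_eval X {eX : encT X} (p r : X -> nat) (q : X -> seq nat) :
  fp p -> fp r -> fp q -> fp (fun x => residues_eval (p x).+1 (q x) (r x)).
Proof.
move=> Hp Hr Hq; have [g [Pg _ Lg]] := fp_size Hp; rewrite /residues_eval.
apply: (@fp_foldl _ _ _ _ _ _ (fun x acc a => (a + r x * acc) %% (p x).+1) _ _ g) => //.
- by fpa.
- by fpa.
- by fpa.
move=> x i _; apply: leq_trans (Lg x); rewrite !esz_nat.
elim/last_ind: (take _ _) => // u e _; rewrite -cats1 foldl_cat [foldl _ _ [:: e]]/=.
by rewrite -ltnS ltn_mod.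
Qed.

Lemma fp_residue_verify X {eX : encT X} (m n0 d : X -> nat) (h : X -> headerT) (C : X -> seq gateT)
    (w rho : X -> seq nat) : fp m -> fp n0 -> fp d -> fp h -> fp C -> fp w -> fp rho ->
  fp (fun x => residue_verify (m x).+1 (n0 x) (C x) (coefs (h x) (C x) (d x) (w x)) (w x) (rho x)).
Proof.
move=> Hm Hn Hd Hh HC Hw Hr; rewrite /residue_verify.
pose st x := foldl (residue_step (m x).+1 (coefs (h x) (C x) (d x) (w x))) (0, [::], true) (rho x).
pose F x (s : nat * seq nat * bool) r := residue_step (m x).+1 (coefs (h x) (C x) (d x) (w x)) s r.
have HF : fp (fun q : X * (nat * seq nat * bool * nat) => F q.1 q.2.1 q.2.2).
  rewrite /F /residue_step.
  have Hq : fp (fun q : X * (nat * seq nat * bool * nat) => coefs (h q.1) (C q.1) (d q.1) (w q.1) q.2.1.1.2).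
    by apply: fp_coefs; fpa.
  apply: fp_pair; first apply: fp_pair.
  - by apply: fp_residues_eval; fpa.
  - by fpa.
  apply: fp_and; first by fpa.
  apply: fp_eq; last by fpa.
  by apply: fp_modn; [apply: fp_add; apply: fp_residues_eval|]; fpa.
have Hst : fp st.
  have [g [Pg _ Lg]] := fp_size Hm; have [k [Pk _ Lk]] := fp_size Hr.
  apply: (@fp_foldl _ _ _ _ _ _ F _ _ (fun z => 2 * (2 * g z + 1 + k z) + 1 + 1)) => //.
  - by fpa.
  - by polyb.
  move=> x i Hi; have := Lg x; have := Lk x; rewrite esz_nat => L1 L2.
  rewrite !esz_pair esz_bool esz_nat.
  have [A ->] : (foldl (F x) (0, [::], true) (take i (rho x))).1.1 <= m x /\
      (foldl (F x) (0, [::], true) (take i (rho x))).1.2 = take i (rho x).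
    elim/last_ind: (take _ _) => // u e [_ E2]; rewrite -cats1 foldl_cat; split; last first.
      by rewrite [foldl _ _ [:: e]]/= /F /residue_step /= -/(F x) E2 cats1.
    rewrite [foldl _ _ [:: e]]/= {1}/F /residue_step [X in X <= _]/=.
    rewrite /residues_eval -[coefs _ _ _ _ _]revK revK; set cs := rev _.
    elim/last_ind: cs => // cs a _; rewrite -cats1 foldl_cat [foldl _ _ [:: a]]/=.
    by rewrite -ltnS ltn_mod.
  have := @esz_take _ enc_nat i (rho x); move: (esz _) (foldl _ _ _).1.1 A => u v; lia.
apply: fp_and; first by rewrite -/(st _); fpa.
apply: fp_eq; first by fpa.
apply: fp_summand; by fpa.
Qed.

Lemma fp_accept X {eX : encT X} (h : X -> headerT) (y : X -> seq bool) :
  fp h -> fp y -> fp (fun x => accept (h x) (y x)).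
Proof.
move=> Hh Hy; rewrite /accept /accept_with.
have HC := fp_hd_circ Hh; have Hd := fp_hd_deg Hh; have HN := fp_hd_vars Hh.
have Hm : fp (fun x => hd_mod (h x)) by rewrite /hd_mod; fpa.
have Hb : fp (fun x => hd_bits (h x)) by rewrite /hd_bits; fpa.
have Hl : fp (fun x => 4 * hd_len (h x)) by rewrite /hd_len; fpa.
apply: fp_residue_verify => //; apply: fp_nchunks => //.
by apply: fp_drop => //; apply: fp_mul.
Qed.

(** The honest message sums over all 0-1 values of the remaining variables, hence the padding. *)
Lemma fp_query_value X {eX : encT X} (q : X -> queryT) (pad : X -> nat) : fp q -> fp pad ->
  (forall x, 2 ^ ((q x).1.1 + size (q x).1.2.1 - size (q x).2.1.2).-1 <= pad x) ->
  fp (fun x => query_value (q x)).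
Proof.
move=> Hq Hp L.
have HW := fp_words (k := fun x => ((q x).1.1 + size (q x).1.2.1 - size (q x).2.1.2).-1) _ Hp L.
pose wd x := words ((q x).1.1 + size (q x).1.2.1 - size (q x).2.1.2).-1.
have {}HW : fp wd by apply: HW; fpa.
pose dg x := (degree_bound (q x).1.1 (q x).1.2.1).+1.
have Hd : fp dg by rewrite /dg /degree_bound; fpa.
apply: (@fp_ext _ _ _ _ (fun x => nth 0 (sumo (trunc_ops (q x).1.2.2.+1 (dg x))
   [seq summand (trunc_ops (q x).1.2.2.+1 (dg x)) (q x).1.1 (q x).1.2.1
     [seq const_residues (dg x) c | c <- (q x).2.1.1]
    ([seq const_residues (dg x) c | c <- (q x).2.1.2] ++
     var_residues (dg x) :: [seq const_residues (dg x) (nat_of_bool b) | b <- z]) | z <- wd x]) (q x).2.2.1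
   == (q x).2.2.2)); last by move=> x; rewrite /wd /dg; case: (q x) => [[n0 [C m]] [[w pre] [e c]]].
rewrite /const_residues /var_residues.
apply: fp_eq; last by fpa.
apply: fp_nth; [by fpa| |by fpa].
apply: fp_sumo; [by fpa|by fpa|].
apply: fp_map; last by fpa.
apply: (fp_summand (p := fun z : X * seq bool => (q z.1).1.2.2) (K := fun z : X * seq bool => dg z.1)); by fpa.
Qed.

(** * Exponential time with padding, and the generator *)

(** The number 2^k(n) is produced in unary by doubling k(n) times; what follows is polynomial in the
    padded input. The identity for k yields E, and [cap] yields the bound on the generator. *)
Lemma padded_computable (f : bitstring -> bitstring) (k : nat -> nat) (g : str * nat -> str) :
  fp (fun s : str => k (esz s)) -> fp g -> (forall u, unstr (g (Str u, 2 ^ k (size u))) = f u) ->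
  exists c, computable_in (fun t => forall n, t n <= (2 ^ k n + n + 2) ^ c) f.
Proof.
move=> Hk Hg E.
have [G1 P1 E1] : fp (fun s : str => (k (esz s), 1)) by apply: fp_pair; fpa.
have [G2 P2 E2] : fp (fun n : nat => n + n) by fpa.
have [G3 P3 E3] := Hg.
have {}P1 : polyF (fun=> True) G1.
  by case: P1 => T [t [Pt HT Ht]]; exists T, t; split=> // x _; apply: Ht; exists (Str x).
have [s1 [Ps1 Ms1 Ls1]] := polyF_size P1.
case: P1 => T1 [t1 [Pt1 HT1 Ht1]]; case: P2 => T2 [t2 [/polyb_mono[t2' [Pt2 Mt2 Lt2]] HT2 Ht2]].
case: P3 => T3 [t3 [/polyb_mono[t3' [Pt3 Mt3 Lt3]] HT3 Ht3]].
have It u i : iter i G2 (psnd (G1 u)) = enc (2 ^ i).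
  rewrite -[u]/(unstr (Str u)) (E1 (Str u)) [enc _]/(pair_code _ _) psnd_pair; elim: i => // i IH.
  by rewrite iterS IH E2 expnS mul2n addnn.
have S1 u : size (pfst (G1 u)) = k (size u).
  by rewrite -[u]/(unstr (Str u)) (E1 (Str u)) [enc _]/(pair_code _ _) pfst_pair size_nseq.
have P u : itr G2 (G1 u) = enc (2 ^ k (size u)) by rewrite /itr It S1.
have F u : G3 (pair_code u (itr G2 (G1 u))) = f u.
  by rewrite P -E; exact: E3 (Str u, 2 ^ k (size u)).
have HT := timed_comp (timed_pair timed_id (timed_comp HT1 (timed_itr HT2))) HT3.
pose T x := 40 * (size x + size x + size (itr G2 (G1 x)) + 1) + 1 +
  (T1 x + (40 * (size (G1 x) + 1) + \sum_(i < size (pfst (G1 x))) (T2 (iter i G2 (psnd (G1 x))) + 3) +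
   10 * size (itr G2 (G1 x)))) + T3 (pair_code x (itr G2 (G1 x))).
have {}HT : timed (fun x => G3 (pair_code (id x) (itr G2 (G1 x)))) T := HT.
have -> : f = (fun x => G3 (pair_code (id x) (itr G2 (G1 x)))) by apply: funext => u; rewrite F.
have [t1' [Pt1' Mt1 Lt1]] := polyb_mono Pt1.
have [r [Pr Lr]] : exists r, polyb r /\ forall z, t3' (3 * z + 1) <= r z.
  by exists (fun z => t3' (3 * z + 1)); split=> //; apply: (polyb_comp Pt3); polyb.
have [c0 Hq] : polyb (fun z => 40 * (z + z + z + 1) + 1 +
    (t1' z + (40 * (s1 z + 1) + z * (t2' z + 3) + 10 * z)) + r z) by polyb.
have [c Hc] : polyb (fun z => 2 * ((z + 2) ^ c0 + 20 * (z + (z + (z + 2) ^ c0)) + 20)) by polyb.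
have B u : T u <= (2 ^ k (size u) + size u + 2 + 2) ^ c0.
  set z := 2 ^ k (size u) + size u + 2; apply: leq_trans (Hq z); rewrite /T.
  have Lu : size u <= z by rewrite /z; lia.
  have Lk : k (size u) <= z by apply: leq_trans (ltnW (ltn_expl _ (isT : 1 < 2))) _; rewrite /z; lia.
  have Sp : size (itr G2 (G1 u)) <= z by rewrite P [enc _]/(nseq _ _) size_nseq /z; lia.
  apply: leq_add; first apply: leq_add; first apply: leq_add => //.
  - by rewrite leq_mul2l /=; lia.
  - apply: leq_add; first by apply: leq_trans (Ht1 u I) _; apply: leq_trans (Lt1 _) (Mt1 _ _ Lu).
    apply: leq_add; last by rewrite leq_mul2l Sp.
    apply: leq_add; first by rewrite leq_mul2l /= leq_add2r (leq_trans (Ls1 u I)) // Ms1.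
    rewrite S1; apply: (@leq_trans (\sum_(i < k (size u)) (t2' z + 3))); last first.
      by rewrite sum_nat_const card_ord leq_mul2r Lk orbT.
    apply: leq_sum => i _; rewrite leq_add2r It; apply: leq_trans (Ht2 _ _) _; first by exists (2 ^ i).
    apply: leq_trans (Lt2 _) (Mt2 _ _ _); rewrite [enc _]/(nseq _ _) size_nseq.
    have : 2 ^ i <= 2 ^ k (size u) by rewrite leq_exp2l // ltnW.
    by rewrite /z; lia.
  apply: leq_trans (Ht3 _ _) _; first by exists (Str u, 2 ^ k (size u)); rewrite P.
  by apply: leq_trans (Lr z); apply: leq_trans (Lt3 _) (Mt3 _ _ _); rewrite size_pair_code; lia.
have [M HM] := timed_machine HT; exists (2 * c), M; eexists; split; last exact: HM.
move=> n; set z := 2 ^ k n + n + 2.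
have Z : 2 < z by have := expn_gt0 2 (k n); rewrite /z; lia.
apply: (@leq_trans ((z + 2) ^ c)); last by rewrite expnM leq_pow // -mulnn; nia.
apply: leq_trans (Hc z); apply/bigmax_leqP => x _.
have := B x; have := timed_size x HT; rewrite size_tuple -/z.
have Ln : n <= z by rewrite /z; lia.
by move: (T x) (size _) => a b; lia.
Qed.

Definition powcap a k N := iter k (fun v => minn (v * a) N) 1.

Lemma powcapE a k N : 0 < N -> powcap a k N = minn (a ^ k) N.
Proof.
move=> N0; rewrite /powcap; elim: k => [|k IH]; first by rewrite /= expn0 /minn; case: ltnP => //; lia.
rewrite iterS IH expnSr; case: (leqP (a ^ k) N) => // L.
case: a L {IH} => [|a] L; first by rewrite !muln0.
by rewrite !(minn_idPr _) // ?leq_pmulr // (leq_trans (ltnW L)) // leq_pmulr.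
Qed.

Lemma fp_powcap X {eX : encT X} (a k N : X -> nat) : fp a -> fp k -> fp N ->
  fp (fun x => powcap (a x) (k x) (N x)).
Proof.
move=> Ha Hk HN; have [g [Pg _ Lg]] := fp_size HN.
apply: (@fp_iter _ _ _ _ _ (fun x v => minn (v * a x) (N x)) _ (fun z => g z + 1)) => //.
- by fpa.
- by fpa.
- by polyb.
move=> x i _; have := Lg x; rewrite !esz_nat => L.
by case: i => [|i]; [rewrite leq_addl|rewrite iterS (leq_trans (geq_minr _ _)) // (leq_trans L) // leq_addr].
Qed.

Lemma trunc_log_count n : trunc_log 2 n = size [seq k <- iota 1 n | powcap 2 k n.+1 <= n].
Proof.
case: n => // n; rewrite size_filter; set L := trunc_log 2 n.+1.
have LL : L <= n.+1 by rewrite /L; apply: leq_trans (ltnW (ltn_expl _ (isT : 1 < 2))) (trunc_logP _ _).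
rewrite (@eq_in_count _ _ (fun k => k <= L)); last first.
  move=> k; rewrite mem_iota => /andP[k0 _]; rewrite powcapE // geq_min ltnn orbF /=.
  apply/idP/idP => H; first exact: trunc_log_max.
  by apply: leq_trans (trunc_logP (isT : 1 < 2) (isT : 0 < n.+1)); rewrite leq_exp2l.
rewrite -(subnKC LL) iotaD count_cat.
rewrite (@eq_in_count _ _ predT); last by move=> k; rewrite mem_iota /=; lia.
rewrite count_predT size_iota (@eq_in_count _ _ pred0); last by move=> k; rewrite mem_iota /=; lia.
by rewrite count_pred0 addn0.
Qed.

Lemma fp_trunc_log X {eX : encT X} (n : X -> nat) : fp n -> fp (fun x => trunc_log 2 (n x)).
Proof.
move=> Hn; apply: fp_ext; last by move=> x; rewrite trunc_log_count.
apply: fp_listsize; apply: fp_filter; last by fpa.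
by apply: fp_leq; [apply: fp_powcap|]; fpa.
Qed.

(* The bound imposed on the length of a block in a string of length n. *)
Definition cap n := minn (trunc_log 2 n ^ trunc_log 2 (trunc_log 2 n)) n.

Lemma fp_cap X {eX : encT X} (n : X -> nat) : fp n -> fp (fun x => cap (n x)).
Proof.
move=> Hn; have H1 := fp_trunc_log Hn; have H2 := fp_trunc_log H1.
apply: (@fp_ext _ _ _ _ (fun x => if n x == 0 then 0 else
  powcap (trunc_log 2 (n x)) (trunc_log 2 (trunc_log 2 (n x))) (n x))).
  by apply: fp_if; [fpa|fpa|apply: fp_powcap].
move=> x; case: eqP => [->|/eqP]; first by rewrite /cap minn0.
by rewrite -lt0n => N0; rewrite powcapE.
Qed.

(** Total: every string describes some header. It is made opaque below so that conversion does not
    unfold the decoder. *)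
Definition header_of (hs : bitstring) : headerT := dec hs.

Lemma header_ofK h : header_of (enc h) = h.
Proof. exact: encK. Qed.

Lemma fp_header_of X {eX : encT X} (s : X -> seq bool) : fp (fun x => Str (s x)) ->
  fp (fun x => header_of (s x)).
Proof. by move=> H; apply: (fp_dec (s := fun x => Str (s x))). Qed.

Section Padded.
Opaque header_of.
#[local] Arguments header_of : simpl never.
#[local] Arguments enc : simpl never.
#[local] Arguments block_size : simpl never.

Section Generator.
Definition good_words (h : headerT) b := [seq y <- words b | accept h y].

(** The first test discards strings that are not codes of pairs, [pfst] and [psnd] being total. The
    bound [b <= cap (size u)] limits the time for listing all b-bit words. *)
Definition gen_guard (u : bitstring) (h : headerT) (hs rest : bitstring) b :=
  [&& pair_code hs rest == u, 0 < b, b <= cap (size u) & (2 * size hs + 2) * b.-1 <= size rest].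

(** The default for indices out of range has length b too, so that lengths never depend on the
    content. *)
Definition decode_block h b rest j : bitstring :=
  nth (nseq b false) (good_words h b) (bval (take b.-1 (drop (j * b.-1) rest))).

(* A string u = self_delim hs ++ rest is decompressed by reading rest as
   B = |self_delim hs| + 1 indices of b - 1 bits in the list of the accepted
   strings of b bits. *)
Definition generator (u : bitstring) : bitstring :=
  let hs := pfst u in let rest := psnd u in let h := header_of hs in
  let b := block_size h in let B := 2 * size hs + 2 in
  if gen_guard u h hs rest b then
    flatten [seq decode_block h b rest j | j <- iota 0 B] ++ drop (B * b.-1) rest
  else false :: u.

Lemma size_good_word h b y : y \in good_words h b -> size y = b.
Proof. by rewrite mem_filter mem_words => /andP[_ /eqP]. Qed.

Lemma size_decode_block h b rest j : size (decode_block h b rest j) = b.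
Proof.
rewrite /decode_block; set i := bval _; case: (ltnP i (size (good_words h b))) => L.
  exact: size_good_word (mem_nth _ L).
by rewrite nth_default ?size_nseq.
Qed.

Lemma size_flatten_const (f : nat -> bitstring) b l : (forall j, size (f j) = b) ->
  size (flatten [seq f j | j <- l]) = size l * b.
Proof. by move=> E; elim: l => //= j l IH; rewrite size_cat IH E mulSn. Qed.

(** The 2|hs| + 1 bits of the self-delimited header disappear while B = 2|hs| + 2 blocks gain one
    bit each. *)
Lemma size_generator u : size (generator u) = size u + 1.
Proof.
rewrite /generator /gen_guard; case: ifP => [/and4P[/eqP E b0 _ L]|_]; last by rewrite addn1.
rewrite size_cat (size_flatten_const _ (size_decode_block _ _ _)) size_iota size_drop.
have := congr1 size E; rewrite size_pair_code.
move: (size u) (size (pfst u)) (size (psnd u)) (block_size _) b0 L => nu hs r b.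
by case: b => // b _ /=; nia.
Qed.

Lemma drop_flatten_const (f : nat -> bitstring) b l j : (forall j, size (f j) = b) ->
  drop (j * b) (flatten [seq f i | i <- l]) = flatten [seq f i | i <- drop j l].
Proof.
move=> E; elim: l j => [|i l IH] [|j] //=; first by rewrite drop0.
by rewrite mulSn -IH -{1}(E i) addnC -drop_drop drop_size_cat.
Qed.

(* An accepted block is one of at most 2^(b - 1) strings, so its index saves one
   bit; the B bits saved pay for the description of h. *)
Lemma generator_hits (h : headerT) (a : bitstring) n :
  let b := block_size h in let B := 2 * size (enc h) + 2 in
  size a = n.+1 -> 0 < b -> b <= cap n -> B * b <= n.+1 ->
  count (accept h) (words b) * 2 <= 2 ^ b ->
  (forall j, j < B -> accept h (take b (drop (j * b) a))) ->
  exists u, generator u = a.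
Proof.
move=> b B Sa b0 bc LB Hc Ha.
pose blk j := take b (drop (j * b) a).
have Sblk j : j < B -> size (blk j) = b.
  by move=> Hj; rewrite size_takel // size_drop Sa; have := leq_mul2r b j.+1 B; rewrite Hj orbT mulSn => H; have := leq_trans H LB; lia.
pose ix j := bits b.-1 (index (blk j) (good_words h b)).
have Six j : size (ix j) = b.-1 by rewrite size_bits.
pose rest := flatten [seq ix j | j <- iota 0 B] ++ drop (B * b) a.
have Sr : size rest = B * b.-1 + (n.+1 - B * b).
  by rewrite size_cat (size_flatten_const _ Six) size_iota size_drop Sa.
exists (pair_code (enc h) rest); rewrite /generator pfst_pair psnd_pair header_ofK -/b -/B.
have Su : size (pair_code (enc h) rest) = n.
  rewrite size_pair_code Sr; move: b0 LB; rewrite /B; move: (size (enc h)) => z.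
  by clearbody b; case: (b) => // c _ /=; nia.
have -> : gen_guard (pair_code (enc h) rest) h (enc h) rest b.
  by rewrite /gen_guard Su; apply/and4P; split; [exact: eqxx | exact: b0 | exact: bc | rewrite Sr; exact: leq_addr].
have -> : drop (B * b.-1) rest = drop (B * b) a.
  by rewrite drop_size_cat // (size_flatten_const _ Six) size_iota.
rewrite -[RHS](cat_take_drop (B * b)); congr (_ ++ _).
have -> : take (B * b) a = flatten [seq blk j | j <- iota 0 B].
  have H k : k <= B -> take (k * b) a = flatten [seq blk j | j <- iota 0 k].
    elim: k => [|k IH] Hk; first by rewrite mul0n take0.
    rewrite -addn1 iotaD map_cat flatten_cat /= cats0 -IH ?(ltnW Hk) // addn1 mulSn addnC takeD.
    by rewrite add0n.
  exact: H.
congr flatten; apply/eq_in_map => j; rewrite mem_iota add0n => /andP[_ Hj].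
have Gj : blk j \in good_words h b by rewrite mem_filter mem_words Sblk // eqxx andbT; apply: Ha.
rewrite /decode_block.
have -> : take b.-1 (drop (j * b.-1) rest) = ix j.
  rewrite /rest drop_cat (size_flatten_const _ Six) size_iota.
  (* Blocks of one bit have empty indices, and the positions j(b - 1) no longer separate them. *)
  have [b1|b1] := posnP b.-1.
    have -> : take b.-1 (if j * b.-1 < B * b.-1 then drop (j * b.-1) (flatten [seq ix j0 | j0 <- iota 0 B]) ++ drop (B * b) a
       else drop (j * b.-1 - B * b.-1) (drop (B * b) a)) = [::] by rewrite {1}b1 take0.
    by apply/esym/size0nil; rewrite Six.
  rewrite ltn_pmul2r // Hj drop_flatten_const // drop_iota add0n.
  have -> : B - j = (B - j.+1).+1 by rewrite subnSK.
  have -> : flatten [seq ix i | i <- iota j (B - j.+1).+1] = ix j ++ flatten [seq ix i | i <- iota j.+1 (B - j.+1)] by [].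
  by rewrite -catA (take_size_cat _ (Six j)).
rewrite bval_bits ?nth_index //.
have : index (blk j) (good_words h b) < size (good_words h b) by rewrite index_mem.
move=> H; apply: leq_trans H _; rewrite size_filter.
by move: Hc; rewrite -{2}(prednK b0) expnSr leq_mul2r.
Qed.
End Generator.

(** The minimum with [trunc_log 2 pad] and the cap on indices keep this polynomial for every value
    of pad; for pad = 2^cap and under the guard they change nothing. *)
Definition gen_padded (q : str * nat) : str :=
  let u := unstr q.1 in let pad := q.2 in
  let hs := pfst u in let rest := psnd u in let h := header_of hs in
  let b := block_size h in let B := 2 * size hs + 2 in
  Str (if gen_guard u h hs rest b then
    flatten [seq nth (nseq b false) [seq y <- words (minn b (trunc_log 2 pad)) | accept h y]
                   (cval_cap pad (take b.-1 (drop (j * b.-1) rest))) | j <- iota 0 B] ++ drop (B * b.-1) rest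
  else false :: u).

Lemma gen_paddedE u : unstr (gen_padded (Str u, 2 ^ cap (size u))) = generator u.
Proof.
rewrite /gen_padded /generator /=; case: ifP => // /and4P[_ b0 bc _].
congr (flatten _ ++ _); apply: eq_map => j; rewrite /decode_block /good_words trunc_expnK //.
rewrite (minn_idPl bc) cval_capE //; apply: leqW; rewrite leq_exp2l //.
by rewrite size_take_min (leq_trans (geq_minl _ _)) // (leq_trans (leq_pred _)).
Qed.

Lemma fp_gen_padded : fp gen_padded.
Proof.
pose hs (q : str * nat) := pfst (unstr q.1); pose rest (q : str * nat) := psnd (unstr q.1).
have Hhs : fp (fun q => Str (hs q)) by rewrite /hs; apply: (fp_pfst (s := fun q : str * nat => q.1)); fpa.
have Hrest : fp (fun q => Str (rest q)) by rewrite /rest; apply: (fp_psnd (s := fun q : str * nat => q.1)); fpa.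
pose h (q : str * nat) := header_of (hs q).
have Hh : fp h by apply: fp_header_of.
have Hb := fp_block_size Hh.
have HsB : fp (fun q => hs q : seq bool) := fp_unstr Hhs.
have HrB : fp (fun q => rest q : seq bool) := fp_unstr Hrest.
have Hsz : fp (fun q => size (hs q)) by fpa.
have HW : fp (fun q : str * nat => words (minn (block_size (h q)) (trunc_log 2 q.2))).
  apply: (fp_words (k := fun q : str * nat => minn (block_size (h q)) (trunc_log 2 q.2)) (pad := fun q : str * nat => q.2 + 1)).
  - by apply: fp_minn => //; apply: fp_trunc_log; fpa.
  - by fpa.
  move=> q; apply: (@leq_trans (2 ^ trunc_log 2 q.2)); first by rewrite leq_exp2l // geq_minr.
  by case: q.2 => // n; rewrite (leq_trans (trunc_logP _ _)) // leq_addr.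
pose G (q : str * nat) := [seq y <- words (minn (block_size (h q)) (trunc_log 2 q.2)) | accept (h q) y].
have HG : fp G by apply: fp_filter => //; apply: fp_accept; fpa.
pose cp (q : str * nat) := cap (size (unstr q.1)).
have Hcap : fp cp by apply: fp_cap; fpa.
pose bs (q : str * nat) := block_size (h q).
have {}Hb : fp bs by [].
pose body (q : str * nat) : seq bool := if
    [&& pair_code (hs q) (rest q) == unstr q.1, 0 < bs q, bs q <= cp q
      & (2 * size (hs q) + 2) * (bs q).-1 <= size (rest q)]
  then flatten [seq nth (nseq (bs q) false) (G q)
                   (cval_cap q.2 (take (bs q).-1 (drop (j * (bs q).-1) (rest q)))) | j <- iota 0 (2 * size (hs q) + 2)]
       ++ drop ((2 * size (hs q) + 2) * (bs q).-1) (rest q)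
  else false :: unstr q.1.
apply: (@fp_ext _ _ _ _ (fun q => Str (body q))) => //.
apply: (fp_Str (l := body)); rewrite /body.
by fpa.
Qed.
End Padded.

(** * Running times and asymptotics *)

Lemma class_E_fp (L : language) (g : str * nat -> bool) : fp g ->
  (forall y, L y <-> g (Str y, 2 ^ size y)) -> class_E L.
Proof.
move=> Hg E.
have H1 : fp (fun s : str => id (esz s)) by fpa.
have H2 : fp (fun q => Str [:: g q]) by apply: (fp_Str (l := fun q => [:: g q])); fpa.
have [|c [M [t [Ht HM]]]] := @padded_computable (fun x => [:: `[< L x >]]) (fun n => n) (fun q => Str [:: g q]) H1 H2.
  by move=> u; congr cons; apply/idP/asboolP => /E.
exists M, t; split=> //; exists (3 * c), 1 => n n0; apply: leq_trans (Ht n) _.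
rewrite -mulnA [c * n]mulnC mulnA expnM; apply: leq_pow.
rewrite expnM; elim: n n0 => // -[|n] IH _; first by [].
have := IH isT; rewrite !(expnSr _ n.+1); lia.
Qed.

Module SubexpBound.
Import Reals Lra ssrnat.
Local Notation "x ^ y" := (expn x y) : nat_scope.

Lemma INR_expn a k : INR (a ^ k) = pow (INR a) k.
Proof. by elim: k => // k IH; rewrite expnS mult_INR IH. Qed.

Lemma INR_leq a b : a <= b -> Rle (INR a) (INR b).
Proof. by move=> H; apply: le_INR; apply/leP. Qed.

Lemma Rpower_log2 z : Rlt 0 z -> Rpower 2 (log2 z) = z.
Proof.
move=> z0; rewrite /Rpower /log2 /Rdiv Rmult_assoc Rinv_l ?Rmult_1_r ?exp_ln //.
by have := ln_lt_2; lra.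
Qed.

Lemma Rpower2_nat k : Rpower 2 (INR k) = INR (2 ^ k).
Proof. by rewrite INR_expn Rpower_pow //; lra. Qed.

Lemma log2_geq k z : Rlt 0 z -> Rle (INR (2 ^ k)) z -> Rle (INR k) (log2 z).
Proof.
move=> z0 H; case: (Rle_lt_dec (INR k) (log2 z)) => // H2.
have L2 : Rlt 1 2 by lra.
have := Rpower_lt 2 _ _ L2 H2; rewrite Rpower_log2 // Rpower2_nat; lra.
Qed.

(** With P = (log n)^(log log n), each of the three summands is at most 2^P, and 4 <= 2^P, so their
    sum is at most 2^(3P): the constant is 3c. From n = 4 on, log n >= 2 and log log n >= 1, hence
    log n <= P. The roundings in [cap] go downwards. *)
Lemma subexp_cap t c : (forall n, t n <= (2 ^ cap n + n + 2) ^ c) -> subexp_bounded t.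
Proof.
move=> Ht; exists (Rmult 3 (INR c)), 4 => n n4.
set x := log2 (INR n); set y := log2 x; set P := Rpower x y.
have Rn : Rle (INR 4) (INR n) by apply: INR_leq.
have n0 : Rlt 0 (INR n) by move: Rn; rewrite /=; lra.
have x2 : Rle (INR 2) x by apply: log2_geq.
have x0 : Rlt 1 x by move: x2; rewrite /=; lra.
have y1 : Rle (INR 1) y by apply: log2_geq => //; lra.
have n0' : 0 < n by lia.
have m1 : 0 < trunc_log 2 n by apply: trunc_log_max => //; lia.
have mx : Rle (INR (trunc_log 2 n)) x.
  by apply: log2_geq => //; apply: INR_leq; apply: trunc_logP.
have ly : Rle (INR (trunc_log 2 (trunc_log 2 n))) y.
  apply: log2_geq; first by lra.
  apply: Rle_trans mx; apply: INR_leq; exact: trunc_logP.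
have cP : Rle (INR (cap n)) P.
  apply: (Rle_trans _ (INR (trunc_log 2 n ^ trunc_log 2 (trunc_log 2 n)))).
    by apply: INR_leq; apply: geq_minl.
  rewrite INR_expn; apply: (Rle_trans _ (pow x (trunc_log 2 (trunc_log 2 n)))).
    by apply: pow_incr; split=> //; apply: pos_INR.
  by rewrite -Rpower_pow; [apply: Rle_Rpower; lra|lra].
have xP : Rle x P.
  rewrite -{1}(Rpower_1 x); last by lra.
  by apply: Rle_Rpower; [lra | exact: y1].
have L2 : Rle 1 2 by lra.
have A1 : Rle (INR (2 ^ cap n)) (Rpower 2 P) by rewrite -Rpower2_nat; apply: Rle_Rpower.
have A2 : Rle (INR n) (Rpower 2 P) by rewrite -{1}(Rpower_log2 n0); apply: Rle_Rpower.
have A3 : Rle 4 (Rpower 2 P) by move: Rn; rewrite /=; lra.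
have A4 : Rle (INR (2 ^ cap n + n + 2)) (Rpower 2 (P + P + P)).
  rewrite !Rpower_plus !plus_INR [INR 2]/=; move: (INR _) (INR _) (Rpower 2 P) A1 A2 A3 => u v w; nra.
apply: Rle_trans (INR_leq (Ht n)) _; rewrite INR_expn.
apply: (Rle_trans _ (pow (Rpower 2 (P + P + P)) c)).
  by apply: pow_incr; split=> //; apply: pos_INR.
rewrite -Rpower_pow; last by apply: exp_pos.
rewrite Rpower_mult; apply: Req_le; congr Rpower; rewrite -/x -/y -/P; lra.
Qed.

End SubexpBound.

Lemma generator_computable : computable_in subexp_bounded generator.
Proof.
have Hc : fp (fun s : str => cap (esz s)) by apply: fp_cap; fpa.
have [c [M [t [Ht HM]]]] := padded_computable Hc fp_gen_padded gen_paddedE.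
by exists M, t; split=> //; apply: SubexpBound.subexp_cap Ht.
Qed.

Lemma trunc_log_geq k n : 2 ^ k <= n -> k <= trunc_log 2 n.
Proof. exact: trunc_log_max. Qed.

(** With q the quotient of m by 2(k + 1), m <= (q + 1)^2 and q + 1 <= 2^q, so m^k <= 2^(2kq) <=
    2^m. *)
Lemma pow_leq_exp2 k m : (2 * k.+1) ^ 2 <= m -> m ^ k <= 2 ^ m.
Proof.
move=> H; set K := 2 * k.+1 in H *; set q := m %/ K.
have K0 : 0 < K by [].
have E := divn_eq m K; have R := ltn_pmod m K0.
have Kq : K <= q by rewrite /q leq_divRL // mulnn.
have m1 : m <= q.+1 * q.+1 by rewrite E; rewrite -/q; nia.
apply: (@leq_trans ((q.+1 * q.+1) ^ k)); first exact: leq_pow.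
rewrite mulnn -expnM; apply: (@leq_trans ((2 ^ q) ^ (2 * k))); first by apply: leq_pow; apply: ltn_expl.
by rewrite -expnM leq_exp2l // E -/q; rewrite /K; nia.
Qed.

Lemma polylog_leq_cap g : polyb g -> exists N, forall n, N <= n -> g (trunc_log 2 n) <= cap n.
Proof.
(* For m = [trunc_log 2 n] at least M, the first summand makes its logarithm at least 2c, the second
   is what [pow_leq_exp2] asks for with k = 2c, and the third gives m + 2 <= m^2. *)
move=> [c Hc]; pose M := 2 ^ (2 * c) + (2 * (2 * c).+1) ^ 2 + 2.
exists (2 ^ M) => n Hn; have HM := trunc_log_geq Hn.
have n0 : 0 < n by apply: leq_trans Hn; rewrite expn_gt0.
apply: leq_trans (Hc _) _; set m := trunc_log 2 n in HM *.
have m0 : 2 <= m by apply: leq_trans HM; rewrite /M leq_addl.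
apply: (@leq_trans (m ^ (2 * c))); first by rewrite expnM leq_pow // -mulnn; nia.
rewrite /cap -/m leq_min; apply/andP; split.
  rewrite leq_pexp2l ?(ltnW m0) //; apply: trunc_log_geq; apply: leq_trans HM.
  by rewrite /M -addnA leq_addr.
apply: leq_trans (trunc_logP (isT : 1 < 2) n0); rewrite -/m; apply: pow_leq_exp2.
by apply: leq_trans HM; rewrite /M addnAC leq_addl.
Qed.

(** * A prime between X and 2 X ^ 2 *)

(** In Vandermonde's sum each term is ['C(K, i)] times a positive factor, and these add up to (1 +
    1)^K. *)
Lemma central_binomial K : 2 ^ K <= 'C(K + K, K).
Proof.
rewrite -(binomial.Vandermonde K K K) -[2]/(1 + 1) expnDn; apply: leq_sum => i _.
rewrite !exp1n !muln1 leq_pmulr // bin_gt0 leq_subr //.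
Qed.

(** By Legendre's formula the exponent of p is the sum over k of floor(2K / p^k) - 2 floor(K / p^k);
    each term is at most 1, and is 0 once p^k > 2K. *)
Lemma logn_central_binomial p K : prime p -> 0 < K -> p ^ logn p 'C(K + K, K) <= K + K.
Proof.
move=> pp K0; have p1 := prime_gt1 pp; have N0 : 0 < K + K by lia.
apply: leq_trans (trunc_logP p1 N0); rewrite leq_exp2l //.
have C0 : 0 < 'C(K + K, K) by rewrite bin_gt0 leq_addl.
have := bin_fact (leq_addl K K); rewrite addnK => /(congr1 (logn p)).
rewrite !lognM ?muln_gt0 ?fact_gt0 // !logn_fact //.
have ext : \sum_(1 <= k < K.+1) K %/ p ^ k = \sum_(1 <= k < (K + K).+1) K %/ p ^ k.
  rewrite (@big_cat_nat _ _ _ K.+1 1 (K + K).+1) //=; last by lia.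
  rewrite [X in _ = _ + X]big_nat_cond [X in _ = _ + X]big1 ?addn0 // => k /andP[/andP[Hk _] _].
  by apply: divn_small; apply: ltn_trans Hk (ltn_expl _ p1).
rewrite ext => E.
suff : \sum_(1 <= k < (K + K).+1) (K + K) %/ p ^ k <=
   \sum_(1 <= k < (K + K).+1) K %/ p ^ k + \sum_(1 <= k < (K + K).+1) K %/ p ^ k + trunc_log p (K + K) by lia.
apply: (@leq_trans (\sum_(1 <= k < (K + K).+1) (K %/ p ^ k + K %/ p ^ k + (p ^ k <= K + K)))).
  apply: leq_sum => k _; set q := p ^ k; have q0 : 0 < q by rewrite expn_gt0 ltnW.
  case: (leqP q (K + K)) => H; last by rewrite divn_small.
  have := divn_eq K q; have := ltn_pmod K q0 => R E2.
  by rewrite -ltnS ltn_divLR //; move: E2 R; set d := K %/ q; nia.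
rewrite big_split big_split /= leq_add2l.
set L := trunc_log p (K + K).
have LN : L <= K + K by apply: leq_trans (trunc_logP p1 N0); rewrite ltnW // ltn_expl.
rewrite (@big_cat_nat _ _ _ L.+1) //= -[X in _ <= X]addn0; apply: leq_add.
  apply: (@leq_trans (\sum_(1 <= k < L.+1) 1)); first by apply: leq_sum => k _; exact: leq_b1.
  by rewrite sum_nat_const_nat muln1 subn1.
rewrite leqn0 big_nat_cond big1 // => k /andP[/andP[Hk _] _].
by case: (leqP (p ^ k) (K + K)) => // /(trunc_log_max p1); rewrite leqNgt Hk.
Qed.

Lemma prime_dvd_fact p n : prime p -> p %| n`! -> p <= n.
Proof.
move=> pp; elim: n => [|n IH]; first by rewrite dvdn1 => /eqP p1; rewrite p1 in pp.
by rewrite factS Euclid_dvdM // => /orP[/dvdn_leq -> //|/IH/leqW].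
Qed.

(** A weak form of Bertrand's postulate, enough for a modulus polynomial in X. Without such a prime,
    all primes dividing C(2K, K) with K = X^2 are below X and each contributes at most 2K, so
    2^(X^2) <= (2X^2)^X; but 2^X > 2X^2 from X = 7 on. *)
Lemma prime_between X : 7 <= X -> exists2 p, prime p & X <= p <= X * X + X * X.
Proof.
move=> X7; set K := X * X; have K0 : 0 < K by rewrite /K; nia.
apply: contrapT => H; set c := 'C(K + K, K).
have C0 : 0 < c by rewrite bin_gt0 leq_addl.
have small p : p \in primes c -> p < X.
  rewrite mem_primes => /and3P[pp _ pc]; rewrite ltnNge; apply/negP => Xp; apply: H; exists p => //.
  rewrite Xp; have : p %| (K + K)`!.
    by rewrite -(bin_fact (leq_addl K K)) dvdn_mulr.
  exact: prime_dvd_fact.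
have B : c <= (K + K) ^ X.
  rewrite [c](prod_prime_decomp C0) prime_decompE big_map /=.
  apply: (@leq_trans (\prod_(p <- primes c) (K + K))).
    rewrite big_seq [X in _ <= X]big_seq; apply: leq_prod => p; rewrite mem_primes => /and3P[pp _ _].
    exact: logn_central_binomial.
  rewrite big_const_seq count_predT iter_muln_1 leq_pexp2l ?addn_gt0 ?K0 //.
  rewrite -(size_iota 0 X); apply: uniq_leq_size; first exact: primes_uniq.
  by move=> p /small; rewrite mem_iota.
have := leq_trans (central_binomial K) B; rewrite /K expnM leq_exp2r; last by lia.
apply/negP; rewrite -ltnNge.
elim: X X7 {K K0 H c C0 small B} => // X IH; rewrite leq_eqVlt => /orP[/eqP <- //|X7].
by have := IH X7; rewrite expnS; nia.
Qed.

(** * Two languages in E *)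

Lemma cval_cap_min m w : cval_cap m w = minn (bval w) m.
Proof.
elim/last_ind: w => [|w b IH]; first by rewrite /cval_cap min0n.
rewrite /cval_cap bval_rcons -cats1 foldl_cat [foldl _ _ [:: b]]/= -/(cval_cap m w) IH.
by lia.
Qed.

Section TableauLanguage.
Variable M : machine.
Let k := (ntapes_pred M).+1.
Local Notation syms := {ffun 'I_k -> symbol}.
Local Notation letter := ((state M * syms) * (syms * syms))%type.
Local Notation key := (nat * (seq symbol * (seq symbol * seq symbol)))%type.

(** Letters belong to finite types attached to M, which have no encoding; the key is an encodable
    copy, translated by a finite table. *)
Definition letter_key (x : letter) : key :=
  (nat_of_ord (enum_rank x.1.1), ([seq x.1.2 i | i <- enum 'I_k],
     ([seq x.2.1 i | i <- enum 'I_k], [seq x.2.2 i | i <- enum 'I_k]))).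

Lemma letter_key_inj : injective letter_key.
Proof.
have F (f g : syms) : [seq f i | i <- enum 'I_k] = [seq g i | i <- enum 'I_k] -> f = g.
  by move=> /eq_in_map E; apply/ffunP => i; apply: E; rewrite mem_enum.
move=> [[q f] [g h]] [[q' f'] [g' h']] [/ord_inj/enum_rank_inj /= -> /F /= -> /F /= -> /F /= ->] //.
Qed.

Definition config_key (c : nat * seq (seq symbol * seq symbol)) p : key :=
  (c.1, ([seq head None t.2 | t <- c.2], ([seq nth None t.2 p | t <- c.2], [seq nth None t.1 p | t <- c.2]))).

Lemma config_keyE c p : config_key (@cfg_code M c) p = letter_key (letter_at c p).
Proof.
rewrite /config_key /cfg_code /letter_key /letter_at /= -!map_comp.
by congr (_, (_, (_, _))); apply: eq_map => i; rewrite /= ffunE.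
Qed.

Definition key_table (x : key) : seq bool :=
  if [pick y | letter_key y == x] is Some y then letter_code y else [::].
Definition all_keys : seq key := [seq letter_key y | y <- enum {: letter}].

Lemma key_tableE y : (if letter_key y \in all_keys then key_table (letter_key y) else [::]) = letter_code y.
Proof.
rewrite map_f ?mem_enum // /key_table; case: pickP => [z /eqP/letter_key_inj -> //|/(_ y)].
by rewrite eqxx.
Qed.

Lemma fp_letter_code X {eX : encT X} (z : X -> str) (t p : X -> nat) : fp z -> fp t -> fp p ->
  fp (fun x => letter_code (letter_at (iter (t x) (@step M) (init_config M (unstr (z x)))) (p x)) : seq bool).
Proof.
move=> Hz Ht Hp.
pose c x := @cfg_code M (iter (t x) (@step M) (init_config M (unstr (z x)))).
have Hc : fp c by apply: (fp_comp (f := fun x => (z x, t x)) (fp_sim M)); fpa.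
have Hk : fp (fun x => config_key (c x) (p x)) by rewrite /config_key; fpa.
apply: (@fp_ext _ _ _ _ (fun x => if config_key (c x) (p x) \in all_keys then key_table (config_key (c x) (p x)) else [::])).
  exact: fp_fin.
by move=> x; rewrite /c config_keyE key_tableE.
Qed.

Variable input : nat -> bitstring.
Hypothesis Hinput : fp (fun n : nat => Str (input n)).

Definition run_on n t := iter t (@step M) (init_config M (input n)).
Definition tableau_bit n : assignment := fun f t p =>
  nth false (letter_code (letter_at (run_on n (bval t)) (bval p))) f.

Definition tableau_prefix f nb : bitstring := self_delim (enc ((f, nb) : nat * bitstring)).

Definition key_of (w : bitstring) : nat * bitstring := dec w.

(** Since n, t and p are in binary, running M is exponential in the length of y at worst. The guard
    ensures this for strings whose decoding would give a longer n. *)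
Definition tableau_lang : language := fun y =>
  let q := key_of (pfst y) in
  let l := (size (psnd y))./2 in
  size q.2 <= size y /\ tableau_bit (bval q.2) q.1 (take l (psnd y)) (drop l (psnd y)).

Lemma tableau_langE f nb t p : size t = size p ->
  tableau_lang (tableau_prefix f nb ++ t ++ p) <-> tableau_bit (bval nb) f t p.
Proof.
move=> S; rewrite /tableau_lang /tableau_prefix -/(pair_code _ _) pfst_pair psnd_pair /key_of encK.
rewrite size_cat S addnn doubleK -S take_size_cat // drop_size_cat //; split=> [[]//|H]; split=> //.
rewrite size_pair_code; have := @esz_pair _ _ enc_nat enc_bs (f, nb).
have := @size_esz _ enc_bool nb; rewrite /esz /=; lia.
Qed.

Lemma tableau_lang_E : class_E tableau_lang.
Proof.
pose q (x : str * nat) := key_of (pfst (unstr x.1)).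
have Hq : fp q.
  by apply: (fp_dec (s := fun x : str * nat => Str (pfst (unstr x.1)))); apply: (fp_pfst (s := fun x : str * nat => x.1)); fpa.
pose w (x : str * nat) : seq bool := psnd (unstr x.1).
have Hw : fp w by apply: (fp_unstr (s := fun x : str * nat => Str (psnd (unstr x.1)))); apply: (fp_psnd (s := fun x : str * nat => x.1)); fpa.
have Hl : fp (fun x => (size (w x))./2) by apply: fp_half; fpa.
pose g (x : str * nat) := (size (q x).2 <= size (unstr x.1)) &&
  nth false (letter_code (letter_at (iter (cval_cap x.2 (take (size (w x))./2 (w x))) (@step M)
    (init_config M (unstr (Str (input (cval_cap x.2 (q x).2)))))) (cval_cap x.2 (drop (size (w x))./2 (w x))))) (q x).1.
apply: (@class_E_fp _ g).
  rewrite /g; apply: fp_and; first by fpa.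
  apply: fp_nth; [by fpa| |by fpa].
  apply: (fp_letter_code (z := fun x => Str (input (cval_cap x.2 (q x).2)))).
  - apply: (fp_comp (f := fun x => cval_cap x.2 (q x).2) Hinput); apply: fp_cval_cap; fpa.
  - by apply: fp_cval_cap; [by fpa|apply: fp_take; fpa].
  - by apply: fp_cval_cap; [by fpa|apply: fp_drop; fpa].
move=> y; rewrite /tableau_lang  /g /tableau_bit /run_on -/(q (Str y, 2 ^ size y)).
rewrite [X in X.2]/= [(_, 2 ^ _).2]/=.
rewrite -[psnd y]/(w (Str y, 2 ^ size y)).
set v := w _; set nb := (q _).2.
have Sv : size v <= size y by apply: size_psnd.
have C u : size u <= size y -> cval_cap (2 ^ size y) u = bval u.
  move=> Hu; rewrite cval_cap_min; apply/minn_idPl; apply: leq_trans (ltnW (bval_lt u)) _.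
  by rewrite leq_exp2l.
split=> [[H1 H2]|/andP[H1 H2]].
  apply/andP; split; first exact: H1.
  by rewrite !C ?size_drop ?size_take_min ?(leq_trans (geq_minr _ _)) ?(leq_trans (leq_subr _ _)).
split; first exact: H1.
by move: H2; rewrite !C ?size_drop ?size_take_min ?(leq_trans (geq_minr _ _)) ?(leq_trans (leq_subr _ _)).
Qed.
End TableauLanguage.

(** The guard, which always holds for codes of queries, limits the sum in [query_value] to 2^|y|
    terms. *)
Definition query_lang : language := fun y =>
  let q : queryT := dec y in q.1.1 + size q.1.2.1 <= size y /\ query_value q.

Lemma query_langE (q : queryT) : query_lang (enc q) <-> query_value q.
Proof.
rewrite /query_lang  encK; split=> [[]//|H]; split=> //.
rewrite -/(esz q); case: q H => [[n0 [C m]] r] _; rewrite !esz_pair esz_nat /=.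
by have := @size_esz gateT (enc_prod (enc_seq enc_nat) (enc_seq enc_bs)) C; lia.
Qed.

Definition query_of (y : bitstring) : queryT := dec y.

Lemma query_lang_E : class_E query_lang.
Proof.
pose q (x : str * nat) : queryT := query_of (unstr x.1).
have Hq : fp q by apply: (fp_dec (s := fun x : str * nat => x.1)); fpa.
(* [fp_query_value] wants the padding to suffice for all pairs of a string and a number, also
   unrelated ones; where it does not, the query is replaced by a trivial one. *)
pose dummy : queryT := ((0, ([::], 0)), (([::], [::]), (0, 0))).
pose ok (x : str * nat) := ((q x).1.1 + size (q x).1.2.1 <= size (unstr x.1)) && (powcap 2 (size (unstr x.1)) x.2.+1 <= x.2).
have Hok : fp ok by rewrite /ok; apply: fp_and; [by fpa|apply: fp_leq; [apply: fp_powcap; fpa|by fpa]].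
pose q' x := if ok x then q x else dummy.
have Hq' : fp q' by rewrite /q'; fpa.
have HV : fp (fun x => query_value (q' x)).
  apply: (fp_query_value (pad := fun x : str * nat => x.2.+1) Hq'); first by fpa.
  move=> x; rewrite /q'; case: ifP => // /andP[H1]; rewrite powcapE // geq_min ltnn orbF => H2.
  apply: leq_trans (leqnSn _); apply: leq_trans H2; rewrite leq_exp2l //.
  by rewrite (leq_trans (leq_pred _)) // (leq_trans (leq_subr _ _)).
apply: (@class_E_fp _ (fun x => ok x && query_value (q' x))); first by apply: fp_and.
move=> y; rewrite /query_lang -[dec y]/(q (Str y, 2 ^ size y)) /q'.
have -> : ok (Str y, 2 ^ size y) = ((q (Str y, 2 ^ size y)).1.1 + size (q (Str y, 2 ^ size y)).1.2.1 <= size y).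
  by rewrite /ok powcapE // geq_min [(_, 2 ^ _).2]/= leqnn andbT.
by case: (leqP _ (size y)) => H; split=> [[]|].
Qed.

(** * The test machine *)

Lemma fp_decide (V : language) X {eX : encT X} (s : X -> str) : class_P V -> fp s ->
  fp (fun x => `[< V (unstr (s x)) >]).
Proof.
move=> HV Hs; have H := polytime_fp HV Hs.
apply: (@fp_ext _ _ _ _ (fun x => head false (unstr (Str [:: `[< V (unstr (s x)) >]])))) => //.
Qed.

Section Accepting.
Variables (M : machine) (d : bitstring -> bool) (t : nat -> nat).
Hypothesis HM : computes_in_time M (fun z => [:: d z]) t.

Lemma accepting_sound z N : let cf := iter N (@step M) (init_config M z) in
  halting cf.1 -> head None (cf.2 ord_max).2 = Some true -> d z.
Proof.
move=> cf Hh Ho; have [s [_ Hs Os]] := HM z.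
have E : output cf = [:: d z].
  rewrite -Os; congr output; rewrite /cf.
  by case/orP: (leq_total s N) => L; [|symmetry]; apply: iter_halted.
by move: E; rewrite /output; case: (cf.2 ord_max).2 Ho => //= x l -> [].
Qed.

Lemma accepting_complete z N : d z -> t (size z) <= N ->
  let cf := iter N (@step M) (init_config M z) in
  halting cf.1 /\ head None (cf.2 ord_max).2 = Some true.
Proof.
move=> dz LN cf; have [s [Ls Hs Os]] := HM z.
have E : cf = iter s (@step M) (init_config M z) by apply: iter_halted => //; apply: leq_trans LN.
rewrite E; split=> //; move: Os; rewrite dz /output.
by case: (((iter s (@step M) (init_config M z)).2 ord_max).2) => //= -[b|] //= l [-> _].
Qed.
End Accepting.

(** 2^k cannot be written in unary, but a comparison with x needs it only up to x + 1. *)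
Definition geq_pow2 x k := x <= powcap 2 k x.+1.
Definition leq_pow2 k x := powcap 2 k x.+1 <= x.

Lemma geq_pow2E x k : geq_pow2 x k = (x <= 2 ^ k).
Proof. by rewrite /geq_pow2 powcapE // leq_min leqnSn andbT. Qed.
Lemma leq_pow2E k x : leq_pow2 k x = (2 ^ k <= x).
Proof. by rewrite /leq_pow2 powcapE // geq_min ltnn orbF. Qed.

Lemma fp_geq_pow2 X {eX : encT X} (x k : X -> nat) : fp x -> fp k -> fp (fun z => geq_pow2 (x z) (k z)).
Proof. by move=> Hx Hk; rewrite /geq_pow2; apply: fp_leq => //; apply: fp_powcap; fpa. Qed.
Lemma fp_leq_pow2 X {eX : encT X} (k x : X -> nat) : fp k -> fp x -> fp (fun z => leq_pow2 (k z) (x z)).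
Proof. by move=> Hk Hx; rewrite /leq_pow2; apply: fp_leq => //; apply: fp_powcap; fpa. Qed.

Definition is_prime m := (1 < m) && all (fun i => m %% i != 0) (iota 2 (m - 2)).

Lemma is_primeE m : is_prime m = prime m.
Proof.
apply/andP/primeP => -[m1 H]; split=> //.
  move=> i /[dup] D; rewrite /dvdn => E; have L := dvdn_leq (ltnW m1) D.
  have i0 : 0 < i by apply: dvdn_gt0 D; apply: ltnW.
  apply: contraT; rewrite negb_or => /andP[n1 nm].
  have /(allP H) : i \in iota 2 (m - 2) by rewrite mem_iota; lia.
  by rewrite E.
apply/allP => i; rewrite mem_iota => Hi; apply/negP => /(H i) /orP[] /eqP; lia.
Qed.

Lemma fp_is_prime X {eX : encT X} (m : X -> nat) : fp m -> fp (fun x => is_prime (m x)).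
Proof. by move=> Hm; rewrite /is_prime; fpa. Qed.

Definition starts_check (h : headerT) (xs : bitstring) :=
  all (fun i => (dl_assignment (circ_list (hd_asg h)) 0 (bits (hd_len h) 0) (bits (hd_len h) i) == nth false xs i) &&
                (dl_assignment (circ_list (hd_asg h)) 1 (bits (hd_len h) 0) (bits (hd_len h) i) == ~~ nth false xs i))
      (iota 0 (size xs)).

Lemma starts_checkP h xs : starts_check h xs <->
  starts_with xs (hd_len h) (dl_assignment (circ_list (hd_asg h))).
Proof.
split=> [/allP H i Hi|H]; last by apply/allP => i; rewrite mem_iota add0n => /andP[_ /H[-> ->]]; rewrite !eqxx.
by have := H i; rewrite mem_iota add0n Hi => /(_ isT)/andP[/eqP -> /eqP ->].
Qed.

Lemma fp_dl_assignment X {eX : encT X} (D : X -> raw_list) (f : X -> nat) (t p : X -> seq bool) :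
  fp D -> fp f -> fp t -> fp p -> fp (fun x => dl_assignment (circ_list (D x)) (f x) (t x) (p x)).
Proof.
move=> HD Hf Ht Hp; rewrite /dl_assignment.
apply: (@fp_ext _ _ _ _ (fun x => circuit_eval (circ_of (nth ([::], [::]) (D x) (f x)).2)
   ((nth ([::], [::]) (D x) (f x)).1 ++ t x ++ p x))); last by move=> x; rewrite nth_circ_list.
by apply: fp_circuit_eval; fpa.
Qed.

Lemma fp_starts_check X {eX : encT X} (h : X -> headerT) (xs : X -> seq bool) : fp h -> fp xs ->
  fp (fun x => starts_check (h x) (xs x)).
Proof.
move=> Hh Hx; rewrite /starts_check /hd_asg /hd_len; apply: fp_all; last by fpa.
by apply: fp_and; apply: fp_eq; [apply: fp_dl_assignment| |apply: fp_dl_assignment|]; fpa.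
Qed.

Definition header_size (h : headerT) := esz h.

Definition instT := (sysT * bitstring)%type.
Definition inst_of (x : bitstring) : instT := dec x.
Definition witT := (headerT * (str * str))%type.
Definition wit_of (y : bitstring) : witT := dec y.

Section Test.
Variables (V : language) (c : nat).
Hypothesis HV : class_P V.

(* The string x = (s, n in binary) fixes the system s that the header must be
   about; the witness is a header together with a member a of the NP set, of
   length n + 1, and its certificate w. *)
Definition test_with (x : bitstring) (h : headerT) (a w : bitstring) : bool :=
  let n := (size a).-1 in let b := block_size h in let B := 2 * header_size h + 2 in
  [&& `[< V (pair_code a w) >], 0 < size a, cval_cap (size a) (inst_of x).2 == n,
      hd_sys h == (inst_of x).1, is_prime (hd_mod h).+1 &
  [&& leq_pow2 (hd_bits h) (hd_mod h).+1, geq_pow2 (2 * hd_vars h * hd_deg h) (hd_bits h),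
      starts_check h (self_delim x), geq_pow2 (size (self_delim x)) (hd_len h), size w <= size a ^ c + c &
  [&& 0 < b, b <= cap n, B * b <= n.+1 & all (fun j => accept h (take b (drop (j * b) a))) (iota 0 B)]]].

Definition test (z : bitstring) : bool :=
  let y := wit_of (psnd z) in test_with (pfst z) y.1 (unstr y.2.1) (unstr y.2.2).

Lemma fp_test : fp (fun s : str => test (unstr s)).
Proof.
pose x (s : str) : seq bool := pfst (unstr s).
have HX : fp (fun s => Str (x s)) by apply: fp_pfst; fpa.
have Hx : fp x := fp_unstr HX.
pose y (s : str) := wit_of (psnd (unstr s)).
have Hy : fp y by apply: (fp_dec (s := fun s => Str (psnd (unstr s)))); apply: fp_psnd; fpa.
pose i (s : str) := inst_of (x s).
have Hi : fp i by apply: (fp_dec (s := fun s => Str (x s))).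
pose h (s : str) := (y s).1; have Hh : fp h by rewrite /h; fpa.
pose a (s : str) : seq bool := unstr (y s).2.1; have Ha : fp a by rewrite /a; fpa.
pose w (s : str) : seq bool := unstr (y s).2.2; have Hw : fp w by rewrite /w; fpa.
have HN := fp_hd_vars Hh; have Hd := fp_hd_deg Hh; have Hb := fp_block_size Hh.
pose xs (s : str) : seq bool := pair_code (x s) [::].
have Hxs : fp xs by apply: fp_pair_code; fpa.
have Exs s : self_delim (x s) = xs s by rewrite /xs /pair_code cats0.
pose n s := (size (a s)).-1; have Hn : fp n by rewrite /n; fpa.
pose B s := 2 * header_size (h s) + 2.
have HB : fp B by rewrite /B /header_size; fpa.
apply: (@fp_ext _ _ _ _ (fun s => [&& `[< V (pair_code (a s) (w s)) >], 0 < size (a s), cval_cap (size (a s)) (i s).2 == n s,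
      (h s).1.1.1 == (i s).1, is_prime (h s).2.2.+1 &
  [&& leq_pow2 (h s).2.1 (h s).2.2.+1, geq_pow2 (2 * hd_vars (h s) * hd_deg (h s)) (h s).2.1,
      starts_check (h s) (xs s), geq_pow2 (size (xs s)) (h s).1.1.2, size (w s) <= size (a s) ^ c + c &
  [&& 0 < block_size (h s), block_size (h s) <= cap (n s), B s * block_size (h s) <= (n s).+1 &
     all (fun j => accept (h s) (take (block_size (h s)) (drop (j * block_size (h s)) (a s)))) (iota 0 (B s))]]])); last first.
  by move=> s; rewrite -Exs.
have HVd : fp (fun s => `[< V (pair_code (a s) (w s)) >]).
  by apply: (fp_decide (s := fun s => Str (pair_code (a s) (w s)))) => //; apply: (fp_Str (l := fun s => _)); apply: fp_pair_code; fpa.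
apply: fp_and => //; apply: fp_and; first by fpa.
apply: fp_and; first by fpa.
apply: fp_and; first by fpa.
apply: fp_and; first by apply: fp_is_prime; fpa.
apply: fp_and; first by apply: fp_leq_pow2; fpa.
apply: fp_and; first by apply: fp_geq_pow2; [apply: fp_mul; [apply: fp_mul|]|]; fpa.
apply: fp_and; first exact: fp_starts_check.
apply: fp_and; first by apply: fp_geq_pow2; fpa.
apply: fp_and; first by fpa.
apply: fp_and; first by apply: fp_leq; fpa.
apply: fp_and; first by apply: fp_leq => //; apply: fp_cap.
apply: fp_and; first by apply: fp_leq; [apply: fp_mul|]; fpa.
apply: fp_all; last by fpa.
have HQ : fp (fun q : str * nat => block_size (h q.1)) by apply: fp_block_size; fpa.
apply: fp_accept; first by fpa.
by apply: fp_take => //; apply: fp_drop; [apply: fp_mul|]; fpa.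
Qed.

End Test.

(** * The self-referential formulas *)

(** Chosen so that the side 2^len of the grid lies between (n + 2)^e and (4n + 4)^e, while its
    indices have logarithmic length. *)
Definition len e n := e * (trunc_log 2 n + 2).

Lemma exp_len e n : 2 ^ len e n <= (4 * n + 4) ^ e.
Proof.
rewrite /len mulnC expnM; apply: leq_pow; rewrite expnD.
case: n => // n; have := trunc_logP (isT : 1 < 2) (isT : 0 < n.+1); rewrite -[2 ^ 2]/4; lia.
Qed.

Lemma exp_len_geq e n : (n + 2) ^ e <= 2 ^ len e n.
Proof.
rewrite /len mulnC expnM; apply: leq_pow; rewrite expnD -[2 ^ 2]/4.
have := trunc_log_ltn n (isT : 1 < 2); rewrite expnS; have := expn_gt0 2 (trunc_log 2 n); lia.
Qed.

Definition binary n : bitstring := bits (trunc_log 2 n).+1 n.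

Lemma bval_binary n : bval (binary n) = n.
Proof. by rewrite /binary bval_bits // trunc_log_ltn. Qed.

Lemma size_binary n : size (binary n) = (trunc_log 2 n).+1.
Proof. exact: size_bits. Qed.

Lemma tableau_sys_uniq M : uniq (tableau_sys M).2.
Proof. by rewrite filter_uniq // uniq_words. Qed.

Lemma tableau_sys_sizes M :
  all (fun w => size w == 8 + (tableau_sys M).1 + (tableau_sys M).1) (tableau_sys M).2.
Proof. by apply/allP => w; rewrite mem_filter mem_words => /andP[_]. Qed.

Section Goedel.
Variables (P : bitstring -> bitstring) (MT : machine) (eT : nat).
Hypotheses (HP : polytime P) (RP : range P = TAUT).

Definition sigma (x : bitstring) n := sys_formula (tableau_sys MT) (len eT n) (self_delim x).

Definition proof_of (y : bitstring) : str * str := dec y.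

(* On (x, (1^n, pi)), where x carries n: is pi a P-proof of sigma x n? *)
Definition refutes (z : bitstring) : bool :=
  let x := pfst z in let y := proof_of (psnd z) in let n := size (unstr y.1) in
  (cval_cap n.+1 (inst_of x).2 == n) && (P (unstr y.2) == formula_code (sigma x n)).

Lemma fp_sigma X {eX : encT X} (x : X -> str) (n : X -> nat) : fp x -> fp n ->
  fp (fun z => formula_code (sigma (unstr (x z)) (n z)) : seq bool).
Proof.
move=> Hx Hn; have HX := fp_unstr Hx.
have HL := fp_trunc_log Hn.
have Hs : fp (fun z => self_delim (unstr (x z)) : seq bool).
  apply: (@fp_ext _ _ _ _ (fun z => pair_code (unstr (x z)) [::] : seq bool)); last by move=> z; rewrite /pair_code cats0.
  by apply: fp_pair_code; fpa.
apply: (fp_sys_code (s := fun=> tableau_sys MT) (l := fun z => len eT (n z)) (pad := fun z => (4 * n z + 4) ^ eT)) => //.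
- exact: fp_const.
- by rewrite /len; fpa.
- by apply: fp_pow; fpa.
- by move=> z; apply: exp_len.
Qed.

Lemma fp_refutes : fp (fun s : str => refutes (unstr s)).
Proof.
pose x (s : str) := Str (pfst (unstr s)).
have Hx : fp x by apply: fp_pfst; fpa.
pose y (s : str) := proof_of (psnd (unstr s)).
have Hy : fp y by apply: (fp_dec (s := fun s => Str (psnd (unstr s)))); apply: fp_psnd; fpa.
pose i (s : str) := inst_of (unstr (x s)).
have Hi : fp i by apply: (fp_dec (s := x)).
pose u (s : str) : seq bool := unstr (y s).1.
have Hu : fp u by apply: (fp_unstr (s := fun s => (y s).1)); fpa.
pose n (s : str) := size (u s); have Hn : fp n by rewrite /n; fpa.
have HPp : fp (fun s => Str (P (unstr (y s).2))) by apply: (polytime_fp (s := fun s => (y s).2)); fpa.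
apply: (@fp_ext _ _ _ _ (fun s => (cval_cap (n s).+1 (i s).2 == n s) &&
   (unstr (Str (P (unstr (y s).2))) == formula_code (sigma (unstr (x s)) (n s)) :> seq bool))) => //.
apply: fp_and; first by fpa.
by apply: fp_eq; [exact: fp_unstr HPp | exact: fp_sigma].
Qed.

Lemma P_sound F pi : P pi = formula_code F -> tautology F.
Proof.
move=> E; have : TAUT (P pi) by rewrite -RP; exists pi.
by case=> G TG; rewrite E => /esym H; have [|->] := @formula_code_inj F G [::] [::]; rewrite ?cats0.
Qed.

Variables (A V : language) (c : nat) (tT : nat -> nat).
Hypothesis HA : forall a w, size w <= size a ^ c + c -> V (pair_code a w) -> A a.
Hypothesis disj : forall u, ~ A (generator u).
Hypothesis HMT : computes_in_time MT (fun z => [:: test V c z]) tT.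
Variables (MM : machine) (tM : nat -> nat).
Hypothesis HMM : computes_in_time MM (fun z => [:: refutes z]) tM.

Definition inst n : bitstring := enc ((tableau_sys MM, binary n) : instT).

Lemma inst_ofK n : inst_of (inst n) = (tableau_sys MM, binary n).
Proof. exact: encK. Qed.

(* If sigma fails, MT accepts a header and a in A. The assignment in the header
   cannot violate the tableau system of MM, as a would then be compressible, that
   is, in the range of the generator; hence MM accepts a P-proof of sigma. *)
Lemma sigma_tautology n : size (self_delim (inst n)) <= 2 ^ len eT n ->
  tautology (sigma (inst n) n).
Proof.
move=> Sx; apply: contrapT => NT.
have [v Hv] : exists v, ~ formula_eval v (sigma (inst n) n) by apply: contrapT => H; apply: NT => v; apply: contrapT => H2; apply: H; exists v.
have {}Hv : formula_eval v (sigma (inst n) n) = false by apply/negbTE/negP.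
move: Hv => /sys_formula_eval [H1 H2].
(* A valuation falsifying the formula is an accepting tableau of MT on some input starting with the
   code of [inst n]. *)
have [y [Hh Ho]] := tableau_sound Sx H1 H2.
have := accepting_sound HMT Hh Ho; rewrite /test -/(pair_code _ _) pfst_pair psnd_pair.
move: (wit_of y) => [h [[a] [w]]] /=.
rewrite /test_with inst_ofK; case/and5P => /asboolP Va a0 /eqP En /eqP Es; rewrite is_primeE => /andP[pp].
case/and5P; rewrite leq_pow2E !geq_pow2E => pb Nb /starts_checkP Hs Sl /andP[Sw].
case/and4P => b0 bc LB /allP Hacc.
(* The value was capped at |a| but compared with |a| - 1, so the equality cannot be due to the
   cap. *)
have En' : n = (size a).-1.
  by move: En; rewrite cval_cap_min bval_binary; case: (leqP n (size a)) => // _; move: a0; lia.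
have Sa : size a = n.+1 by rewrite En' prednK.
have Aa := HA Sw Va.
have [Hd|Hd] := pselect (holds (hd_sys h) (hd_len h) (dl_assignment (circ_list (hd_asg h)))).
  rewrite Es in Hd.
  have [y' [Hh' Ho']] := tableau_sound Sl Hd Hs.
  have := accepting_sound HMM Hh' Ho'; rewrite /refutes -/(pair_code _ _) pfst_pair psnd_pair inst_ofK.
  case/andP => /eqP; set m := size _; rewrite cval_cap_min bval_binary => Em /eqP EP.
  have Em' : n = m by move: Em; rewrite /minn; case: ifP; lia.
  by rewrite -Em' in EP; apply: NT; apply: P_sound EP.
have Us : uniq (hd_sys h).2 by rewrite Es; apply: tableau_sys_uniq.
have Ws : all (fun w => size w == 8 + (hd_sys h).1 + (hd_sys h).1) (hd_sys h).2 by rewrite Es; apply: tableau_sys_sizes.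
have [x Sxx Hx] := (hd_circ_sat h).2 Hd.
have Hc := accept_sound pp pb Us Ws Sxx Hx Nb.
have [u Hu] : exists u, generator u = a.
  apply: (@generator_hits h a n) => //.
  - by rewrite En'.
  - by move: LB; rewrite -En'.
  - by move=> j Hj; apply: Hacc; rewrite mem_iota.
by apply: (@disj u); rewrite Hu.
Qed.

Variable n0 : nat.
Hypothesis Hn0 : forall n, n0 <= n -> size (self_delim (inst n)) <= 2 ^ len eT n.

Definition axiom n := if n < n0 then FConst true else sigma (inst n) n.

(** The proof of an axiom has its index n in unary, so a translation into P-proofs takes time
    polynomial in n. *)
Definition extended (q : bitstring) : bitstring :=
  if head false q then formula_code (axiom (size (behead q))) else P (behead q).

Lemma fp_inst X {eX : encT X} (n : X -> nat) : fp n -> fp (fun x => Str (inst (n x))).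
Proof.
move=> Hn; have HL := fp_trunc_log Hn; apply: (fp_code (f := fun x => (tableau_sys MM, binary (n x)) : instT)).
by rewrite /binary; fpa.
Qed.

Lemma extended_system : proof_system extended.
Proof.
split.
  apply: fp_polytime.
  have Hb : fp (fun s : str => Str (behead (unstr s))) by apply: (fp_Str (l := fun s : str => behead (unstr s))); fpa.
  have HPp := polytime_fp HP Hb.
  have Hn : fp (fun s : str => size (behead (unstr s))) by fpa.
  have HS := fp_sigma (fp_inst Hn) Hn.
  pose F s := formula_code (sigma (inst (size (behead (unstr s)))) (size (behead (unstr s)))) : seq bool.
  have {}HS : fp F by [].
  pose G s := Str (P (behead (unstr s))); have {}HPp : fp G by [].
  apply: (@fp_ext _ _ _ _ (fun s : str => if head false (unstr s) then
      (if size (behead (unstr s)) < n0 then Str [:: false; false; true] else Str (F s)) else G s)).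
    apply: fp_if; [by fpa| |by []].
    by apply: fp_if; [by fpa|exact: fp_const|exact: (fp_Str (l := F))].
  by move=> s; rewrite /extended /axiom; do !case: ifP => //.
apply/seteqP; split=> [_ [q _ <-]|x]; last first.
  by rewrite -RP => -[pi _ <-]; exists (false :: pi).
rewrite /extended; case: ifP => _; last by rewrite -RP; exists (behead q).
exists (axiom (size (behead q))) => //; rewrite /mkset /axiom.
by case: ltnP => [|/Hn0/sigma_tautology].
Qed.
End Goedel.

(** * Polylogarithmic sizes *)

Definition polylog (f : nat -> nat) := exists g, polyb g /\ forall n, f n <= g (trunc_log 2 n).

Lemma polylog_leq f g : polylog g -> (forall n, f n <= g n) -> polylog f.
Proof. by move=> [q [Pq H]] L; exists q; split=> // n; apply: leq_trans (L n) (H n). Qed.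
Lemma polylog_const k : polylog (fun=> k).
Proof. by exists (fun=> k); split=> //; polyb. Qed.
Lemma polylog_log : polylog (trunc_log 2).
Proof. by exists id; split=> //; polyb. Qed.
Lemma polylog_add f g : polylog f -> polylog g -> polylog (fun n => f n + g n).
Proof. by move=> [q [Pq H]] [r [Pr L]]; exists (fun n => q n + r n); split=> [|n]; [polyb|rewrite leq_add]. Qed.
Lemma polylog_mul f g : polylog f -> polylog g -> polylog (fun n => f n * g n).
Proof. by move=> [q [Pq H]] [r [Pr L]]; exists (fun n => q n * r n); split=> [|n]; [polyb|rewrite leq_mul]. Qed.
Lemma polylog_comp f g : polyb g -> polylog f -> polylog (fun n => g (f n)).
Proof.
move=> /polyb_mono[g' [Pg Mg Lg]] [q [Pq H]]; exists (fun n => g' (q n)); split; first exact: polyb_comp.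
by move=> n; apply: leq_trans (Lg _) (Mg _ _ (H n)).
Qed.
Lemma polylog_exp f k : polylog f -> polylog (fun n => f n ^ k).
Proof. by apply: (polylog_comp (g := fun x => x ^ k)); polyb. Qed.
(** Spares all counting of gates: a polynomial-time construction applied to data of polylogarithmic
    size has a result of polylogarithmic size. *)
Lemma polylog_fp A B {eA : encT A} {eB : encT B} (F : A -> B) (a : nat -> A) :
  fp F -> polylog (fun n => esz (a n)) -> polylog (fun n => esz (F (a n))).
Proof.
move=> /fp_size[g [Pg _ Lg]] H; apply: polylog_leq (polylog_comp Pg H) _ => n; exact: Lg.
Qed.
Lemma polylog_cap f : polylog f -> exists N, forall n, N <= n -> f n <= cap n.
Proof. by move=> [g [/polylog_leq_cap[N HN] H]]; exists N => n /HN; apply: leq_trans. Qed.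
Lemma cap_leq n : cap n <= n.
Proof. exact: geq_minr. Qed.

Ltac polylog := repeat lazymatch goal with
  | |- polylog (fun _ => ?k) => exact: polylog_const
  | |- polylog (fun x => addn (@?f x) (@?g x)) => apply: (@polylog_add f g)
  | |- polylog (fun x => muln (@?f x) (@?g x)) => apply: (@polylog_mul f g)
  | |- polylog (fun x => expn (@?f x) ?k) => apply: (@polylog_exp f k)
  | |- polylog (fun x => trunc_log 2 x) => exact: polylog_log
  | |- _ => assumption
  end.

Lemma esz_mkpair A B (eA : encT A) (eB : encT B) (a : A) (b : B) : esz (a, b) = 2 * esz a + 1 + esz b.
Proof. exact: esz_pair. Qed.

Lemma raw_circ_esz n C : circuit_wf n C ->
  esz (raw_circ C) <= size C * (2 * (9 + 3 * (n + size C)) + 1).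
Proof.
move=> [_ W]; apply: leq_trans (@esz_leq _ _ _ (9 + 3 * (n + size C)) _) _; last by rewrite size_map.
rewrite size_map => i Hi d; rewrite (nth_map (GConst false)) //.
by have := W i Hi; case: (nth _ C i) => [j|[]|j|j k|j k] /=; rewrite !esz_pair !esz_nat /=; lia.
Qed.

Lemma size_self_delim w : size (self_delim w) = 2 * size w + 1.
Proof. by have := size_pair_code w [::]; rewrite /pair_code cats0 addn0. Qed.

Lemma esz_bitstring (w : bitstring) : esz w = 3 * size w.
Proof. by elim: w => // b w IH; rewrite esz_cons esz_bool IH /=; lia. Qed.

Lemma esz_nats m (l : seq nat) : all (fun a => a < m) l -> esz l <= size l * (2 * m + 1).
Proof.
move=> A; apply: esz_leq => i L d; rewrite esz_nat; apply: ltnW.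
exact: (allP A) (mem_nth _ L).
Qed.

(** Mirrors the nesting of pairs in [queryT], where first components count twice; the final
    successor makes every query length a valid index into [prv]. *)
Definition query_bound l eC N p d :=
  (2 * (2 * l + 1 + (2 * eC + 1 + p)) + 1 +
   (2 * (2 * (N * (2 * p + 1)) + 1 + N * (2 * p + 1)) + 1 + (2 * d + 1 + p))).+1.

Lemma query_size n0 C m w pre e c N d :
  size w = N -> all (fun a => a < m.+1) w -> size pre < N -> all (fun a => a < m.+1) pre ->
  e < d -> c < m.+1 ->
  size (prover_query n0 C m w pre e c) < query_bound n0 (esz C) N m.+1 d.
Proof.
move=> Sw Aw Sp Ap He Hc; rewrite /prover_query -/(esz _) /query_bound ltnS !esz_mkpair !esz_nat.
have := esz_nats Aw; have := esz_nats Ap; rewrite Sw => L1 L2.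
have L3 : size pre * (2 * m.+1 + 1) <= N * (2 * m.+1 + 1) by rewrite leq_mul2r (ltnW Sp) orbT.
move: (esz w) (esz pre) (esz C) (N * _) (size pre * _) L1 L2 L3 => x y z u v; lia.
Qed.

Section Header.
Variables (MM : machine) (input : nat -> bitstring) (eM : nat) (prime_above : nat -> nat).
Hypothesis prime_aboveP : forall X, 7 <= X -> prime (prime_above X) /\ X <= prime_above X <= X * X + X * X.
Variables (C1 C2 : nat -> circuit).
Hypotheses (W1 : forall n, circuit_wf n (C1 n)) (B1 : poly_bounded (fun n => size (C1 n))).
Hypothesis (E1 : forall x, tableau_lang MM input x <-> circuit_eval (C1 (size x)) x).
Hypotheses (W2 : forall n, circuit_wf n (C2 n)) (B2 : poly_bounded (fun n => size (C2 n))).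
Hypothesis (E2 : forall x, query_lang x <-> circuit_eval (C2 (size x)) x).

Local Notation sM := (tableau_sys MM).
Definition asg_pre n f := tableau_prefix f (binary n).
Definition asg n : raw_list :=
  [seq (asg_pre n f, raw_circ (C1 (size (asg_pre n f) + (len eM n + len eM n)))) | f <- iota 0 sM.1].
(** The circuit, the number of variables and the degree do not depend on the prover or the modulus.
    They are taken from this provisional header, since the number of bits, the modulus and the
    prover are chosen in terms of them. *)
Definition header0 n : headerT := (((sM, len eM n), (asg n, [::])), (0, 0)).
(** The 4 makes up for rounding down and also gives 2^bits >= 16, as [prime_between] needs at least
    7. *)
Definition bits_of n := trunc_log 2 (2 * hd_vars (header0 n) * hd_deg (header0 n)) + 4.
Definition mod_of n := (prime_above (2 ^ bits_of n)).-1.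
Definition prv_bound n := query_bound (4 * len eM n) (esz (hd_circ (header0 n))) (hd_vars (header0 n))
  (mod_of n).+1 (hd_deg (header0 n)).
Definition prv n := [seq raw_circ (C2 k) | k <- iota 0 (prv_bound n)].
Definition header n : headerT := (((sM, len eM n), (asg n, prv n)), (bits_of n, mod_of n)).

Lemma bits7 n : 7 <= 2 ^ bits_of n.
Proof. by rewrite /bits_of expnD -[2 ^ 4]/16; have := expn_gt0 2 (trunc_log 2 (2 * hd_vars (header0 n) * hd_deg (header0 n))); lia. Qed.

Lemma mod_prime n : prime (mod_of n).+1.
Proof. by have [pp _] := prime_aboveP (bits7 n); rewrite prednK // prime_gt0. Qed.

Lemma mod_geq n : 2 ^ bits_of n <= (mod_of n).+1.
Proof. by have [pp /andP[H _]] := prime_aboveP (bits7 n); rewrite prednK // prime_gt0. Qed.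

Lemma mod_leq n : mod_of n <= 2 ^ bits_of n * 2 ^ bits_of n + 2 ^ bits_of n * 2 ^ bits_of n.
Proof. by have [pp /andP[_ H]] := prime_aboveP (bits7 n); apply: leq_trans (leq_pred _) H. Qed.

Lemma exp_bits n : 2 ^ bits_of n <= 16 * (2 * hd_vars (header0 n) * hd_deg (header0 n) + 1).
Proof.
rewrite /bits_of expnD mulnC leq_mul2l /=; case: (2 * _ * _) => // k.
by apply: leq_trans (trunc_logP _ _) _ => //; rewrite leq_addr.
Qed.

Lemma geq_bits n : 2 * hd_vars (header0 n) * hd_deg (header0 n) <= 2 ^ bits_of n.
Proof.
set z := 2 * _ * _; apply: leq_trans (ltnW (trunc_log_ltn z (isT : 1 < 2))) _.
by rewrite leq_exp2l // /bits_of -/z; lia.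
Qed.

Lemma asgE n f t p : f < sM.1 -> size t = len eM n -> size p = len eM n ->
  dl_assignment (circ_list (asg n)) f t p = tableau_bit MM input n f t p.
Proof.
move=> Hf St Sp; rewrite /dl_assignment nth_circ_list (nth_map 0) ?size_iota // nth_iota // add0n [_.1]/= [_.2]/=.
rewrite raw_circK.
have -> : size (asg_pre n f) + (len eM n + len eM n) = size (asg_pre n f ++ t ++ p) by rewrite !size_cat St Sp.
have := tableau_langE MM input f (binary n) (etrans St (esym Sp)); rewrite bval_binary => H.
by apply/idP/idP => [/E1/H|/H/E1].
Qed.

Lemma lookupE n q : esz q < prv_bound n -> lookup (prv n) (enc (q : queryT)) = query_value q.
Proof.
move=> L; rewrite /lookup (nth_map 0) ?size_iota // nth_iota // add0n raw_circK.
have H := query_langE q.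
by apply/idP/idP => [/E2/H|/H/E2].
Qed.

Lemma polylog_len e : polylog (len e).
Proof. by rewrite /len; polylog. Qed.

Lemma polylog_asg : polylog (fun n => esz (asg n)).
Proof.
have [g1 [/poly_boundedE/polyb_mono[g [Pg Mg Lg]] Hg]] : exists g, poly_bounded g /\ forall n, size (C1 n) <= g n.
  by exists (fun n => size (C1 n)); split.
pose z n := 2 * (2 * sM.1 + 1 + 3 * (trunc_log 2 n).+1) + 1.
have Pz : polylog z.
  apply: (@polylog_leq _ (fun n => 2 * (2 * sM.1 + 1 + 3 * (trunc_log 2 n + 1)) + 1)); first by polylog.
  by move=> n; rewrite /z -[(trunc_log 2 n).+1]addn1.
have PL := polylog_len eM.
pose k n := z n + (len eM n + len eM n); have Pk : polylog k by rewrite /k; polylog.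
have Pgk := polylog_comp Pg Pk.
pose r n := 2 * (3 * z n) + 1 + g (k n) * (2 * (9 + 3 * (k n + g (k n))) + 1).
have Pr : polylog r by rewrite /r; polylog.
apply: (@polylog_leq _ (fun n => sM.1 * (2 * r n + 1))); first by polylog.
move=> n; apply: leq_trans (@esz_leq _ _ _ (r n) _) _; last by rewrite size_map size_iota.
rewrite size_map size_iota => f Hf d; rewrite (nth_map 0) ?size_iota // nth_iota // add0n.
have Sz : size (asg_pre n f) <= z n.
  rewrite /asg_pre /tableau_prefix; rewrite size_self_delim -/(esz _) esz_mkpair esz_nat esz_bitstring size_binary /z; move: (trunc_log 2 n) Hf => j; lia.
rewrite esz_mkpair esz_bitstring /r; set q := size (asg_pre n f) + _.
have Lq : q <= k n by rewrite /q /k leq_add2r.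
have Lc : size (C1 q) <= g (k n) by apply: leq_trans (Hg _) (leq_trans (Lg _) (Mg _ _ Lq)).
have W : esz (raw_circ (C1 q)) <= g (k n) * (2 * (9 + 3 * (k n + g (k n))) + 1).
  apply: leq_trans (raw_circ_esz (W1 q)) _; apply: leq_mul => //.
  by rewrite leq_add2r leq_mul2l /= leq_add2l leq_mul2l /= leq_add.
by apply: leq_add W; rewrite leq_add2r leq_mul2l /= leq_mul2l /=.
Qed.

Lemma polylog_header0 : polylog (fun n => esz (header0 n)).
Proof.
have H1 := polylog_asg; have H2 := polylog_len eM.
apply: (@polylog_leq _ (fun n => 2 * (2 * (2 * esz sM + 1 + len eM n) + 1 + (2 * esz (asg n) + 1 + 0)) + 1 + 1)); first by polylog.
by move=> n; rewrite /header0 !esz_mkpair !esz_nat.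
Qed.

Lemma polylog_circ : polylog (fun n => esz (hd_circ (header0 n))).
Proof. by apply: (polylog_fp (F := hd_circ)) polylog_header0; apply: (fp_hd_circ (h := fun h => h)); exact: fp_id. Qed.
Lemma polylog_vars : polylog (fun n => hd_vars (header0 n)).
Proof.
apply: (@polylog_leq _ (fun n => esz (hd_vars (header0 n)))); last by move=> n; rewrite esz_nat.
by apply: (polylog_fp (F := hd_vars)) polylog_header0; apply: (fp_hd_vars (h := fun h => h)); exact: fp_id.
Qed.
Lemma polylog_deg : polylog (fun n => hd_deg (header0 n)).
Proof.
apply: (@polylog_leq _ (fun n => esz (hd_deg (header0 n)))); last by move=> n; rewrite esz_nat.
by apply: (polylog_fp (F := hd_deg)) polylog_header0; apply: (fp_hd_deg (h := fun h => h)); exact: fp_id.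
Qed.

Lemma polylog_exp_bits : polylog (fun n => 2 ^ bits_of n).
Proof.
have H1 := polylog_vars; have H2 := polylog_deg.
by apply: (@polylog_leq _ (fun n => 16 * (2 * hd_vars (header0 n) * hd_deg (header0 n) + 1))); [polylog|exact: exp_bits].
Qed.
Lemma polylog_bits : polylog bits_of.
Proof. by apply: polylog_leq polylog_exp_bits _ => n; apply: ltnW; apply: ltn_expl. Qed.
Lemma polylog_mod : polylog mod_of.
Proof. by have H := polylog_exp_bits; apply: polylog_leq mod_leq; polylog. Qed.
Lemma polylog_prv_bound : polylog prv_bound.
Proof.
have H1 := polylog_vars; have H2 := polylog_deg; have H3 := polylog_circ; have H4 := polylog_mod; have H5 := polylog_len eM.
rewrite /prv_bound /query_bound.
pose m n := mod_of n + 1; have Hm : polylog m by rewrite /m; polylog.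
have E n : (mod_of n).+1 = m n by rewrite /m addn1.
apply: (@polylog_leq _ (fun n =>
  (2 * (2 * (4 * len eM n) + 1 + (2 * esz (hd_circ (header0 n)) + 1 + m n)) + 1 +
   (2 * (2 * (hd_vars (header0 n) * (2 * m n + 1)) + 1 + hd_vars (header0 n) * (2 * m n + 1)) + 1 + (2 * hd_deg (header0 n) + 1 + m n))) + 1)); first by polylog.
by move=> n; rewrite E [X in _ <= X]addn1.
Qed.

Lemma polylog_prv : polylog (fun n => esz (prv n)).
Proof.
have [g1 [/poly_boundedE/polyb_mono[g [Pg Mg Lg]] Hg]] : exists g, poly_bounded g /\ forall n, size (C2 n) <= g n.
  by exists (fun n => size (C2 n)); split.
have PK := polylog_prv_bound; have PgK := polylog_comp Pg PK.
pose r n := g (prv_bound n) * (2 * (9 + 3 * (prv_bound n + g (prv_bound n))) + 1).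
have Pr : polylog r by rewrite /r; polylog.
apply: (@polylog_leq _ (fun n => prv_bound n * (2 * r n + 1))); first by polylog.
move=> n; apply: leq_trans (@esz_leq _ _ _ (r n) _) _; last by rewrite size_map size_iota.
rewrite size_map size_iota => k Hk d; rewrite (nth_map 0) ?size_iota // nth_iota // add0n.
have Lc : size (C2 k) <= g (prv_bound n) by apply: leq_trans (Hg _) (leq_trans (Lg _) (Mg _ _ (ltnW Hk))).
apply: leq_trans (raw_circ_esz (W2 k)) _; apply: leq_mul => //.
by rewrite leq_add2r leq_mul2l /= leq_add2l leq_mul2l /= leq_add // ltnW.
Qed.

Lemma polylog_header : polylog (fun n => esz (header n)).
Proof.
have H1 := polylog_asg; have H2 := polylog_len eM; have H3 := polylog_prv; have H4 := polylog_bits; have H5 := polylog_mod.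
apply: (@polylog_leq _ (fun n => 2 * (2 * (2 * esz sM + 1 + len eM n) + 1 + (2 * esz (asg n) + 1 + esz (prv n))) + 1 +
  (2 * bits_of n + 1 + mod_of n))); first by polylog.
by move=> n; rewrite /header !esz_mkpair !esz_nat.
Qed.

Lemma polylog_block : polylog (fun n => block_size (header n)).
Proof.
have H1 := polylog_vars; have H2 := polylog_bits.
apply: (@polylog_leq _ (fun n => hd_vars (header0 n) * bits_of n + hd_vars (header0 n) * bits_of n)); first by polylog.
by move=> n.
Qed.

Lemma header_accepts n y :
  holds sM (len eM n) (tableau_bit MM input n) -> accept (header n) y.
Proof.
move=> H; apply: accept_complete.
- exact: mod_prime.
- exact: mod_geq.
- exact: tableau_sys_uniq.
- exact: tableau_sys_sizes.
- move=> x Sx; apply/negP => Hx.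
  have := (hd_circ_sat (header n)).1 (ex_intro2 _ _ x Sx Hx); apply=> t p t' p' St Sp St' Sp'.
  have E u v : size u = len eM n -> size v = len eM n -> letter_bits sM.1 (dl_assignment (circ_list (asg n))) u v =
     letter_bits sM.1 (tableau_bit MM input n) u v.
    by move=> Su Sv; apply/eq_in_map => f; rewrite mem_iota add0n => /andP[_ Hf]; apply: asgE.
  by have := H t p t' p' St Sp St' Sp'; rewrite /pair_word -!E.
move=> w pre e c Sw Aw Sp Ap He Hc; apply: lookupE.
exact: (query_size _ _ Sw Aw Sp Ap He Hc).
Qed.

Lemma header_starts n xs : starts_with xs (len eM n) (tableau_bit MM input n) ->
  starts_with xs (len eM n) (dl_assignment (circ_list (asg n))).
Proof.
by move=> H i Hi; have [H1 H2] := H i Hi; split; rewrite asgE ?size_bits.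
Qed.
End Header.

Local Open Scope nat_scope.
Local Open Scope classical_set_scope.

(** * The generator hits every infinite NP set *)

Lemma infinite_unbounded (A : language) N : infinite_set A -> exists2 a, A a & N < size a.
Proof.
move=> infA; apply: contrapT => H; apply: infA.
apply: (@sub_finite_set _ _ [set` flatten [seq words k | k <- iota 0 N.+1]]); last exact: finite_seq.
move=> a Aa; rewrite /mkset; apply/flattenP; exists (words (size a)); last by rewrite mem_words.
apply: map_f; rewrite mem_iota add0n ltnS; case: (leqP (size a) N) => // L; by case: H; exists a.
Qed.

Lemma block_size_gt0 h : 0 < hd_bits h -> 0 < block_size h.
Proof.
by move=> b0; rewrite /block_size addn_gt0 muln_gt0 b0 andbT /hd_vars /hd_circ /viol_circ size_rcons addnS.
Qed.

(** f will translate [true :: nseq n true], a proof of the axiom in [extended], into a P-proof. *)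
Definition goedel_input (f : bitstring -> bitstring) MM n : bitstring :=
  pair_code (inst MM n) (enc ((Str (nseq n true), Str (f (true :: nseq n true))) : str * str)).

Definition test_input MM n (h : headerT) (a w : bitstring) : bitstring :=
  pair_code (inst MM n) (enc ((h, (Str a, Str w)) : witT)).

Lemma test_inputE V c MM n h a w : test V c (test_input MM n h a w) = test_with V c (inst MM n) h a w.
Proof.
rewrite /test /test_input pfst_pair psnd_pair.
by have -> : wit_of (enc ((h, (Str a, Str w)) : witT)) = (h, (Str a, Str w)) by exact: encK.
Qed.

Lemma size_test_input MM n h a w : size (test_input MM n h a w) =
  2 * size (inst MM n) + 1 + (2 * esz h + 1 + (2 * size a + 1 + size w)).
Proof. by rewrite /test_input size_pair_code -/(esz _) !esz_mkpair !esz_str. Qed.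

Lemma refutes_input P MT eT f MM n :
  P (f (true :: nseq n true)) = formula_code (sigma MT eT (inst MM n) n) ->
  refutes P MT eT (goedel_input f MM n).
Proof.
move=> H; rewrite /refutes /goedel_input pfst_pair psnd_pair inst_ofK.
have -> : proof_of (enc ((Str (nseq n true), Str (f (true :: nseq n true))) : str * str)) =
  (Str (nseq n true), Str (f (true :: nseq n true))) by exact: encK.
change ((cval_cap (size (nseq n true)).+1 (binary n) == size (nseq n true)) &&
  (P (f (true :: nseq n true)) == formula_code (sigma MT eT (inst MM n) (size (nseq n true))))).
by rewrite size_nseq cval_cap_min bval_binary (minn_idPl (leqnSn n)) H !eqxx.
Qed.

Lemma generator_hits_NP (P : bitstring -> bitstring) (A : language) :
  p_optimal P -> class_E `<=` class_Ppoly -> class_NP A -> infinite_set A ->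
  exists u, A (generator u).
Proof.
move=> [[PP RP] Popt] HE [V [c [HV HAV]]] infA; apply: contrapT => Nd.
have disj u : ~ A (generator u) by move=> H; apply: Nd; exists u.
have HA a w : size w <= size a ^ c + c -> V (pair_code a w) -> A a.
  by move=> Sw Vw; apply/HAV; exists w.
have [MT [tT [/poly_boundedE[e0 He0] HMT]]] : polytime (fun z => [:: test V c z]).
  apply: fp_polytime; apply: (fp_Str (l := fun s : str => [:: test V c (unstr s)])).
  by have H := fp_test c HV; apply: fp_cons => //; exact: fp_const.
(* A bound on the length of [test_input]. It may not mention MM or the header, which are built after
   eT; for large n the header and the code of [inst n] have length at most n. *)
pose qz n := 2 * n + 1 + (2 * n + 1 + (2 * (n + 1) + 1 + ((n + 1) ^ c + c))).
(* The last row of the grid is at time 2^len - 1, hence the 1; the n leaves room for the prescribed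
   prefix. *)
have [eT HeT] : polyb (fun n => (qz n + 2) ^ e0 + 1 + n) by rewrite /qz; polyb.
have {}HeT n : (qz n + 2) ^ e0 + 1 + n <= 2 ^ len eT n by apply: leq_trans (HeT n) (exp_len_geq _ _).
have [MM [tM [/poly_boundedE/polyb_mono[tM' [PtM MtM LtM]] HMM]]] : polytime (fun z => [:: refutes P MT eT z]).
  apply: fp_polytime; apply: (fp_Str (l := fun s : str => [:: refutes P MT eT (unstr s)])).
  by have H := fp_refutes MT eT PP; apply: fp_cons => //; exact: fp_const.
have Hinst : polylog (fun n => 2 * size (inst MM n) + 1).
  apply: (@polylog_leq _ (fun n => 2 * (2 * esz (tableau_sys MM) + 1 + 3 * (trunc_log 2 n + 1)) + 1)); first by polylog.
  by move=> n; rewrite /inst -/(esz _) esz_mkpair esz_bitstring size_binary -[(trunc_log 2 n).+1]addn1.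
have [n0 Hn0] := polylog_cap Hinst.
have {}Hn0 n : n0 <= n -> size (self_delim (inst MM n)) <= n.
  by move=> /Hn0 H; rewrite size_self_delim (leq_trans H) // cap_leq.
have HnT n : n0 <= n -> size (self_delim (inst MM n)) <= 2 ^ len eT n.
  by move=> /Hn0 H; apply: leq_trans H (leq_trans (leq_addl _ _) (HeT n)).
have [f [Pf Hf]] := Popt _ (extended_system PP RP HA disj HMT HMM HnT).
pose zM := goedel_input f MM.
have Hz : fp (fun n : nat => Str (zM n)).
  have Hu : fp (fun n : nat => Str (true :: nseq n true)) by apply: (fp_Str (l := fun n : nat => true :: nseq n true)); fpa.
  have Hu' : fp (fun n : nat => Str (nseq n true)) by apply: (fp_Str (l := fun n : nat => nseq n true)); fpa.
  have Hfu := polytime_fp Pf Hu.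
  have Hy := fp_code (fp_pair Hu' Hfu).
  have Hx := fp_inst MM (@fp_id nat _).
  apply: (fp_Str (l := fun n : nat => zM n : seq bool)).
  by apply: fp_pair_code; [exact: (fp_unstr Hx) | exact: (fp_unstr Hy)].
have Rz n : n0 <= n -> refutes P MT eT (zM n).
  by move=> Ln; apply: refutes_input; rewrite Hf /extended /= size_nseq /axiom ltnNge Ln.
have [g [Pg _ Lg]] := fp_size Hz.
have {}Lg n : size (zM n) <= g n by have := Lg n; rewrite esz_nat.
(* Here the exponent may depend on f and MM, hence on eT: the test meets it only through the
   header. *)
have [eM HeM] : polyb (fun n => tM' (g n) + g n + 1) by polyb; apply: polyb_comp.
have {}HeM n : tM' (g n) + g n + 1 <= 2 ^ len eM n by apply: leq_trans (HeM n) (exp_len_geq _ _).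
have HnM n : size (self_delim (inst MM n)) <= 2 ^ len eM n.
  apply: (@leq_trans (size (zM n))); first by rewrite /zM /goedel_input /pair_code [X in _ <= X]size_cat leq_addr.
  by apply: leq_trans (Lg n) (leq_trans _ (HeM n)); rewrite addnAC leq_addl.
have holdsM n : n0 <= n -> holds (tableau_sys MM) (len eM n) (tableau_bit MM zM n) /\
    starts_with (self_delim (inst MM n)) (len eM n) (tableau_bit MM zM n).
  move=> Ln; have [|H1 H2] := accepting_complete (N := (2 ^ len eM n).-1) HMM (Rz n Ln).
    apply: leq_trans (LtM _) _; apply: leq_trans (MtM _ _ (Lg n)) _.
    rewrite -ltnS prednK ?expn_gt0 //; apply: leq_trans (HeM n).
    by rewrite -addnA -[X in X < _]addn0 ltn_add2l addn1.
  by apply: (tableau_complete H1 H2); [rewrite /zM /goedel_input; exact: prefix_prefix | exact: HnM].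
have [C1 [W1 B1 E1]] := HE _ (tableau_lang_E MM Hz).
have [C2 [W2 B2 E2]] := HE _ query_lang_E.
have [pa Hpa] : exists pa : nat -> nat, forall X, 7 <= X -> prime (pa X) /\ X <= pa X <= X * X + X * X.
  suff /choice[pa H] : forall X, exists p, 7 <= X -> prime p /\ X <= p <= X * X + X * X by exists pa.
  move=> X; case: (leqP 7 X) => [/prime_between[p pp Hp]|_]; first by exists p.
  by exists 0.
pose h n := header MM eM pa C1 C2 n.
have PH : polylog (fun n => esz (h n)) by apply: polylog_header.
have PB : polylog (fun n => block_size (h n)) by apply: polylog_block.
(* One inequality for three needs: blocks within the cap, all B blocks within a, and a header of
   length at most n. *)
have [N HN] : exists N, forall n, N <= n -> (2 * esz (h n) + 2) * (block_size (h n) + 1) <= cap n.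
  by apply: polylog_cap; polylog.
have [a Aa La] := infinite_unbounded (N + n0 + 1) infA.
pose n := (size a).-1.
have Sa : size a = n.+1 by rewrite prednK //; apply: leq_ltn_trans La.
have Ln : n0 <= n by rewrite /n; move: La; lia.
have LN : N <= n by rewrite /n; move: La; lia.
have [w [Sw Vw]] := (HAV a).1 Aa.
have [HoM StM] := holdsM n Ln.
have Hb : block_size (h n) <= cap n.
  by apply: leq_trans (HN n LN); move: (block_size _) (esz _) => x y; nia.
have HB : (2 * esz (h n) + 2) * block_size (h n) <= n.+1.
  apply: leq_trans (leqW (cap_leq n)); apply: leq_trans (HN n LN).
  by rewrite leq_mul2l leq_addr orbT.
have Hh : esz (h n) <= n.
  apply: leq_trans (cap_leq n); apply: leq_trans (HN n LN).
  by move: (block_size _) (esz _) => x y; nia.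
pose z := test_input MM n (h n) a w.
have Tz : test V c z.
  rewrite /z test_inputE /test_with inst_ofK -/n.
  apply/and5P; split.
  - by apply/asboolP.
  - by rewrite Sa.
  - by rewrite Sa cval_cap_min bval_binary (minn_idPl (leqnSn n)).
  - exact: eqxx.
  rewrite is_primeE; apply/andP; split; first exact: (mod_prime MM eM Hpa C1).
  rewrite leq_pow2E !geq_pow2E; apply/and5P; split.
  - exact: (mod_geq MM eM Hpa C1).
  - exact: (geq_bits MM eM C1).
  - by apply/starts_checkP; apply: (header_starts (C1 := C1) E1 StM).
  - exact: HnM.
  apply/andP; split; first exact: Sw.
  apply/and4P; split.
  - by apply: block_size_gt0; rewrite /h /header /hd_bits /= /bits_of addnS.
  - exact: Hb.
  - exact: HB.
  by apply/allP => j _; apply: (header_accepts Hpa E1 E2 _ HoM).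
have Sz : size z <= qz n.
  rewrite /z size_test_input Sa /qz.
  have := Hn0 n Ln; rewrite size_self_delim.
  move: Sw; rewrite Sa -[n.+1]addn1; move: (esz (h n)) Hh (size (inst MM n)) (size w) (expn (n + 1) c) => j Hj i q r; lia.
(* The test accepts, so its tableau falsifies [sigma], which [sigma_tautology] shows to be a
   tautology. *)
have [|H1 H2] := accepting_complete (N := (2 ^ len eT n).-1) HMT Tz.
  apply: leq_trans (He0 _) _; apply: (@leq_trans ((qz n + 2) ^ e0)); first by rewrite leq_pow // leq_add2r.
  rewrite -ltnS prednK ?expn_gt0 //; apply: leq_trans (HeT n).
  by rewrite -addnA -[X in X < _]addn0 ltn_add2l.
have Pz : prefix (self_delim (inst MM n)) z by rewrite /z /test_input; exact: prefix_prefix.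
have := tableau_complete H1 H2 Pz (HnT n Ln); set v := (fun f t p => _) => Hv.
have T := sigma_tautology RP HA disj HMT HMM (HnT n Ln).
have := (sys_formula_eval (valuation_of v) (tableau_sys MT) (len eT n) (self_delim (inst MM n))).2.
rewrite valuation_ofK => /(_ Hv) E.
by have := T (valuation_of v); rewrite /sigma E.
Qed.

Theorem theorem3p1 :
  [\/ ~ (exists P : bitstring -> bitstring, p_optimal P),
      ~ (class_E `<=` class_Ppoly) |
      exists h : bitstring -> bitstring,
        [/\ forall u, size (h u) = size u + 1,
            computable_in subexp_bounded h &
            forall A : language, class_NP A -> infinite_set A ->
              range h `&` A !=set0]].
Proof.
have [[P HP]|NP] := pselect (exists P : bitstring -> bitstring, p_optimal P); last by apply: Or31.
have [HE|NE] := pselect (class_E `<=` class_Ppoly); last by apply: Or32.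
apply: Or33; exists generator; split.
- exact: size_generator.
- exact: generator_computable.
move=> A HA infA; have [u Au] := generator_hits_NP HP HE HA infA.
by exists (generator u); split=> //; exists u.
Qed.
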